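(* There exists an absolute constant $C>0$ such that the following holds. Let $d,K\in\mathbb{N}$ with $K\ge d$, and let $F$ be a probability distribution on $\mathbb{R}^d$ such that: (1) $F=qI+\sum_{m=1}^K p_mF_m$, where $q,p_1,\dots,p_K\in(0,1)$, $\sum_{m=1}^K p_m=1-q$, and $F_1,\dots,F_K$ are probability distributions on $\mathbb{R}^d$; (2) there exist non-zero vectors $\vec y_1,\dots,\vec y_K\in\mathbb{R}^d$ such that $\operatorname{supp}F_m\subset\{k\vec y_m: k\in\mathbb{Z}\setminus\{0\}\}$ for each $m$, and $\operatorname{supp}F_m\cap\operatorname{supp}F_k=\emptyset$ for $k\neq m$; (3) each $\operatorname{supp}F_m\ne\emptyset$ and $F_m\{k\vec y_m\}=F_m\{-k\vec y_m\}$ for $k\in\{1,2,\dots\}$, $m=1,\dots,K$; (4) for each $m$ there exists an integer $k_m^0$ such that $F_m\{k_m^0\vec y_m\}>0$ and $F_m\{(k_m^0+1)\vec y_m\}>0$. Let $\sigma_m^2=2\sum_{k=1}^\infty k^2F_m\{k\vec y_m\}$ and $D=\exp\big((F-I)-\tfrac12(F-I)^{*2}\big)$. Then, for any $n\in\mathbb{N}$, $$d_{TV}(F^{*n},D^{*n})\leq \frac{C}{n^2\,q^{13/2}}\left(\sum_{m=1}^K\sqrt{1+\sigma_m}\right)^3.$$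
   Context: $I$ is the distribution concentrated at $\vec 0\in\mathbb{R}^d$; $*$ is convolution of finite signed measures on $\mathbb{R}^d$; $M^{*j}$ is the $j$-fold convolution power, $M^{*0}=I$; $\exp(M)=\sum_{j\ge 0}M^{*j}/j!$. For finite signed measures of total mass one, $d_{TV}(M,V)=\frac12\|M-V\|_{TV}$, with $\|\cdot\|_{TV}$ the total variation norm (total mass of the variation measure). $\sigma_m\ge0$; if some $\sigma_m=\infty$ the right-hand side is understood as $+\infty$. *)

(* Defs.v *)
From HB Require Import structures.
From mathcomp Require Import all_boot all_order all_algebra.
From mathcomp Require Import all_classical all_reals all_analysis measurable_realfun.
From mathcomp Require Import lra.

Set Implicit Arguments.
Unset Strict Implicit.
Unset Printing Implicit Defensive.

Import Order.TTheory GRing.Theory Num.Theory.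
Import numFieldNormedType.Exports.

Local Open Scope classical_set_scope.
Local Open Scope ring_scope.
Local Open Scope ereal_scope.

(* Matrices, hence 'rV[R]_d, carry the Borel sigma-algebra of their topology. *)
Section borel_matrix.
Context (R : realType) (m n : nat).

Let borel0 : <<s @open 'M[R]_(m, n) >> set0.
Proof. exact: sigma_algebra0. Qed.

Let borelC A : <<s @open 'M[R]_(m, n) >> A -> <<s @open 'M[R]_(m, n) >> (~` A).
Proof. exact: sigma_algebraC. Qed.

Let borelU (F : (set 'M[R]_(m, n))^nat) :
  (forall i, <<s @open 'M[R]_(m, n) >> (F i)) ->
  <<s @open 'M[R]_(m, n) >> (\bigcup_i F i).
Proof. exact: sigma_algebra_bigcup. Qed.

HB.instance Definition _ := @isMeasurable.Build (sigma_display (@open 'M[R]_(m, n)))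
  'M[R]_(m, n) <<s @open 'M[R]_(m, n) >> borel0 borelC borelU.

End borel_matrix.

Lemma open_measurable_mx (R : realType) m n (U : set 'M[R]_(m, n)) :
  open U -> measurable U.
Proof. exact: sub_gen_smallest. Qed.

Lemma measurable_coord_mx (R : realType) m n (i : 'I_m) (j : 'I_n) :
  measurable_fun [set: 'M[R]_(m, n)] (fun A => A i j).
Proof.
apply: (measurability _ (RGenOpens.measurableE R)) => //.
move=> _ [_ [a [b ->] <-]]; rewrite setTI; apply: open_measurable_mx.
have /continuousP := @coord_continuous R m n i j; apply.
exact: interval_open.
Qed.

(* Every open set is a countable union of cubes with rational centre and
   radius, so measurability into the Borel matrices is coordinatewise. *)
Lemma measurable_fun_mx (R : realType) m n d (T : measurableType d)
    (f : T -> 'M[R]_(m, n)) :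
  (forall i j, measurable_fun [set: T] (fun x => f x i j)) ->
  measurable_fun [set: T] f.
Proof.
move=> mf; apply: (@measurability _ _ _ _ _ _ (@open 'M[R]_(m, n))) => //.
move=> _ [U oU <-]; rewrite setTI.
pose B (q : 'M[rat]_(m, n) * rat) : set 'M[R]_(m, n) :=
  [set A | forall i j, ball (ratr (q.1 i j) : R) (ratr q.2) (A i j)].
have -> : U = \bigcup_q (if `[< B q `<=` U >] then B q else set0).
  apply/seteqP; split=> [A UA|A [q _]]; last first.
    by case: asboolP => [qU /qU|].
  have /nbhs_ballP[e /= e0 eU] := open_nbhs_nbhs (conj oU UA).
  have [r /itvP re] := rat_in_itvoo (divr_gt0 e0 (ltr0Sn R 1)).
  have r0 : (0 < ratr r :> R)%R by rewrite re.
  have cA i j : {q : rat | ratr q \in `](A i j - ratr r)%R, A i j[%R}.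
    by apply: cid; have [|q qA] := @rat_in_itvoo R (A i j - ratr r)%R (A i j);
      [rewrite ltrBlDr ltrDl|exists q].
  pose c := (\matrix_(i, j) sval (cA i j))%R.
  have cB i j : ball (ratr (c i j) : R) (ratr r) (A i j).
    rewrite mxE; case: (cA i j) => q /= /itvP qA.
    by rewrite /ball /= distrC gtr0_norm ?subr_gt0 ?qA// ltrBlDr -ltrBlDl qA.
  exists (c, r) => //; case: asboolP => // -[] A' /= A'B.
  apply: eU; split=> // i j; have := A'B i j; have := cB i j.
  move=> /ball_sym /ball_triangle /[apply]; apply: le_ball.
  by rewrite [leRHS]splitr lerD// ltW// re.
rewrite preimage_bigcup; apply: countable_bigcupT_measurable => [|q].
  exact: countableP.
case: asboolP => _; last by rewrite preimage_set0.
rewrite (_ : _ @^-1` _ = \bigcap_(p : 'I_m * 'I_n)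
    ((fun x => f x p.1 p.2) @^-1` ball (ratr (q.1 p.1 p.2) : R) (ratr q.2))).
  rewrite -[X in measurable X]setCK setC_bigcap; apply: measurableC.
  apply: countable_bigcupT_measurable => // -[i j]; apply: measurableC => /=.
  by rewrite -[X in measurable X]setTI; apply: mf => //; exact: measurable_ball.
by apply/seteqP; split=> [x Bx [i j] _ /=|x Bx i j]; [exact: Bx|exact: (Bx (i, j))].
Qed.

Lemma measurable_addmx (R : realType) m n :
  measurable_fun [set: 'M[R]_(m, n) * 'M[R]_(m, n)] (fun z => z.1 + z.2)%R.
Proof.
apply: measurable_fun_mx => i j; under eq_fun do rewrite mxE.
apply: measurable_funD; apply: (measurableT_comp (measurable_coord_mx i j)).
  exact: measurable_fst.
exact: measurable_snd.
Qed.

Section finite_product_measure.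
Context d1 d2 (T1 : measurableType d1) (T2 : measurableType d2) (R : realType).
Variables (m1 : {finite_measure set T1 -> \bar R})
          (m2 : {finite_measure set T2 -> \bar R}).

(* An alias of the product measure, on which it is registered as finite. *)
Definition finite_product : set (T1 * T2)%type -> \bar R := m1 \x m2.

HB.instance Definition _ := Measure.on finite_product.

Let finite_product_fin : fin_num_fun finite_product.
Proof.
apply: lty_fin_num_fun; rewrite -setXTT [ltLHS]product_measure1E//.
by rewrite lte_mul_pinfty// ?fin_num_measure// ltey_eq fin_num_measure.
Qed.

HB.instance Definition _ := @Measure_isFinite.Build _ _ _
  finite_product finite_product_fin.

End finite_product_measure.

Section charge_ops.
Context d (T : measurableType d) (R : realType).
Implicit Types mu nu : {charge set T -> \bar R}.

Definition hahn_pos nu : set T := sval (cid (Hahn_decomposition nu)).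

Definition hahn_neg nu : set T :=
  sval (cid (svalP (cid (Hahn_decomposition nu)))).

Lemma hahn_posneg nu : hahn_decomposition nu (hahn_pos nu) (hahn_neg nu).
Proof. exact: svalP (cid (svalP (cid (Hahn_decomposition nu)))). Qed.

(* By [Hahn_decomposition_uniq], none of the notions below depends on the choice
   of a Hahn decomposition. *)
Definition charge_pos nu : {finite_measure set T -> \bar R} :=
  jordan_pos (hahn_posneg nu).

Definition charge_neg nu : {finite_measure set T -> \bar R} :=
  jordan_neg (hahn_posneg nu).

Definition charge_sub mu nu : {charge set T -> \bar R} := cadd mu (copp nu).

Definition tv_norm nu : \bar R := charge_variation (hahn_posneg nu) [set: T].

Definition d_TV mu nu : \bar R := (2^-1)%:E * tv_norm (charge_sub mu nu).

Lemma chargeE nu A : measurable A -> nu A = charge_pos nu A - charge_neg nu A.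
Proof.
by move=> mA; rewrite (jordan_decomp (hahn_posneg nu) mA) /cadd/= cscaleN1.
Qed.

Lemma tv_normE nu : tv_norm nu = charge_pos nu [set: T] + charge_neg nu [set: T].
Proof. by []. Qed.

Lemma tv_norm_hahn nu : tv_norm nu = nu (hahn_pos nu) - nu (hahn_neg nu).
Proof.
rewrite tv_normE /charge_pos /charge_neg/= jordan_posE jordan_negE.
by rewrite cjordan_posE cjordan_negE /crestr0 !mem_set// /crestr !setTI.
Qed.

Lemma tv_norm_fin_num nu : tv_norm nu \is a fin_num.
Proof. by rewrite tv_normE fin_numD !fin_num_measure. Qed.

Lemma tv_norm_ge0 nu : 0 <= tv_norm nu.
Proof. by rewrite tv_normE adde_ge0. Qed.

End charge_ops.

(* The product of two signed measures, as the bilinear extension of the product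
   of their Jordan parts. *)
Section charge_product.
Context d1 d2 (T1 : measurableType d1) (T2 : measurableType d2) (R : realType).
Variables (mu : {charge set T1 -> \bar R}) (nu : {charge set T2 -> \bar R}).

Definition charge_product : {charge set (T1 * T2)%type -> \bar R} :=
  charge_sub
    (cadd (charge_of_finite_measure (finite_product (charge_pos mu) (charge_pos nu)))
          (charge_of_finite_measure (finite_product (charge_neg mu) (charge_neg nu))))
    (cadd (charge_of_finite_measure (finite_product (charge_pos mu) (charge_neg nu)))
          (charge_of_finite_measure (finite_product (charge_neg mu) (charge_pos nu)))).

Lemma charge_productE X : charge_product X =
  (finite_product (charge_pos mu) (charge_pos nu) X +
   finite_product (charge_neg mu) (charge_neg nu) X) -
  (finite_product (charge_pos mu) (charge_neg nu) X +
   finite_product (charge_neg mu) (charge_pos nu) X).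
Proof. by []. Qed.

Lemma finite_productT (m1 : {finite_measure set T1 -> \bar R})
    (m2 : {finite_measure set T2 -> \bar R}) :
  finite_product m1 m2 [set: T1 * T2] = m1 [set: T1] * m2 [set: T2].
Proof. by rewrite -setXTT [LHS]product_measure1E. Qed.

Lemma charge_product_bound X Y : measurable X -> measurable Y ->
  charge_product X - charge_product Y <= tv_norm mu * tv_norm nu.
Proof.
move=> mX mY; rewrite !tv_normE ge0_muleDl// !ge0_muleDr// -!finite_productT.
rewrite !charge_productE.
have fin (m1 : {finite_measure set T1 -> \bar R})
    (m2 : {finite_measure set T2 -> \bar R}) : exists f : set (T1 * T2) -> R,
    forall Z, measurable Z -> [/\ finite_product m1 m2 Z = (f Z)%:E,
      (0 <= f Z)%R & (f Z <= f [set: T1 * T2])%R].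
  exists (fine \o finite_product m1 m2) => Z mZ /=; split.
  - by rewrite fineK// fin_num_measure.
  - exact: fine_ge0.
  - apply: fine_le; rewrite ?fin_num_measure//.
    by apply: le_measure; rewrite ?inE.
have mT : measurable [set: T1 * T2] by [].
have [pp Epp] := fin (charge_pos mu) (charge_pos nu).
have [nn Enn] := fin (charge_neg mu) (charge_neg nu).
have [pn Epn] := fin (charge_pos mu) (charge_neg nu).
have [np Enp] := fin (charge_neg mu) (charge_pos nu).
have [[-> _ ?] [-> ? _] [-> _ _]] := And3 (Epp X mX) (Epp Y mY) (Epp _ mT).
have [[-> _ ?] [-> ? _] [-> _ _]] := And3 (Enn X mX) (Enn Y mY) (Enn _ mT).
have [[-> ? _] [-> _ ?] [-> _ _]] := And3 (Epn X mX) (Epn Y mY) (Epn _ mT).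
have [[-> ? _] [-> _ ?] [-> _ _]] := And3 (Enp X mX) (Enp Y mY) (Enp _ mT).
by rewrite -!(EFinD, EFinN, EFinB) lee_fin; lra.
Qed.

End charge_product.

Section convolution.
Context (R : realType) (d : nat).
Local Notation V := 'rV[R]_d.
Implicit Types (mu nu : {charge set V -> \bar R}) (n : nat) (A : set V).

(* The unit [I] of convolution. *)
Definition charge_dirac0 : {charge set V -> \bar R} :=
  charge_of_finite_measure (\d_(0%R : V)).

Definition conv mu nu : set V -> \bar R :=
  pushforward (charge_product mu nu) (fun z : V * V => z.1 + z.2)%R.

HB.instance Definition _ mu nu := Charge.copy (conv mu nu)
  (measure_function_pushforward__canonical__charge_Charge
     (charge_product mu nu) (@measurable_addmx R 1 d)).

Fixpoint conv_pow mu n : {charge set V -> \bar R} :=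
  if n is n'.+1 then conv mu (conv_pow mu n') else charge_dirac0.

(* A setwise series; it converges absolutely, uniformly in [A], since
   [tv_norm (conv_pow mu j) <= tv_norm mu ^+ j]. *)
Definition conv_exp mu A : \bar R :=
  \sum_(0 <= j <oo) (j`!%:R^-1)%:E * conv_pow mu j A.

Lemma tv_norm_conv mu nu : tv_norm (conv mu nu) <= tv_norm mu * tv_norm nu.
Proof.
have [[mP _] [mN _] _ _] := hahn_posneg (conv mu nu).
rewrite tv_norm_hahn; apply: charge_product_bound;
  by rewrite -[X in measurable X]setTI; apply: measurable_addmx.
Qed.

Lemma tv_norm_dirac0 : tv_norm charge_dirac0 <= 1.
Proof.
have [[mP _] [mN _] _ _] := hahn_posneg charge_dirac0.
rewrite tv_norm_hahn -[leRHS]sube0; apply: leeB.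
  exact: probability_le1.
exact: measure_ge0.
Qed.

Lemma tv_norm_conv_pow mu n : tv_norm (conv_pow mu n) <= tv_norm mu ^+ n.
Proof.
elim: n => [|n ih]; first by rewrite expe0; exact: tv_norm_dirac0.
rewrite expeS; apply: (le_trans (tv_norm_conv _ _)).
by apply: lee_wpmul2l => //; exact: tv_norm_ge0.
Qed.

Let weight (j : nat) : {nonneg R} := (j`!%:R^-1)%:nng%R.

Let mass_lty mu (f : (\bar R)^nat) :
  (forall j, 0 <= f j <= (weight j)%:num%:E * tv_norm (conv_pow mu j)) ->
  \sum_(0 <= j <oo) f j < +oo.
Proof.
move=> fle; pose a := fine (tv_norm mu).
have aE : tv_norm mu = a%:E by rewrite fineK// tv_norm_fin_num.
have a0 : (0 <= a)%R by rewrite fine_ge0// tv_norm_ge0.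
apply: (@le_lt_trans _ _ (\sum_(0 <= j <oo) (exp_coeff a j)%:E)).
  apply: lee_nneseries => [j _ _|j _]; first by have /andP[] := fle j.
  have /andP[_ fj] := fle j; apply: (le_trans fj).
  rewrite /exp_coeff/= mulrC EFinM EFin_expe -aE.
  by apply: lee_wpmul2l; [rewrite lee_fin|exact: tv_norm_conv_pow].
rewrite (_ : \sum_(0 <= j <oo) _ = (limn (series (exp_coeff a)))%:E) ?ltry//.
rewrite -EFin_lim; last exact: is_cvg_series_exp_coeff.
by congr (limn _); apply/funext => k /=; rewrite sumEFin.
Qed.

Let pos_part mu j := mscale (weight j) (charge_pos (conv_pow mu j)).
Let neg_part mu j := mscale (weight j) (charge_neg (conv_pow mu j)).

Let pos_series mu := mseries (pos_part mu) 0.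
Let neg_series mu := mseries (neg_part mu) 0.

HB.instance Definition _ mu := Measure.on (pos_series mu).
HB.instance Definition _ mu := Measure.on (neg_series mu).

Let pos_series_fin mu : fin_num_fun (pos_series mu).
Proof.
apply: lty_fin_num_fun; apply: (@mass_lty mu) => j; rewrite measure_ge0/=.
by apply: lee_wpmul2l; rewrite ?lee_fin// tv_normE leeDl.
Qed.

Let neg_series_fin mu : fin_num_fun (neg_series mu).
Proof.
apply: lty_fin_num_fun; apply: (@mass_lty mu) => j; rewrite measure_ge0/=.
by apply: lee_wpmul2l; rewrite ?lee_fin// tv_normE leeDr.
Qed.

HB.instance Definition _ mu := @Measure_isFinite.Build _ _ _
  (pos_series mu) (pos_series_fin mu).
HB.instance Definition _ mu := @Measure_isFinite.Build _ _ _
  (neg_series mu) (neg_series_fin mu).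

Let conv_exp_chargeE mu A : measurable A -> conv_exp mu A =
  charge_sub (charge_of_finite_measure (pos_series mu))
             (charge_of_finite_measure (neg_series mu)) A.
Proof.
move=> mA; apply/cvg_lim => //.
rewrite [X in X @ \oo --> _](_ : _ = fun n =>
    \sum_(0 <= j < n) pos_part mu j A - \sum_(0 <= j < n) neg_part mu j A).
  apply: cvgeB; last 2 first.
  - by apply: is_cvg_nneseries => j _ _; exact: measure_ge0.
  - by apply: is_cvg_nneseries => j _ _; exact: measure_ge0.
  by apply: fin_num_adde_defr; exact: fin_num_measure.
apply/funext => n; rewrite -sumeN => [|i j _ _]; last first.
  by apply: fin_num_adde_defr; exact: fin_num_measure.
rewrite -big_split; apply: eq_bigr => j _ /=.
rewrite chargeE// muleBr//.
by apply: fin_num_adde_defr; exact: fin_num_measure.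
Qed.

Let conv_exp0 mu : conv_exp mu set0 = 0.
Proof. by rewrite conv_exp_chargeE// charge0. Qed.

Let conv_exp_fin mu A : measurable A -> conv_exp mu A \is a fin_num.
Proof. by move=> mA; rewrite conv_exp_chargeE// fin_num_measure. Qed.

Let conv_exp_sigma_additive mu : semi_sigma_additive (conv_exp mu).
Proof.
move=> F mF tF mUF; rewrite conv_exp_chargeE//.
under eq_fun do under eq_bigr do rewrite conv_exp_chargeE//.
exact: charge_semi_sigma_additive.
Qed.

HB.instance Definition _ mu := isCharge.Build _ _ _ (conv_exp mu)
  (conv_exp0 mu) (@conv_exp_fin mu) (@conv_exp_sigma_additive mu).

End convolution.

Section lattice_distributions.
Context (R : realType) (d : nat).
Local Notation V := 'rV[R]_d.

(* The topological support: the complement of the largest open null set. *)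
Definition msupport (mu : set V -> \bar R) : set V :=
  [set x | forall U : set V, open U -> U x -> 0 < mu U].

(* Possibly [+oo], since [\sum] and [sqrte] are extended-real valued. *)
Definition lattice_sigma (mu : set V -> \bar R) (y : V) : \bar R :=
  sqrte (2%:E * \sum_(1 <= k <oo) (k%:R ^+ 2)%:E * mu [set (k%:R *: y)%R]).

End lattice_distributions.

(* Main.v *)
(* Write A = F - I. Since D = exp (A - A^2/2), the difference F - D is A^3 times a
   bounded factor, so F^n - D^n is a sum of n terms F^j D^(n-1-j) A^3 r. Put
   c = q/4. As functions of G = (F - qI) / (1-q), the factors F exp (-cA) and
   D exp (-cA) are power bounded, with constant O(1/q): on the unit circle, with
   t = 1 - Re z, they are at most exp (-q(1-q)t/2) in modulus and their centred
   derivative is O((1-q)|z-1|), and an l1 norm is controlled by the L2 norms of a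
   function and of its derivative. What remains is exp (cnA) A^3, the cube of
   exp (cnA/3) A = exp (cnA/3) (sum_m p_m (F_m - I)), and each F_m contributes
   |(F_m - I) exp (la (F_m - I))| = O(sqrt sigma_m / la) with la = c n p_m / 3.
   This last bound is uniform because, for the real characteristic function f of
   F_m, the average of 1 / (1 + la (1 - f)) is O(1 / sqrt la): by convexity it is
   at most the value for a single pair {k, -k}, where the Poisson kernel computes it.

   After truncating and renormalising the F_m everything is a finite combination
   of translations, exp (cA) being replaced by
   prod_m (1 + (c/N) p_m (F_m - I))^N, exp (-cA) by (1 - cA/N)^N and D by
   (1 + (A - A^2/2)/N)^N with N large; averages over the circle become averages
   over roots of unity of large prime order. *)

Require Import Defs.
From HB Require Import structures.
From mathcomp Require Import all_boot all_order all_algebra.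
From mathcomp Require Import all_classical all_reals all_analysis.
From mathcomp Require Import measurable_realfun complex ring lra.

Set Implicit Arguments.
Unset Strict Implicit.
Unset Printing Implicit Defensive.

Import Order.TTheory GRing.Theory Num.Theory.
Import numFieldNormedType.Exports.

Local Open Scope classical_set_scope.
Local Open Scope ring_scope.

(** * Parseval's identity over roots of unity *)

(** All norm estimates go through one-variable polynomials: the value of a polynomial at a
    contraction is bounded by the l1 norm of its coefficients. Factors built from F alone are
    polynomials in [G]; those built from a single F_m are polynomials in the translation by y_m,
    once an invertible translation of norm one has cleared the negative powers. Hence neither the
    dimension nor the number of components enters a constant: in the product of the smoothing
    factors only the m-th one acts on F_m - I, the others are contractions, and the weight p_m of
    F_m - I in A cancels the p_m in la.

    The powers add up as follows. Each of the three smoothed factors A costs 1/(nq), each of the two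
    power bounded families costs 1/q, and there are n terms; the result is n^-2 q^-5, and q < 1
    turns this into the stated power of q.

    The group algebra contains no exponentials, only their binomial substitutes. All errors this
    causes are O(1/N), with constants that may depend on n and on the distributions, and N tends to
    infinity with everything else fixed. *)

Section circle.
Context (R : realType).
Implicit Types (z : R[i]) (h : {poly R}).

(** A modulus with values in [R]; the norm of [R[i]] itself is complex-valued. *)
Definition nc z : R := ComplexField.Normc.normc z.
Definition ev h z : R[i] := (map_poly (real_complex R) h).[z].
Definition versine z : R := 1 - complex.Re z.
Definition l1 h : R := \sum_(k < size h) `|h`_k|.

Lemma nc_ge0 z : 0 <= nc z.
Proof. by case: z => a b; rewrite sqrtr_ge0. Qed.

Lemma ncM z1 z2 : nc (z1 * z2) = nc z1 * nc z2.
Proof. exact: ComplexField.Normc.normcM. Qed.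

Lemma ncD z1 z2 : nc (z1 + z2) <= nc z1 + nc z2.
Proof. exact: le_normcD. Qed.

Lemma ncN z : nc (- z) = nc z.
Proof. exact: normcN. Qed.

Lemma nc1 : nc 1 = 1.
Proof. exact: ComplexField.Normc.normc1. Qed.

Lemma nc0 : nc 0 = 0.
Proof. exact: ComplexField.Normc.normc0. Qed.

Lemma ncX z n : nc (z ^+ n) = nc z ^+ n.
Proof. by elim: n => [|n ih]; rewrite ?expr0 ?nc1// !exprS ncM ih. Qed.

Lemma nc_sqr z : nc z ^+ 2 = complex.Re z ^+ 2 + complex.Im z ^+ 2.
Proof. by case: z => a b; rewrite sqr_sqrtr// addr_ge0 ?sqr_ge0. Qed.

Lemma nc_real (a : R) : nc a%:C%C = `|a|.
Proof. by rewrite /nc /= expr0n addr0 sqrtr_sqr. Qed.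

Lemma nc_sqrC z : (nc z ^+ 2)%:C%C = z * (z^*)%C.
Proof. by rewrite -sqr_normc -add_Re2_Im2 nc_sqr. Qed.

Lemma nc1_neq0 z : nc z = 1 -> z != 0.
Proof. by move=> z1; apply/eqP => z0; move: z1; rewrite z0 nc0 => /esym/eqP; rewrite oner_eq0. Qed.

Lemma evE h n z : (size h <= n)%N -> ev h z = \sum_(k < n) (h`_k)%:C%C * z ^+ k.
Proof.
move=> sh; rewrite /ev (@horner_coef_wide _ n) ?size_map_poly//.
by apply: eq_bigr => k _; rewrite coef_map.
Qed.

Lemma evM h1 h2 z : ev (h1 * h2) z = ev h1 z * ev h2 z.
Proof. by rewrite /ev rmorphM hornerM. Qed.
Lemma evD h1 h2 z : ev (h1 + h2) z = ev h1 z + ev h2 z.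
Proof. by rewrite /ev rmorphD hornerD. Qed.
Lemma evB h1 h2 z : ev (h1 - h2) z = ev h1 z - ev h2 z.
Proof. by rewrite /ev rmorphB hornerD hornerN. Qed.
Lemma ev_exp h n z : ev (h ^+ n) z = ev h z ^+ n.
Proof. by rewrite /ev rmorphXn horner_exp. Qed.
Lemma evC a z : ev a%:P z = a%:C%C.
Proof. by rewrite /ev map_polyC hornerC. Qed.
Lemma evX z : ev 'X z = z.
Proof. by rewrite /ev map_polyX hornerX. Qed.
Lemma evZ a h z : ev (a *: h) z = a%:C%C * ev h z.
Proof. by rewrite -mul_polyC evM evC. Qed.
Lemma ev1 z : ev 1 z = 1.
Proof. by rewrite evC. Qed.
Lemma ev_sum (I : Type) (s : seq I) (P : pred I) (F : I -> {poly R}) z :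
  ev (\sum_(i <- s | P i) F i) z = \sum_(i <- s | P i) ev (F i) z.
Proof. by rewrite /ev rmorph_sum horner_sum. Qed.

Section roots.
Context (M : nat) (w : R[i]) (wM : M.-primitive_root w).

Lemma prim_gt0 : (0 < M)%N. Proof. exact: prim_order_gt0 wM. Qed.

Lemma nc_prim : nc w = 1.
Proof.
apply/eqP; rewrite -(pexpr_eq1 prim_gt0) ?nc_ge0//.
by rewrite -ncX (prim_expr_order wM) nc1.
Qed.

Lemma nc_root i : nc (w ^+ i) = 1.
Proof. by rewrite ncX nc_prim expr1n. Qed.

(** Conjugation inverts [w], so this is a geometric sum of ratio [w ^+ k / w ^+ l], an [M]-th root
    of unity other than [1] when [k != l]. *)
Lemma sum_root_ortho (k l : 'I_M) :
  \sum_(i < M) (w ^+ i) ^+ k * (((w ^+ i)^*)%C) ^+ l = (M * (k == l))%:R.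
Proof.
have wC : (w^*)%C = w^-1.
  have w0 := nc1_neq0 nc_prim.
  by apply: (mulfI w0); rewrite divff// -nc_sqrC nc_prim expr1n.
pose u := w ^+ k / w ^+ l.
have -> : \sum_(i < M) (w ^+ i) ^+ k * (((w ^+ i)^*)%C) ^+ l = \sum_(i < M) u ^+ i.
  apply: eq_bigr => i _; rewrite rmorphXn /= wC exprMn_comm; last exact: mulrC.
  by rewrite -!exprM -!exprVn -!exprM [(i * k)%N]mulnC [(i * l)%N]mulnC.
have uM : u ^+ M = 1.
  by rewrite expr_div_n -!exprM !(mulnC _ M) !exprM (prim_expr_order wM) !expr1n divr1.
have wl0 := nc1_neq0 (nc_root l).
have [kl|kl] := eqVneq k l.
  rewrite /u kl divff//; under eq_bigr do rewrite expr1n.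
  by rewrite sumr_const card_ord muln1.
have u1 : u - 1 != 0.
  rewrite subr_eq0; apply: contra_neq kl => u1.
  have : w ^+ k == w ^+ l by rewrite -(mulfVK wl0 (w ^+ k)) -/u u1 mul1r.
  by rewrite (eq_prim_root_expr wM) !modn_small// => /eqP kl; apply/val_inj.
by rewrite muln0; apply: (mulfI u1); rewrite -subrX1 uM subrr mulr0.
Qed.

Lemma parseval h : (size h <= M)%N ->
  \sum_(i < M) nc (ev h (w ^+ i)) ^+ 2 = M%:R * \sum_(k < M) h`_k ^+ 2.
Proof.
move=> sh; apply: (@complexI R); rewrite rmorph_sum rmorphM rmorph_sum rmorph_nat /=.
have E i : (nc (ev h (w ^+ i)) ^+ 2)%:C%C = \sum_(k < M) \sum_(l < M)
    (h`_k * h`_l)%:C%C * ((w ^+ i) ^+ k * (((w ^+ i)^*)%C) ^+ l).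
  rewrite nc_sqrC (evE _ sh) mulr_suml; apply: eq_bigr => k _.
  rewrite rmorph_sum mulr_sumr; apply: eq_bigr => l _ /=.
  rewrite rmorphM mulrACA; congr (_ * (_ * _)); last by rewrite -rmorphXn.
  by rewrite rmorphM; congr (_ * _); exact: conjc_real.
under eq_bigr do rewrite E.
rewrite exchange_big mulr_sumr; apply: eq_bigr => k _ /=.
rewrite exchange_big /=.
under eq_bigr do rewrite -mulr_sumr sum_root_ortho.
rewrite (bigD1 k)//= big1 ?addr0 => [|l lk].
  by rewrite eqxx muln1 mulrC expr2.
by rewrite eq_sym (negPf lk) muln0 mulr0.
Qed.

(** The Euler operator minus [mu] multiplies the [k]-th coefficient by [k - mu], so its mean square
    measures the spread of the coefficients around [mu]. *)
Lemma parseval_deriv h (mu : R) : (size h <= M)%N ->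
  \sum_(i < M) nc (ev ('X * h^`() - mu *: h) (w ^+ i)) ^+ 2 =
  M%:R * \sum_(k < M) (k%:R - mu) ^+ 2 * h`_k ^+ 2.
Proof.
move=> sh; rewrite parseval; last first.
  apply: (leq_trans (size_polyD _ _)); rewrite geq_max size_polyN.
  rewrite (leq_trans (size_scale_leq _ _) sh) andbT.
  apply: (leq_trans (size_polyMleq _ _)); rewrite size_polyX /=.
  have [->|h0] := eqVneq h 0; first by rewrite deriv0 size_poly0 prim_gt0.
  by apply: leq_trans sh; exact: lt_size_deriv.
congr (_ * _); apply: eq_bigr => k _; rewrite -exprMn coefB coefZ coefXM coef_deriv.
by case: k => [[|k] kM] /=; rewrite ?mulrBl ?mul0r ?mulr_natl.
Qed.

End roots.
End circle.

(** * Bounding the l1 norm by circle averages *)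

Section l1_norm.
Context (R : realType).
Implicit Types (h : {poly R}).

Lemma l1E h n : (size h <= n)%N -> l1 h = \sum_(k < n) `|h`_k|.
Proof.
move=> hn; rewrite /l1 (big_ord_widen n (fun k => `|h`_k|) hn).
rewrite [RHS](bigID (fun k : 'I_n => (k < size h)%N)) /=.
rewrite [X in _ = _ + X]big1 ?addr0// => k; rewrite -leqNgt => hk.
by rewrite nth_default// normr0.
Qed.

Lemma l1_ge0 h : 0 <= l1 h.
Proof. exact: sumr_ge0. Qed.

(** Lagrange's identity: the gap between the two sides is half the double sum of
    [w i * w j * (a i * b j - a j * b i) ^+ 2]. *)
Lemma weighted_CS (I : finType) (w a b : I -> R) : (forall i, 0 <= w i) ->
  (\sum_i w i * a i * b i) ^+ 2 <=
  (\sum_i w i * a i ^+ 2) * (\sum_i w i * b i ^+ 2).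
Proof.
move=> w0; set T := \sum_i w i * a i * b i; set U := \sum_i w i * a i ^+ 2.
set V := \sum_i w i * b i ^+ 2.
have : 0 <= \sum_i \sum_j w i * w j * (a i * b j - a j * b i) ^+ 2.
  by apply: sumr_ge0 => i _; apply: sumr_ge0 => j _; apply: mulr_ge0; [exact: mulr_ge0|exact: sqr_ge0].
suff -> : \sum_i \sum_j w i * w j * (a i * b j - a j * b i) ^+ 2 =
    2 * (U * V - T ^+ 2) by rewrite pmulr_rge0// subr_ge0.
have E i : \sum_j w i * w j * (a i * b j - a j * b i) ^+ 2 =
    w i * a i ^+ 2 * V + w i * b i ^+ 2 * U - 2 * (w i * a i * b i) * T.
  rewrite /U /V /T !mulr_sumr -big_split -sumrB /=.
  by apply: eq_bigr => j _; ring.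
under eq_bigr do rewrite E.
by rewrite sumrB big_split -!mulr_suml -mulr_sumr /= -/T -/U -/V; ring.
Qed.

Lemma sqr_sum_le (I : finType) (a om : I -> R) : (forall i, 0 < om i) ->
  (\sum_i a i) ^+ 2 <= (\sum_i om i * a i ^+ 2) * (\sum_i (om i)^-1).
Proof.
move=> om0; have om1 i : om i != 0 by rewrite gt_eqF.
have e1 : \sum_i a i = \sum_i (om i)^-1 * (om i * a i) * 1.
  by apply: eq_bigr => i _; rewrite mulKf// mulr1.
have e2 : \sum_i om i * a i ^+ 2 = \sum_i (om i)^-1 * (om i * a i) ^+ 2.
  by apply: eq_bigr => i _; rewrite exprMn expr2 -mulrA mulKf.
have e3 : \sum_i (om i)^-1 = \sum_i (om i)^-1 * 1 ^+ 2.
  by apply: eq_bigr => i _; rewrite expr1n mulr1.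
rewrite e1 e2 [X in _ <= _ * X]e3.
by apply: weighted_CS => i; rewrite invr_ge0 ltW.
Qed.

(* [x / (b + |x|)] is an increasing bounded function whose unit increments
   dominate [b / (b ^+ 2 + x ^+ 2)]. *)
Lemma lorentz_increment (b x : R) : 1 <= b ->
  b / (b ^+ 2 + x ^+ 2) <= 8 * ((x + 1) / (b + `|x + 1|) - x / (b + `|x|)).
Proof.
move=> b1; have b0 : 0 < b by lra.
have d0 : 0 < b ^+ 2 + x ^+ 2 by rewrite ltr_wpDr ?sqr_ge0// exprn_gt0.
rewrite ler_pdivrMr//.
have [x0|x0] := leP 0 x.
  rewrite !ger0_norm//; last by lra.
  have -> : (x + 1) / (b + (x + 1)) - x / (b + x) = b / ((b + (x + 1)) * (b + x)).
    by field; apply/andP; split; lra.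
  rewrite mulrA mulrAC ler_pdivlMr; last by apply: mulr_gt0; lra.
  have : (b + (x + 1)) * (b + x) <= 8 * (b ^+ 2 + x ^+ 2).
    by have := sqr_ge0 (b - x); nra.
  by rewrite -(ler_pM2l b0) => /le_trans; apply; rewrite mulrCA mulrA.
have [x1|x1] := leP (x + 1) 0.
  rewrite !ler0_norm//; last by lra.
  have -> : (x + 1) / (b - (x + 1)) - x / (b - x) = b / ((b - (x + 1)) * (b - x)).
    by field; apply/andP; split; lra.
  rewrite mulrA mulrAC ler_pdivlMr; last by apply: mulr_gt0; lra.
  have : (b - (x + 1)) * (b - x) <= 8 * (b ^+ 2 + x ^+ 2).
    by have := sqr_ge0 (b + x); nra.
  by rewrite -(ler_pM2l b0) => /le_trans; apply; rewrite mulrCA mulrA.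
(* The unit step straddles [0]: both denominators are at most [b + 1], so the increment is at least
   [(b + 1)^-1 >= (2 * b)^-1]. *)
rewrite ger0_norm ?(ltW x1)// ltr0_norm//.
have l1 : (x + 1) / (b + 1) <= (x + 1) / (b + (x + 1)).
  by rewrite ler_pM2l// lef_pV2 ?posrE; lra.
have l2 : - x / (b + 1) <= - x / (b - x).
  by rewrite ler_pM2l ?oppr_gt0// lef_pV2 ?posrE; lra.
have : (b + 1)^-1 <= (x + 1) / (b + (x + 1)) - x / (b - x).
  rewrite -mulNr; apply: le_trans (lerD l1 l2).
  by rewrite -mulrDl (_ : x + 1 + - x = 1) ?mul1r//; ring.
have : (2 * b)^-1 <= (b + 1)^-1 by rewrite lef_pV2 ?posrE; lra.
set u := (b + 1)^-1; set v := (2 * b)^-1; set D := _ - _ => vu uD.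
have vb : v * b = 2^-1 by rewrite /v; field; lra.
have vD : v <= D by lra.
have v0 : 0 < v by rewrite invr_gt0; lra.
have : v * b ^+ 2 <= D * (b ^+ 2 + x ^+ 2).
  by apply: ler_pM; rewrite ?lerDl ?sqr_ge0// ltW.
by rewrite expr2 mulrA vb; lra.
Qed.

(** The increments of [psi] telescope and [psi] takes values in [[-1, 1]], whence [16 = 8 * 2],
    uniformly in [n] and [mu]. *)
Lemma sum_lorentz (b mu : R) n : 1 <= b ->
  \sum_(k < n) (b ^+ 2 + (k%:R - mu) ^+ 2)^-1 <= 16 / b.
Proof.
move=> b1; have b0 : 0 < b by lra.
pose psi (x : R) := x / (b + `|x|).
have psi1 x : `|psi x| <= 1.
  rewrite /psi normrM normfV (@ger0_norm _ (b + _)); last first.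
    by rewrite addr_ge0// ltW.
  by rewrite ler_pdivrMr ?mul1r ?lerDr ?(ltW b0)// ltr_pwDl.
rewrite ler_pdivlMr// mulr_suml.
apply: (@le_trans _ _ (\sum_(k < n) 8 * (psi (k.+1%:R - mu) - psi (k%:R - mu)))).
  apply: ler_sum => k _; rewrite mulrC (_ : k.+1%:R - mu = k%:R - mu + 1) ?/psi; last by rewrite -natr1; ring.
  exact: lorentz_increment.
rewrite -mulr_sumr -(big_mkord xpredT (fun k => psi (k.+1%:R - mu) - psi (k%:R - mu))).
rewrite telescope_sumr//.
have := psi1 (n%:R - mu); have := psi1 (0%:R - mu); rewrite !ler_norml; lra.
Qed.

(** A Carlson-type inequality: Cauchy-Schwarz against the weight [b ^+ 2 + (k - mu) ^+ 2]. The
    centre [mu] is free, and the width [b] is left free to balance the two terms. *)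
Lemma l1_sqr_le h (b mu : R) n : 1 <= b -> (size h <= n)%N ->
  l1 h ^+ 2 <= 16 * (b * (\sum_(k < n) h`_k ^+ 2) +
                     b^-1 * \sum_(k < n) (k%:R - mu) ^+ 2 * h`_k ^+ 2).
Proof.
move=> b1 hn; have b0 : 0 < b by lra.
rewrite (l1E hn); apply: le_trans (sqr_sum_le _ (om := fun k : 'I_n => b ^+ 2 + (k%:R - mu) ^+ 2) _) _.
  by move=> k; rewrite ltr_wpDr ?sqr_ge0// exprn_gt0.
apply: (le_trans (ler_wpM2l _ (sum_lorentz mu n b1))).
  by apply: sumr_ge0 => k _; rewrite mulr_ge0 ?addr_ge0 ?sqr_ge0.
under eq_bigr do rewrite real_normK ?num_real// mulrDl.
rewrite big_split/= -mulr_sumr le_eqVlt; apply/orP; left; apply/eqP; field; lra.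
Qed.

Lemma l1_circle (M : nat) (w : R[i]) h (b mu A0 A1 : R) :
  M.-primitive_root w -> 1 <= b -> (size h <= M)%N ->
  M%:R^-1 * (\sum_(i < M) nc (ev h (w ^+ i)) ^+ 2) <= A0 ->
  M%:R^-1 * (\sum_(i < M) nc (ev ('X * h^`() - mu *: h) (w ^+ i)) ^+ 2) <= A1 ->
  l1 h ^+ 2 <= 16 * (b * A0 + b^-1 * A1).
Proof.
move=> wM b1 hM; have M0 : 0 < M%:R :> R by rewrite ltr0n (prim_order_gt0 wM).
rewrite (parseval wM)// (parseval_deriv wM)// !mulKf ?gt_eqF// => h0 h1.
apply: (le_trans (l1_sqr_le mu b1 hM)); rewrite ler_pM2l//.
by apply: lerD; rewrite ler_wpM2l// ?invr_ge0; lra.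
Qed.

End l1_norm.

(** * Roots of unity of prime order and averages of the Poisson kernel *)

Section circle_averages.
Context (R : realType).
Implicit Types (z : R[i]) (h : {poly R}).

(** A root of [1 + X + ... + X^(p-1)] has order dividing [p]. The order is not [1], because the
    polynomial takes the value [p] at [1]. *)
Lemma prime_root_exists p : prime p -> exists z, p.-primitive_root z.
Proof.
move=> pp; have p1 := prime_gt1 pp; have p0 := prime_gt0 pp.
pose P : {poly R[i]} := \poly_(i < p) 1.
have sP : size P = p by rewrite size_poly_eq// oner_eq0.
have /closed_rootP[z Pz] : size P != 1%N by rewrite sP gtn_eqF.
have S0 : \sum_(i < p) z ^+ i = 0.
  by move/rootP: Pz; rewrite horner_poly; under eq_bigr do rewrite mul1r.
have zp : z ^+ p = 1 by apply/eqP; rewrite -subr_eq0 subrX1 S0 mulr0.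
have [m mz mp] := prim_order_exists p0 zp; exists z.
move/primeP: pp => [_ /(_ m mp) /orP[/eqP m1|/eqP <-//]].
have z1 : z = 1 by rewrite -(prim_expr_order mz) m1.
move: S0; rewrite z1; under eq_bigr do rewrite expr1n.
by rewrite sumr_const card_ord => /eqP; rewrite pnatr_eq0 gtn_eqF.
Qed.

Lemma versineE z : nc z = 1 -> nc (z - 1) ^+ 2 = 2 * versine z.
Proof.
move=> z1; have : nc z ^+ 2 = 1 by rewrite z1 expr1n.
rewrite !nc_sqr /versine; case: z {z1} => a b /= h.
have hb : b ^+ 2 = 1 - a ^+ 2 by rewrite -h; ring.
by rewrite subr0 hb; ring.
Qed.

Lemma versine_ge0 z : nc z = 1 -> 0 <= versine z.
Proof. by move=> /versineE h; have := sqr_ge0 (nc (z - 1)); rewrite h; lra. Qed.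

Lemma versine_le2 z : nc z = 1 -> versine z <= 2.
Proof.
move=> z1; have : nc z ^+ 2 = 1 by rewrite z1 expr1n.
rewrite nc_sqr /versine; have := sqr_ge0 (complex.Im z); nra.
Qed.

(* Since [p(z) (1 - r z) = 1 - r ^+ M] at the [M]-th roots of unity for
   [p = \sum_(l < M) r ^+ l 'X^l], Parseval's identity averages the Poisson
   kernel [1 / |1 - r z| ^+ 2]; here [r = 1 - 1 / sqrt (1 + v)]. *)
Lemma avg_lorentz (M : nat) (w : R[i]) (v : R) : M.-primitive_root w -> 0 <= v ->
  Num.sqrt (1 + v) <= M%:R ->
  M%:R^-1 * (\sum_(i < M) (1 + v * versine (w ^+ i))^-1) <= 8 / Num.sqrt (1 + v).
Proof.
move=> wM v0; set rho := (Num.sqrt (1 + v))^-1 => Mrho.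
have M0 : 0 < M%:R :> R by rewrite ltr0n (prim_order_gt0 wM).
have v1 : 0 < 1 + v by lra.
have s1 : 1 <= Num.sqrt (1 + v) by rewrite -[leLHS]sqrtr1 ler_sqrt; lra.
have rho0 : 0 < rho by rewrite invr_gt0; lra.
have rho1 : rho <= 1 by rewrite invf_le1; lra.
have rhov : rho ^+ 2 * v = 1 - rho ^+ 2.
  have : rho ^+ 2 * (1 + v) = 1.
    by rewrite exprVn sqr_sqrtr ?(ltW v1)// mulVf// gt_eqF.
  by lra.
have Mrho1 : 1 <= M%:R * rho by rewrite ler_pdivlMr ?mul1r//; lra.
pose r := 1 - rho; have r0 : 0 <= r by rewrite /r; lra.
(* Bernoulli gives [(1 + rho) ^+ M >= 2], while [(1 - rho) * (1 + rho) <= 1]: cutting the geometric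
   series at [M] costs at most one half. *)
have rM : r ^+ M <= 2^-1.
  have b1 : 1 + M%:R * rho <= (1 + rho) ^+ M.
    elim: (M) => [|k ih]; first by rewrite expr0; lra.
    rewrite exprS -natr1; have : 0 <= k%:R :> R by [].
    have : (1 + rho) * (1 + k%:R * rho) <= (1 + rho) * (1 + rho) ^+ k.
      by rewrite ler_pM2l//; lra.
    nra.
  have b2 : r ^+ M * (1 + rho) ^+ M <= 1.
    by rewrite -exprMn exprn_ile1// /r; nra.
  have b3 : 2 <= (1 + rho) ^+ M by lra.
  have b4 : 0 <= r ^+ M by apply: exprn_ge0.
  nra.
have rM0 : 0 <= r ^+ M by apply: exprn_ge0.
pose p : {poly R} := \poly_(l < M) r ^+ l.
have pM : (size p <= M)%N by apply: size_poly.
have evp i : ev p (w ^+ i) * (1 - r%:C%C * w ^+ i) = 1 - (r ^+ M)%:C%C.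
  set z := w ^+ i; have zM : z ^+ M = 1 by rewrite -exprAC (prim_expr_order wM) expr1n.
  have -> : ev p z = \sum_(k < M) (r%:C%C * z) ^+ k.
    rewrite (evE _ pM); apply: eq_bigr => k _.
    by rewrite coef_poly ltn_ord exprMn rmorphXn.
  have := subrX1 (r%:C%C * z) M; rewrite exprMn zM mulr1 -rmorphXn => h.
  by rewrite -[LHS]opprK -mulrN opprB mulrC -h opprB.
(* From [rho ^+ 2 * v = 1 - rho ^+ 2] one gets [|1 - r z| ^+ 2 <= 2 * rho ^+ 2 * (1 + v * t)]. The
   [8] is this [2] times the [4] from [(1 - r ^+ M) ^+ 2 >= 4^-1]. *)
have key (i : 'I_M) : (1 + v * versine (w ^+ i))^-1 <=
    8 * rho ^+ 2 * nc (ev p (w ^+ i)) ^+ 2.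
  set z := w ^+ i; have z1 : nc z = 1 by rewrite (nc_root wM).
  have t0 := versine_ge0 z1; set t := versine z in t0 *.
  have d0 : 0 < 1 + v * t by have := mulr_ge0 v0 t0; lra.
  rewrite -[X in X <= _]mul1r ler_pdivrMr//.
  have e1 : nc (1 - r%:C%C * z) ^+ 2 = rho ^+ 2 + 2 * r * t.
    have : nc z ^+ 2 = 1 by rewrite z1 expr1n.
    rewrite /t /versine !nc_sqr /r; case: (z) => a b /= h.
    rewrite ?(mul0r, subr0, addr0, sub0r, add0r).
    have hb : b ^+ 2 = 1 - a ^+ 2 by rewrite -h; ring.
    by rewrite sqrrN exprMn hb; ring.
  have e2 : nc (1 - r%:C%C * z) ^+ 2 <= 2 * rho ^+ 2 * (1 + v * t).
    rewrite e1 (_ : 2 * rho ^+ 2 * (1 + v * t) = 2 * rho ^+ 2 + 2 * (rho ^+ 2 * v) * t); last by ring.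
    rewrite rhov; have := sqr_ge0 rho.
    by have := mulr_ge0 t0 (mulr_ge0 (ltW rho0) r0); rewrite /r; nra.
  have e3 : nc (ev p z) ^+ 2 * nc (1 - r%:C%C * z) ^+ 2 = (1 - r ^+ M) ^+ 2.
    by rewrite -exprMn -ncM evp -rmorphB nc_real real_normK ?num_real.
  have e4 : 4^-1 <= (1 - r ^+ M) ^+ 2 by nra.
  have := ler_wpM2l (sqr_ge0 (nc (ev p z))) e2; lra.
apply: (@le_trans _ _ (M%:R^-1 * \sum_(i < M) 8 * rho ^+ 2 * nc (ev p (w ^+ i)) ^+ 2)).
  by rewrite ler_pM2l ?invr_gt0//; apply: ler_sum => i _; exact: key.
rewrite -mulr_sumr (parseval wM)// mulrCA mulKf ?gt_eqF//.
have h1 : \sum_(k < M) p`_k ^+ 2 <= \sum_(k < M) r ^+ k.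
  apply: ler_sum => k _; rewrite coef_poly ltn_ord expr2 ler_piMr ?exprn_ge0//.
  by apply: exprn_ile1 => //; rewrite /r; lra.
have h2 : rho * \sum_(k < M) r ^+ k <= 1.
  have := subrX1 r M; rewrite (_ : r - 1 = - rho); last by rewrite /r; ring.
  lra.
have := ler_wpM2l (ltW rho0) h1; nra.
Qed.

(** The fourth power of [(1 + y) / 2 <= expR (y / 2)]. Four powers suffice for both mean squares of
    [sym_l1_bound], including the one that leaves [(1 + y)^-1] to be averaged. *)
Lemma exp_decay (y : R) : 0 <= y -> (1 + y) ^+ 4 * expR (- (2 * y)) <= 16.
Proof.
move=> y0; have h : ((1 + y) / 2) ^+ 4 <= expR (2 * y).
  rewrite (_ : 2 * y = 4%:R * (y / 2)); last by lra.
  rewrite expRM_natl; apply: lerXn2r; rewrite ?nnegrE ?expR_ge0//; first lra.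
  by have := expR_ge1Dx (y / 2); lra.
rewrite expRN ler_pdivrMr ?expR_gt0//; move: h; rewrite expr_div_n; lra.
Qed.

End circle_averages.

(** * l1 bounds for powers and for smoothed symmetric polynomials *)

Section l1_bounds.
Context (R : realType).
Implicit Types (z : R[i]) (g h : {poly R}).

Lemma large_root (n : nat) (x : R) :
  exists M (w : R[i]), [/\ prime M, M.-primitive_root w, (n <= M)%N & x <= M%:R].
Proof.
have [M Mx pM] := prime_above (maxn n (Num.bound `|x|)).
have [w wM] := prime_root_exists R pM; exists M, w; split => //.
  by apply: leq_trans (ltnW Mx); rewrite leq_maxl.
apply: (le_trans (ler_norm x)); apply: (le_trans (ltW (archi_boundP (normr_ge0 x)))).
by rewrite ler_nat; apply: leq_trans (ltnW Mx); rewrite leq_maxr.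
Qed.

Lemma decay_inv (y : R) : 0 <= y -> expR (- y) <= (1 + y)^-1.
Proof.
by move=> y0; rewrite expRN lef_pV2 ?posrE ?expR_gt0 ?expR_ge1Dx//; lra.
Qed.

Lemma decay_lin (y : R) : 0 <= y -> y * expR (- y) <= 4 * (1 + y)^-1.
Proof.
move=> y0; have y1 : 0 < 1 + y by lra.
rewrite ler_pdivlMr// expRN mulrAC ler_pdivrMr ?expR_gt0//.
have -> : expR y = expR (y / 2) ^+ 2 by rewrite -expRM_natl; congr expR; lra.
have h := expR_ge1Dx (y / 2).
have : (1 + y / 2) ^+ 2 <= expR (y / 2) ^+ 2.
  by apply: lerXn2r; rewrite ?nnegrE ?expR_ge0//; lra.
nra.
Qed.

(** With [v = a * j], the mean square of [g ^+ j] is of order [(1 + v) ^ (-1/2)] and that of its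
    centred derivative of order [(B / a) ^+ 2 * v * (1 + v) ^ (-1/2)]. The width [sqrt (1 + v)]
    balances them, and [j] disappears. *)
Lemma l1_pow_bound g (a mu B : R) : 0 < a <= 1 ->
  (forall z, nc z = 1 -> nc (ev g z) ^+ 2 <= expR (- (a * versine z))) ->
  (forall z, nc z = 1 ->
     nc (ev ('X * g^`() - mu *: g) z) ^+ 2 <= B ^+ 2 * versine z) ->
  forall j, l1 (g ^+ j) ^+ 2 <= 128 * (1 + 4 * expR 2 * (B / a) ^+ 2).
Proof.
move=> /andP[a0 a1] hg hd [|m].
  rewrite expr0 /l1 size_poly1 big_ord1 coefC /= normr1 expr1n.
  by have := mulr_ge0 (expR_ge0 2%:R) (sqr_ge0 (B / a)); lra.
set j := m.+1; pose v := a * j%:R.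
have j0 : 0 < j%:R :> R by rewrite ltr0n.
have v0 : 0 < v by apply: mulr_gt0.
have v1 : 0 < 1 + v by lra.
set s := Num.sqrt (1 + v).
have s1 : 1 <= s by rewrite /s -[leLHS]sqrtr1 ler_sqrt; lra.
have s0 : 0 < s by lra.
have s2 : s ^+ 2 = 1 + v by rewrite sqr_sqrtr// ltW.
have [M [w [pM wM sM Mv]]] := large_root (size (g ^+ j)) s.
have av := avg_lorentz wM (ltW v0) Mv.
rewrite -/s in av.
have M0 : 0 < M%:R^-1 :> R by rewrite invr_gt0 ltr0n prime_gt0.
have E2 : 0 < expR 2%:R :> R by apply: expR_gt0.
have c0 : 0 <= B ^+ 2 * j%:R ^+ 2 * expR 2.
  by apply: mulr_ge0; [apply: mulr_ge0; exact: sqr_ge0|exact: ltW].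
set A1 := B ^+ 2 * j%:R ^+ 2 * expR 2 * 4 / v * (8 / s).
apply: (le_trans (@l1_circle _ _ _ _ s (mu * j%:R) (8 / s) A1 wM s1 sM _ _)).
- apply: le_trans av; rewrite ler_pM2l//; apply: ler_sum => i _.
  rewrite ev_exp ncX; set z := w ^+ i; have z1 : nc z = 1 by rewrite (nc_root wM).
  rewrite exprAC; apply: le_trans (decay_inv _); last first.
    by rewrite mulr_ge0 ?versine_ge0// ltW.
  rewrite /v mulrAC mulrC -mulrN expRM_natl; apply: lerXn2r; last exact: hg.
    by rewrite nnegrE sqr_ge0.
  by rewrite nnegrE expR_ge0.
- rewrite /A1; set c := _ / v.
  apply: (@le_trans _ _ (M%:R^-1 * \sum_(i < M) c * (1 + v * versine (w ^+ i))^-1)); last first.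
    rewrite -mulr_sumr mulrCA ler_wpM2l// /c.
    by rewrite divr_ge0 ?(ltW v0)// mulr_ge0.
  rewrite ler_pM2l//; apply: ler_sum => i _.
  set z := w ^+ i; have z1 : nc z = 1 by rewrite (nc_root wM).
  have t0 := versine_ge0 z1; have t2 := versine_le2 z1.
  have -> : 'X * (g ^+ j)^`() - (mu * j%:R) *: g ^+ j =
      j%:R%:P * g ^+ m * ('X * g^`() - mu *: g).
    by rewrite deriv_exp /j /= exprS -!mul_polyC -mulr_natl polyCM polyC_natr; ring.
  rewrite !evM !ncM evC nc_real ev_exp ncX ger0_norm//.
  (* Differentiation leaves only [j - 1] powers of [g]; the missing decay costs at most [expR 2],
     since [a <= 1] and [versine z <= 2]. *)
  have h1 : nc (ev g z) ^+ m ^+ 2 <= expR 2 * expR (- (v * versine z)).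
    rewrite -expRD exprAC; apply: (@le_trans _ _ (expR (- (a * versine z)) ^+ m)).
      by apply: lerXn2r; rewrite ?nnegrE ?sqr_ge0 ?expR_ge0// hg.
    by rewrite -expRM_natl ler_expR /v /j -natr1; nra.
  have h2 := hd _ z1.
  have h3 := decay_lin (mulr_ge0 (ltW v0) t0).
  rewrite !exprMn.
  apply: (@le_trans _ _ (j%:R ^+ 2 * (expR 2 * expR (- (v * versine z))) * (B ^+ 2 * versine z))).
    apply: ler_pM => //; [|exact: sqr_ge0|by apply: ler_wpM2l => //; exact: sqr_ge0].
    by apply: mulr_ge0; exact: sqr_ge0.
  have -> : j%:R ^+ 2 * (expR 2 * expR (- (v * versine z))) * (B ^+ 2 * versine z) =
    (B ^+ 2 * j%:R ^+ 2 * expR 2 / v) * (v * versine z * expR (- (v * versine z))).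
    by field; rewrite gt_eqF.
  have -> : c * (1 + v * versine z)^-1 =
    (B ^+ 2 * j%:R ^+ 2 * expR 2 / v) * (4 * (1 + v * versine z)^-1).
    by rewrite /c; ring.
  by apply: ler_wpM2l h3; rewrite divr_ge0 ?(ltW v0).
have -> : s * (8 / s) = 8 by field; rewrite gt_eqF.
have -> : s^-1 * A1 = 32 * expR 2 * (B / a) ^+ 2 * (v / (1 + v)).
  by rewrite /A1 -s2 /v; field; rewrite !gt_eqF.
have : v / (1 + v) <= 1 by rewrite ler_pdivrMr; lra.
have := mulr_ge0 (ltW E2) (sqr_ge0 (B / a)).
set X := expR 2 * _; rewrite -[32 * expR 2 * _]mulrA -[4 * _ * _]mulrA -/X; nra.
Qed.

End l1_bounds.

(** * A single smoothed symmetric component *)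

Section symmetric_bound.
Context (R : realType).
Implicit Types (z : R[i]).

(** Generating polynomial of the law with mass [w i / 2] at each of [i.+1] and [- i.+1], multiplied
    by ['X^L] to clear negative exponents; ['X^L] accordingly stands for the unit mass at [0]. *)
Definition sym_poly (L : nat) (w : 'I_L -> R) : {poly R} :=
  \sum_(i < L) (w i / 2) *: ('X^(L + i.+1) + 'X^(L - i.+1)).

Definition sym_dpoly (L : nat) (w : 'I_L -> R) : {poly R} :=
  \sum_(i < L) (w i * i.+1%:R / 2) *: ('X^(L + i.+1) - 'X^(L - i.+1)).

Lemma mulX_deriv_exp n : 'X * ('X^n)^`() = n%:R *: 'X^n :> {poly R}.
Proof.
by case: n => [|n]; rewrite derivXn ?mulr0n ?mulr0 ?scale0r// mulrnAr -exprS scaler_nat.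
Qed.

Lemma mulX_deriv_sym L (w : 'I_L -> R) :
  'X * (sym_poly w)^`() = L%:R *: sym_poly w + sym_dpoly w.
Proof.
rewrite /sym_poly /sym_dpoly raddf_sum mulr_sumr scaler_sumr -big_split /=.
apply: eq_bigr => i _; rewrite derivZ derivD -scalerAr mulrDr !mulX_deriv_exp.
rewrite natrB// natrD -!mul_polyC !polyCM !polyCD ?polyCN; ring.
Qed.

Section at_point.
Context (L : nat) (w : 'I_L -> R) (z : R[i]).
Hypotheses (w0 : forall i, 0 <= w i) (w1 : \sum_i w i = 1) (z1 : nc z = 1).

(** One minus the real characteristic function of the law at the point [z] of the circle. *)
Let x : R := \sum_i w i * versine (z ^+ i.+1).

Lemma exp_sub_conj k : (k <= L)%N -> z ^+ (L - k) = z ^+ L * ((z ^+ k)^*)%C.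
Proof.
move=> kL; rewrite -[in RHS](subnK kL) exprD -mulrA -nc_sqrC ncX z1.
by rewrite !expr1n mulr1.
Qed.

Lemma ev_sym : ev (sym_poly w - 'X^L) z = - x%:C%C * z ^+ L.
Proof.
have xE : x = 1 - \sum_i w i * complex.Re (z ^+ i.+1).
  by rewrite -w1 -sumrB; apply: eq_bigr => i _; rewrite /versine; ring.
have -> : ev (sym_poly w - 'X^L) z =
    (\sum_i w i * complex.Re (z ^+ i.+1))%:C%C * z ^+ L - z ^+ L.
  rewrite evB ev_exp evX ev_sum; congr (_ - _).
  rewrite rmorph_sum mulr_suml; apply: eq_bigr => i _.
  rewrite evZ evD !ev_exp !evX exp_sub_conj// exprD -mulrDr addcJ.
  rewrite [RHS]mulrC mulrCA; congr (_ * _); rewrite mulrA -[2]/(2%:R).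
  by rewrite -(rmorph_nat (real_complex R)) -!rmorphM; congr (_%:C%C); field.
by rewrite xE rmorphB rmorph1; ring.
Qed.

Lemma nc_ev_sym : nc (ev (sym_poly w - 'X^L) z) = x.
Proof.
rewrite ev_sym ncM ncN nc_real ncX z1 expr1n mulr1 ger0_norm//.
by apply: sumr_ge0 => i _; rewrite mulr_ge0// versine_ge0// ncX z1 expr1n.
Qed.

Lemma nc_ev_sub (a : R) :
  nc (ev ('X^L + a *: (sym_poly w - 'X^L)) z) = `|1 - a * x|.
Proof.
rewrite evD evZ ev_sym ev_exp evX.
rewrite (_ : _ + _ = (1 - a * x)%:C%C * z ^+ L).
  by rewrite ncM nc_real ncX z1 expr1n mulr1.
by rewrite rmorphB rmorph1 rmorphM; ring.
Qed.

(** The inequality [|f'|^2 <= 2 sigma^2 (1 - f)] for a real characteristic function: Cauchy-Schwarz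
    with weights [w], then [sin^2 <= 2 (1 - cos)]. *)
Lemma nc_ev_dsym (sigma : R) : \sum_i w i * i.+1%:R ^+ 2 <= sigma ^+ 2 ->
  nc (ev (sym_dpoly w) z) ^+ 2 <= sigma ^+ 2 * (2 * x).
Proof.
move=> ws.
have -> : ev (sym_dpoly w) z =
    (\sum_i w i * i.+1%:R * complex.Im (z ^+ i.+1))%:C%C * 'i%C * z ^+ L.
  rewrite ev_sum rmorph_sum !mulr_suml; apply: eq_bigr => i _.
  rewrite evZ evB !ev_exp !evX exp_sub_conj// exprD -mulrBr subcJ.
  rewrite [RHS]mulrC mulrCA; congr (_ * _); rewrite !mulrA; congr (_ * _).
  by rewrite -(rmorph_nat (real_complex R)) -!rmorphM; congr (_%:C%C); field.
rewrite !ncM ncX z1 expr1n mulr1 nc_real.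
have -> : nc ('i%C : R[i]) = 1 by apply/eqP; rewrite -(pexpr_eq1 (isT : 0 < 2)%N) ?nc_ge0// nc_sqr /=; apply/eqP; ring.
rewrite mulr1 real_normK ?num_real//; apply: (le_trans (weighted_CS _ _ w0)).
apply: ler_pM => //; try by apply: sumr_ge0 => i _; rewrite mulr_ge0// sqr_ge0.
rewrite mulr_sumr; apply: ler_sum => i _; rewrite [leRHS]mulrCA; apply: ler_wpM2l => //.
have : nc (z ^+ i.+1) ^+ 2 = 1 by rewrite ncX z1 !expr1n.
rewrite nc_sqr /versine; set u := complex.Re _; set v := complex.Im _ => h.
have := sqr_ge0 (1 - u); nra.
Qed.

End at_point.

(** Smoothing of intensity [lam = eps * M] spreads the law over a scale [sigma * sqrt lam]. With the
    width [sigma * sqrt (1 + lam)], which is at least [1] as [l1_circle] demands, both mean squares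
    contribute the order [sigma / lam ^+ 2]. *)
Lemma sym_l1_bound (L M : nat) (w : 'I_L -> R) (sigma eps : R) :
  (forall i, 0 <= w i) -> \sum_i w i = 1 ->
  1 <= sigma -> \sum_i w i * i.+1%:R ^+ 2 <= sigma ^+ 2 ->
  0 < eps <= 2^-1 -> (0 < M)%N ->
  l1 ((sym_poly w - 'X^L) * ('X^L + eps *: (sym_poly w - 'X^L)) ^+ M) ^+ 2 <=
  2048 * (1 + 2 * expR 2) * sigma / (eps * M%:R) ^+ 2.
Proof.
move=> w0 w1 s1 ws /andP[e0 e1] M0; set P := sym_poly w - 'X^L.
set Q := 'X^L + eps *: P; set g := P * Q ^+ M.
have M0' : 0 < M%:R :> R by rewrite ltr0n.
set lam := eps * M%:R; have l0 : 0 < lam by apply: mulr_gt0.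
have l1 : 0 < 1 + lam by lra.
have sg0 : 0 < sigma by lra.
have E2 : 0 < expR 2%:R :> R by apply: expR_gt0.
set s := Num.sqrt (1 + lam).
have ss1 : 1 <= s by rewrite /s -[leLHS]sqrtr1 ler_sqrt; lra.
have s0 : 0 < s by lra.
have s2 : s ^+ 2 = 1 + lam by rewrite sqr_sqrtr// ltW.
have [N [om [pN omN sN Nv]]] := large_root (maxn (size g) L.+1) s.
have [gN LN] : (size g <= N /\ L < N)%N by move: sN; rewrite geq_max => /andP.
have N0 : 0 < N%:R^-1 :> R by rewrite invr_gt0 ltr0n prime_gt0.
pose x z := \sum_i w i * versine (z ^+ i.+1).
have xbd z : nc z = 1 -> 0 <= x z <= 2.
  move=> z1; have zk k : nc (z ^+ k) = 1 by rewrite ncX z1 expr1n.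
  apply/andP; split.
    by apply: sumr_ge0 => i _; rewrite mulr_ge0// versine_ge0.
  have -> : 2 = \sum_i w i * 2 by rewrite -mulr_suml w1 mul1r.
  by apply: ler_sum => i _; rewrite ler_wpM2l// versine_le2.
have avx : N%:R^-1 * (\sum_(j < N) (1 + lam * x (om ^+ j))^-1) <= 8 / s.
  apply: (@le_trans _ _ (\sum_i w i * (8 / s))); last first.
    by rewrite -mulr_suml w1 mul1r.
  apply: (@le_trans _ _ (\sum_i w i *
      (N%:R^-1 * (\sum_(j < N) (1 + lam * versine ((om ^+ i.+1) ^+ j))^-1)))).
    under [leRHS]eq_bigr do rewrite mulrCA mulr_sumr.
    rewrite -mulr_sumr exchange_big ler_pM2l//; apply: ler_sum => j _ /=.
    set z := om ^+ j; have z1 : nc z = 1 by rewrite (nc_root omN).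
    have /andP[x0 _] := xbd z z1; set a := 1 + lam * x z.
    have a0 : 0 < a by rewrite ltr_wpDr// mulr_ge0// ltW.
    (* Jensen's inequality for the reciprocal through its tangent at [a]:
       [2 / a - b / a ^+ 2 <= b^-1], where the [w]-mean of the values [b] is [a]. *)
    have -> : a^-1 = \sum_i w i * (2 / a - (1 + lam * versine (z ^+ i.+1)) / a ^+ 2).
      under eq_bigr do rewrite mulrBr.
      rewrite sumrB -mulr_suml w1 mul1r.
      have -> : \sum_i w i * ((1 + lam * versine (z ^+ i.+1)) / a ^+ 2) = a / a ^+ 2.
        have aE : a = \sum_i w i * (1 + lam * versine (z ^+ i.+1)).
          rewrite /a /x mulr_sumr -[X in X + _]w1 -big_split /=.
          by apply: eq_bigr => i _; ring.
        by rewrite [X in _ = X / _]aE mulr_suml; apply: eq_bigr => i _; rewrite mulrA.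
      by field; rewrite gt_eqF.
    apply: ler_sum => i _; apply: ler_wpM2l => //; rewrite exprAC -/z.
    set b := 1 + _; have b0 : 0 < b.
      by rewrite ltr_wpDr// mulr_ge0 ?(ltW l0)// versine_ge0// ncX z1 expr1n.
    rewrite -subr_ge0 (_ : _ - _ = (a - b) ^+ 2 / (b * a ^+ 2)); last first.
      by field; rewrite !gt_eqF.
    by rewrite divr_ge0 ?sqr_ge0// mulr_ge0 ?(ltW b0)// sqr_ge0.
  apply: ler_sum => i _; apply: ler_wpM2l => //.
  (* [N] is a prime larger than [L >= i.+1], so [om ^+ i.+1] is again primitive and the single-pair
     average applies to it. *)
  have cop : coprime i.+1 N.
    rewrite coprime_sym prime_coprime//; apply/negP => /dvdn_leq => /(_ isT).
    by rewrite leqNgt (leq_ltn_trans _ LN)// ltn_ord.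
  by apply: avg_lorentz => //; [rewrite prim_root_exp_coprime|exact: ltW].
have decay z : nc z = 1 ->
    (1 + lam * x z) ^+ 4 * expR (- (2 * (lam * x z))) <= 16.
  by move=> /xbd /andP[x0 _]; apply: exp_decay; rewrite mulr_ge0// ltW.
have epsx z : nc z = 1 -> 0 <= 1 - eps * x z <= 1.
  by move=> /xbd /andP[x0 x2]; apply/andP; split; nra.
have epsX z k : nc z = 1 -> (1 - eps * x z) ^+ k <= expR (- (eps * k%:R * x z)).
  move=> z1; have /andP[h0 h1] := epsx z z1.
  rewrite (_ : - (eps * k%:R * x z) = k%:R * (- (eps * x z))); last by ring.
  rewrite expRM_natl; apply: lerXn2r; rewrite ?nnegrE ?expR_ge0//.
  exact: expR_ge1Dx.
set A0 := 16 / lam ^+ 2 * (8 / s).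
set A1 := 32 * sigma ^+ 2 * expR 2 / lam * (8 / s).
have bs : 1 <= sigma * s by rewrite -[leLHS]mulr1 ler_pM.
apply: (le_trans (@l1_circle _ _ _ _ (sigma * s) (L * M.+1)%:R A0 A1 omN bs gN _ _)).
- apply: (@le_trans _ _ (N%:R^-1 * \sum_(j < N) (16 / lam ^+ 2) * (1 + lam * x (om ^+ j))^-1)); last first.
    by rewrite -mulr_sumr mulrCA ler_wpM2l// divr_ge0// sqr_ge0.
  rewrite ler_pM2l//; apply: ler_sum => j _.
  set z := om ^+ j; have z1 : nc z = 1 by rewrite (nc_root omN).
  have /andP[x0 x2] := xbd z z1; have /andP[h0 h1] := epsx z z1.
  rewrite evM ev_exp ncM ncX nc_ev_sym// nc_ev_sub// -/(x z) ger0_norm//.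
  have := epsX z M z1; rewrite -/lam => h2.
  have y0 : 0 <= lam * x z by rewrite mulr_ge0// ltW.
  have h3 := decay z z1; set y := lam * x z in y0 h2 h3 *.
  rewrite ler_pdivlMr; last by rewrite ltr_wpDr.
  rewrite ler_pdivlMr ?exprn_gt0//.
  have h4 : ((1 - eps * x z) ^+ M) ^+ 2 <= expR (- (2 * y)).
    rewrite -[- (2 * y)]mulrN expRM_natl; apply: lerXn2r => //; rewrite nnegrE ?expR_ge0//.
    exact: exprn_ge0.
  apply: le_trans h3; rewrite exprMn.
  rewrite [leLHS](_ : _ = (y ^+ 2 * (1 + y)) * ((1 - eps * x z) ^+ M) ^+ 2); last by rewrite /y; ring.
  apply: ler_pM => //; [by rewrite mulr_ge0 ?sqr_ge0//; lra|exact: sqr_ge0|].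
  by nra.
- apply: (@le_trans _ _ (N%:R^-1 * \sum_(j < N) (32 * sigma ^+ 2 * expR 2 / lam) * (1 + lam * x (om ^+ j))^-1)); last first.
    rewrite -mulr_sumr mulrCA ler_wpM2l// divr_ge0 ?(ltW l0)// mulr_ge0 ?(ltW E2)//.
    by rewrite mulr_ge0// sqr_ge0.
  rewrite ler_pM2l//; apply: ler_sum => j _.
  set z := om ^+ j; have z1 : nc z = 1 by rewrite (nc_root omN).
  have /andP[x0 x2] := xbd z z1; have /andP[h0 h1] := epsx z z1.
  have dP : 'X * P^`() = L%:R *: P + sym_dpoly w.
    rewrite derivB mulrBr mulX_deriv_sym mulX_deriv_exp scalerBr.
    by rewrite addrAC.
  have dQ : 'X * Q^`() = L%:R *: Q + eps *: sym_dpoly w.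
    rewrite /Q derivD mulrDr derivZ -scalerAr dP mulX_deriv_exp !scalerDr.
    by rewrite !scalerA [eps * _]mulrC addrA.
  (* Each of the [M.+1] factors is centred at [L], so [g] is centred at [L * M.+1]. The common
     factor left over is [sym_dpoly w], whose size [nc_ev_dsym] controls. *)
  have dg : 'X * g^`() - (L * M.+1)%:R *: g =
      sym_dpoly w * Q ^+ M.-1 * (Q + lam *: P).
    rewrite /g derivM deriv_exp mulrDr mulrnAr mulrnAr mulrA dP mulrCA (mulrA 'X) dQ.
    rewrite -[in Q ^+ M](prednK M0) exprS -!mul_polyC -mulr_natr natrM -natr1.
    rewrite !polyCM polyCD !polyC_natr; ring.
  rewrite dg !evM ev_exp !ncM ncX nc_ev_sub//.
  have -> : Q + lam *: P = 'X^L + (eps + lam) *: P by rewrite /Q -addrA -scalerDl.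
  rewrite nc_ev_sub// -/(x z) (ger0_norm h0) !exprMn real_normK ?num_real//.
  have := epsX z M.-1 z1 => h2; have h5 := nc_ev_dsym w0 z1 ws.
  have y0 : 0 <= lam * x z by rewrite mulr_ge0// ltW.
  have h3 := decay z z1.
  (* The factor [expR 2] pays for the lost power, because [eps * x z <= 1]. *)
  have h4 : ((1 - eps * x z) ^+ M.-1) ^+ 2 <= expR 2 * expR (- (2 * (lam * x z))).
    apply: (@le_trans _ _ (expR (- (eps * M.-1%:R * x z)) ^+ 2)).
      by apply: lerXn2r => //; rewrite nnegrE ?expR_ge0//; exact: exprn_ge0.
    rewrite -expRM_natl -expRD ler_expR /lam -[in leRHS](prednK M0) -natr1.
    by have : eps * x z <= 1; nra.
  have h6 : (1 - (eps + lam) * x z) ^+ 2 <= (1 + lam * x z) ^+ 2.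
    have := mulr_ge0 (ltW e0) x0; rewrite mulrDl => e2; nra.
  have q1 : 0 < 1 + lam * x z by rewrite ltr_wpDr.
  rewrite ler_pdivlMr//.
  apply: (@le_trans _ _ (sigma ^+ 2 * (2 * x z) * (expR 2 * expR (- (2 * (lam * x z)))) *
     (1 + lam * x z) ^+ 2 * (1 + lam * x z))).
    apply: ler_wpM2r; first exact: ltW.
    apply: ler_pM => //; try exact: sqr_ge0; last first.
      by apply: ler_pM => //; exact: sqr_ge0.
    by apply: mulr_ge0; exact: sqr_ge0.
  rewrite [leLHS](_ : _ = (2 * sigma ^+ 2 * expR 2 / lam) *
    ((lam * x z) * (1 + lam * x z) ^+ 3 * expR (- (2 * (lam * x z))))); last first.
    by field; rewrite gt_eqF.
  rewrite (_ : 32 * _ * _ / _ = (2 * sigma ^+ 2 * expR 2 / lam) * 16); last by ring.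
  apply: ler_wpM2l.
    by rewrite divr_ge0 ?(ltW l0)// mulr_ge0 ?(ltW E2)// mulr_ge0// sqr_ge0.
  apply: le_trans h3; apply: ler_wpM2r; first exact: expR_ge0.
  by rewrite [leRHS]exprS ler_wpM2r ?exprn_ge0 ?(ltW q1)// lerDr.
have -> : sigma * s * A0 = 128 * sigma / lam ^+ 2.
  by rewrite /A0; field; rewrite !gt_eqF.
have -> : (sigma * s)^-1 * A1 = 256 * sigma * expR 2 / lam ^+ 2 * (lam / (1 + lam)).
  by rewrite /A1 -s2; field; rewrite !gt_eqF.
have : lam / (1 + lam) <= 1 by rewrite ler_pdivrMr; lra.
have : 0 <= sigma * expR 2 / lam ^+ 2.
  by rewrite divr_ge0 ?sqr_ge0// mulr_ge0// ltW.
rewrite -(mulrA 256) -(mulrA 256 _ (lam ^+ 2)^-1).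
rewrite (_ : 2048 * (1 + 2 * expR 2) * sigma / lam ^+ 2 =
  16 * (128 * sigma / lam ^+ 2) + 4096 * (sigma * expR 2 / lam ^+ 2)); last by ring.
set Y := sigma * expR 2 / _; set Z := lam / _; set W := 128 * _ / _; nra.
Qed.

End symmetric_bound.

(** * Power-bounded factors *)

Section factor_bounds.
Context (R : realType).
Implicit Types (z : R[i]) (g : {poly R}).

Definition pderiv (mu : R) g : {poly R} := 'X * g^`() - mu *: g.

(** Centres add under products, as means do under convolution. *)
Lemma pderivM mu1 mu2 g1 g2 :
  pderiv (mu1 + mu2) (g1 * g2) = pderiv mu1 g1 * g2 + g1 * pderiv mu2 g2.
Proof. by rewrite /pderiv derivM -!mul_polyC polyCD; ring. Qed.

Lemma pderivX mu g n : pderiv (mu * n%:R) (g ^+ n) = n%:R * g ^+ n.-1 * pderiv mu g.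
Proof.
case: n => [|n]; first by rewrite /pderiv expr0 mulr0 scale0r derivC mulr0 subr0 !mul0r.
rewrite /pderiv deriv_exp /= -!mul_polyC -mulr_natl polyCM polyC_natr exprS; ring.
Qed.

Section parameters.
Context (q : R) (N : nat).
Hypotheses (q01 : 0 < q < 1) (Nq : 32 / q <= N%:R).

Let s := 1 - q.
Let eps := q / 4 / N%:R.
(** ['X] stands for the contraction [G], for which A is [s * (G - 1)]: then [a] is A, while [E ^+ N]
    and [W ^+ N] are the binomial substitutes for exp (-cA) and D. *)
Let a : {poly R} := s%:P * ('X - 1).
Let F := 1 + a.
Let E := 1 - eps%:P * a.
Let W := 1 + N%:R^-1%:P * (a - 2^-1%:P * a ^+ 2).

Let q0 : 0 < q. Proof. by move: q01; lra. Qed.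
Let s01 : 0 < s < 1. Proof. by move: q01; rewrite /s; lra. Qed.
Let N32 : 32 <= N%:R :> R.
Proof. by apply: le_trans Nq; rewrite ler_pdivlMr//; move: q01; lra. Qed.
Let N0 : 0 < N%:R :> R. Proof. by have := N32; lra. Qed.
Let Nq32 : 32 <= N%:R * q.
Proof. by rewrite -ler_pdivrMr//. Qed.
Let eps01 : 0 < eps < 1.
Proof.
rewrite /eps divr_gt0 ?divr_gt0//= ltr_pdivrMr//.
by have := N32; move: q01; lra.
Qed.
Let epsN : eps * N%:R = q / 4.
Proof. by rewrite /eps divfK// gt_eqF. Qed.

Let deriv_a : a^`() = s%:P.
Proof. by rewrite /a deriv_mulC derivB derivX derivC subr0 mulr1. Qed.

Let deriv_E : E^`() = - (eps%:P * s%:P).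
Proof. by rewrite /E derivB derivC deriv_mulC deriv_a sub0r. Qed.

Let deriv_F : F^`() = s%:P.
Proof. by rewrite /F derivD derivC deriv_a add0r. Qed.

Let deriv_W : W^`() = N%:R^-1%:P * (s%:P - s%:P * a).
Proof.
rewrite /W derivD derivC deriv_mulC derivB deriv_a deriv_mulC deriv_exp deriv_a.
have h : (2^-1%:P : {poly R}) *+ 2 = 1.
  by rewrite -polyCMn -polyC1; congr _%:P; rewrite mulr2n; lra.
by rewrite add0r expr1 mulrnAr -mulrnAl h mul1r.
Qed.

Section point.
Context (z : R[i]) (z1 : nc z = 1).
Let t := versine z.
Let t0 : 0 <= t. Proof. exact: versine_ge0. Qed.
Let t2 : t <= 2. Proof. exact: versine_le2. Qed.
Let st : 0 <= s * t. Proof. by move: s01 t0 => /andP[? _] ?; rewrite mulr_ge0// ltW. Qed.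

Let Im2 : complex.Im z ^+ 2 = 2 * t - t ^+ 2.
Proof.
have : nc z ^+ 2 = 1 by rewrite z1 expr1n.
by rewrite nc_sqr /t /versine => h; rewrite -[LHS](addKr (complex.Re z ^+ 2)) h; ring.
Qed.

Let nc_lin (e : R) : nc (1 + e%:C%C * (z - 1)) ^+ 2 = 1 - 2 * e * t + 2 * e ^+ 2 * t.
Proof.
move: Im2; rewrite nc_sqr /t /versine; case: (z) => x y /= h.
transitivity ((1 + e * (x - 1)) ^+ 2 + e ^+ 2 * y ^+ 2); first by ring.
by rewrite h; ring.
Qed.

Let ev_a : ev a z = s%:C%C * (z - 1).
Proof. by rewrite evM evB ev1 evX evC. Qed.

Let nc_F : nc (ev F z) ^+ 2 = 1 - 2 * (s * q * t).
Proof. by rewrite evD ev1 ev_a nc_lin /s; ring. Qed.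

Let nc_E : nc (ev E z) ^+ 2 = 1 + 2 * eps * (s * t) + 2 * eps ^+ 2 * s * (s * t).
Proof.
rewrite evB ev1 evM evC ev_a.
rewrite (_ : 1 - _ = 1 + (- (eps * s))%:C%C * (z - 1)); last first.
  by ring.
by rewrite nc_lin; ring.
Qed.

(** The real part of [a - a ^+ 2 / 2] is [- s q t - s^2 t^2], so [W ^+ N] decays to first order at
    least as fast as [F], and only the term in [N^-2] counts against it. *)
Let nc_W : nc (ev W z) ^+ 2 <= 1 - (2 * (s * q * t)) / N%:R + 8 * (s * (s * t)) / N%:R ^+ 2.
Proof.
have -> : ev W z = 1 + N%:R^-1%:C%C * (s%:C%C * (z - 1) * (1 + (- (2^-1 * s))%:C%C * (z - 1))).
  rewrite evD ev1 evM evC evB [ev (2^-1%:P * _) z]evM evC ev_exp ev_a; ring.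
have XE : nc (s%:C%C * (z - 1) * (1 + (- (2^-1 * s))%:C%C * (z - 1))) ^+ 2 <= 8 * (s * (s * t)).
  rewrite !ncM !exprMn nc_lin versineE// nc_real real_normK ?num_real// -/t.
  move: s01 st t0 t2 => /andP[s0 s1] st0 t0' t2'.
  have : 0 <= s * (s * t) by rewrite mulr_ge0// ltW.
  set u := s * (s * t) => u0.
  rewrite (_ : s ^+ 2 * (2 * t) * _ = 2 * u * (1 + s * t + 2^-1 * u)); last first.
    by rewrite /u; field.
  have st2 : s * t <= 2 by nra.
  have : u <= 2 by rewrite /u; nra.
  nra.
have RE : complex.Re (s%:C%C * (z - 1) * (1 + (- (2^-1 * s))%:C%C * (z - 1))) <= - (s * q * t).
  move: Im2; rewrite /t /versine; case: (z) => x y /= h.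
  apply: (@le_trans _ _ (s * (x - 1) * (1 - 2^-1 * s * (x - 1)) + 2^-1 * s ^+ 2 * y ^+ 2)).
    by rewrite le_eqVlt; apply/orP; left; apply/eqP; ring.
  rewrite h -subr_ge0 (_ : _ - _ = s ^+ 2 * (1 - x) ^+ 2); last by rewrite /s; field.
  by rewrite mulr_ge0// sqr_ge0.
move: XE RE; set x := s%:C%C * _ * _; rewrite !nc_sqr; case: x => xr xi /= XE RE.
apply: (@le_trans _ _ (1 + 2 * xr / N%:R + (xr ^+ 2 + xi ^+ 2) / N%:R ^+ 2)).
  by rewrite le_eqVlt; apply/orP; left; apply/eqP; field; rewrite gt_eqF.
apply: lerD; last by rewrite ler_pM2r// invr_gt0 exprn_gt0.
rewrite lerD2l -mulNr ler_pM2r ?invr_gt0//; lra.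
Qed.

Let sqt : 0 <= s * q * t.
Proof. by rewrite mulrAC mulr_ge0// ltW. Qed.

(** The choice c = q/4 keeps the growth of [E ^+ N] at rate [3 / 4] of [s * q * t]. Against the
    decay rates [2] of [F] and [7 / 4] of [W ^+ N], at least rate [1] remains. *)
Let nc_E_pow : (nc (ev E z) ^+ 2) ^+ N <= expR (3 / 4 * (s * q * t)).
Proof.
apply: (@le_trans _ _ (expR (N%:R * (2 * eps * (s * t) + 2 * eps ^+ 2 * s * (s * t))))).
  rewrite expRM_natl; apply: lerXn2r; rewrite ?nnegrE ?expR_ge0 ?sqr_ge0//.
  by rewrite nc_E -addrA expR_ge1Dx.
rewrite ler_expR.
rewrite (_ : N%:R * _ = 2 * (eps * N%:R) * (s * t) * (1 + eps * s)); last by ring.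
rewrite epsN; move: s01 eps01 st q0 => /andP[s0 s1] /andP[e0 e1] st0 q0'.
have es : eps * s <= 2^-1.
  have : eps * 32 <= q / 4 by rewrite -epsN ler_pM2l// N32.
  by move: q01; nra.
have : 0 <= q * (s * t) by rewrite mulr_ge0// ltW.
rewrite (_ : 3 / 4 * (s * q * t) = 3 / 4 * (q * (s * t))); last by ring.
set u := q * (s * t) => u0.
by rewrite (_ : _ * _ = u / 2 * (1 + eps * s)); [nra|rewrite /u; field].
Qed.

Lemma factorF_decay : nc (ev (E ^+ N * F) z) ^+ 2 <= expR (- (s * q * t)).
Proof.
rewrite evM ev_exp ncM ncX exprMn [X in X * _]exprAC.
apply: (@le_trans _ _ (expR (3 / 4 * (s * q * t)) * expR (- (2 * (s * q * t))))).
  apply: ler_pM nc_E_pow _; [by rewrite exprn_ge0 ?sqr_ge0|exact: sqr_ge0|].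
  by rewrite nc_F; exact: expR_ge1Dx.
by rewrite -expRD ler_expR; have := sqt; lra.
Qed.

Lemma factorW_decay : nc (ev (E ^+ N * W ^+ N) z) ^+ 2 <= expR (- (s * q * t)).
Proof.
rewrite evM !ev_exp ncM !ncX exprMn [X in X * _]exprAC [X in _ * X]exprAC.
apply: (@le_trans _ _ (expR (3 / 4 * (s * q * t)) * expR (- (7 / 4 * (s * q * t))))).
  apply: ler_pM nc_E_pow _; [by rewrite exprn_ge0 ?sqr_ge0|by rewrite exprn_ge0 ?sqr_ge0|].
  apply: (@le_trans _ _ (expR (N%:R * (- ((2 * (s * q * t)) / N%:R) + 8 * (s * (s * t)) / N%:R ^+ 2)))).
    rewrite expRM_natl; apply: lerXn2r; rewrite ?nnegrE ?expR_ge0 ?sqr_ge0//.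
    by apply: (le_trans nc_W); rewrite -addrA expR_ge1Dx.
  rewrite ler_expR.
  rewrite (_ : N%:R * _ = - (2 * (s * q * t)) + 8 * (s * (s * t)) / N%:R); last first.
    by field; rewrite gt_eqF.
  (* The requirement [N >= 32 / q] is calibrated here: it holds the second-order term below an
     eighth of the main decay. *)
  have : 8 * (s * (s * t)) / N%:R <= 4^-1 * (s * q * t).
    rewrite ler_pdivrMr//; move: s01 st Nq32 => /andP[s0 s1] st0 Nq'.
    have : s * (s * t) <= s * t by nra.
    have : 32 * (s * t) <= N%:R * q * (s * t) by rewrite ler_wpM2r.
    lra.
  by lra.
by rewrite -expRD ler_expR; have := sqt; lra.
Qed.

Let D := nc (z - 1).
Let D0 : 0 <= D. Proof. exact: nc_ge0. Qed.
Let D2 : D <= 2.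
Proof. by apply: (le_trans (ncD _ _)); rewrite ncN z1 nc1; lra. Qed.

Let nc_E_le k : (k <= N)%N -> nc (ev E z) ^+ k <= expR 1.
Proof.
move=> kN; apply: (@le_trans _ _ (expR (2 * eps) ^+ k)).
  apply: lerXn2r; rewrite ?nnegrE ?expR_ge0 ?nc_ge0//.
  apply: le_trans (expR_ge1Dx _); rewrite evB ev1; apply: (le_trans (ncD _ _)).
  rewrite ncN nc1 lerD2l evM evC ev_a !ncM !nc_real -/D.
  move: s01 eps01 D0 D2 => /andP[s0 s1] /andP[e0 e1] D0' D2'.
  by rewrite !gtr0_norm// [leRHS]mulrC ler_pM2l//; nra.
rewrite -expRM_natl ler_expR.
apply: (@le_trans _ _ (N%:R * (2 * eps))).
  by rewrite ler_wpM2r ?ler_nat// mulr_ge0// ltW//; case/andP: eps01.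
rewrite (_ : _ * _ = 2 * (eps * N%:R)); last by ring.
by rewrite epsN; move: q01; lra.
Qed.

Let nc_W_le k : (k <= N)%N -> nc (ev W z) ^+ k <= expR 4.
Proof.
move=> kN; apply: (@le_trans _ _ (expR (4 / N%:R) ^+ k)).
  apply: lerXn2r; rewrite ?nnegrE ?expR_ge0 ?nc_ge0//.
  apply: le_trans (expR_ge1Dx _); rewrite evD ev1; apply: (le_trans (ncD _ _)).
  move: s01 D0 D2 => /andP[s0 s1] D0' D2'.
  have aD : nc (ev a z) = s * D by rewrite ev_a ncM nc_real gtr0_norm.
  rewrite nc1 lerD2l evM evC evB [ev (2^-1%:P * _) z]evM evC ev_exp ncM nc_real.
  rewrite mulrC gtr0_norm ?invr_gt0// ler_pM2r ?invr_gt0//.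
  apply: (le_trans (ncD _ _)); rewrite ncN [nc (_ * _)]ncM ncX nc_real aD.
  rewrite !gtr0_norm//; have : s * D <= 2 by nra.
  have : 0 <= s * D by rewrite mulr_ge0// ltW.
  nra.
rewrite -expRM_natl ler_expR mulrCA ler_piMr//.
by rewrite ler_pdivrMr// mul1r ler_nat.
Qed.

(** Each centre is the derivative at [1], where [E], [F] and [W] equal [1]. The centred derivative
    therefore vanishes at [1] and splits off the factor ['X - 1], of modulus [D]. *)
Let pderivE : nc (ev (pderiv (- (eps * s)) E) z) <= 2 * eps * s * D.
Proof.
have -> : pderiv (- (eps * s)) E = (- (eps * s + (eps * s) ^+ 2))%:P * ('X - 1).
  by rewrite /pderiv deriv_E /E /a -mul_polyC; ring.
rewrite evM evC evB evX ev1 ncM nc_real -/D normrN.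
move: s01 eps01 D0 => /andP[s0 s1] /andP[e0 e1] D0'.
have es : 0 < eps * s by rewrite mulr_gt0.
rewrite ger0_norm ?addr_ge0 ?sqr_ge0 ?(ltW es)// ler_wpM2r//.
have : eps * s <= 1 by nra.
nra.
Qed.

Let pderivF : nc (ev (pderiv s F) z) <= s * D.
Proof.
have -> : pderiv s F = (s * (1 - s))%:P * ('X - 1).
  by rewrite /pderiv deriv_F /F /a -mul_polyC; ring.
rewrite evM evC evB evX ev1 ncM nc_real -/D.
move: s01 => /andP[s0 s1].
have s2 : 0 <= s * (1 - s) by apply: mulr_ge0; lra.
rewrite ger0_norm//; apply: ler_wpM2r => //; nra.
Qed.

Let pderivW : nc (ev (pderiv (s / N%:R) W) z) <= 4 * s / N%:R * D.
Proof.
pose V : {poly R} := 1 - (2^-1 * s)%:P * ('X - 1).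
pose U := 1 - s%:P * 'X - N%:R^-1%:P * (s%:P * V).
have -> : pderiv (s / N%:R) W = N%:R^-1%:P * (s%:P * (('X - 1) * U)).
  by rewrite /pderiv deriv_W /W /a /U /V -mul_polyC; ring.
move: s01 D0 D2 => /andP[s0 s1] D0' D2'.
have V2 : nc (ev V z) <= 2.
  rewrite evB ev1 evM evC evB evX ev1; apply: (le_trans (ncD _ _)).
  by rewrite nc1 ncN ncM nc_real -/D gtr0_norm; nra.
have U4 : nc (ev U z) <= 4.
  rewrite evB; apply: (le_trans (ncD _ _)); rewrite ncN.
  apply: (@le_trans _ _ (2 + 2)); last by lra.
  apply: lerD.
    rewrite evB ev1 evM evC evX; apply: (le_trans (ncD _ _)).
    by rewrite nc1 ncN ncM nc_real z1 gtr0_norm//; lra.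
  rewrite evM evC evM evC !ncM !nc_real (gtr0_norm s0) (@gtr0_norm _ N%:R^-1) ?invr_gt0//.
  have h2 : N%:R^-1 <= 1 :> R by rewrite invf_le1//; have := N32; lra.
  have h3 : 0 < N%:R^-1 :> R by rewrite invr_gt0.
  have h4 := nc_ge0 (ev V z).
  have : s * nc (ev V z) <= 2 by nra.
  have : 0 <= s * nc (ev V z) by rewrite mulr_ge0// ltW.
  nra.
rewrite evM evC evM evC evM evB evX ev1 !ncM !nc_real -/D gtr0_norm ?invr_gt0// gtr0_norm//.
have sD : 0 <= s / N%:R * D by rewrite mulr_ge0// divr_ge0// ltW.
have := ler_wpM2l sD U4; lra.
Qed.

(** The [N] produced by differentiating [E ^+ N] is absorbed by [eps * N = q / 4]. The constant [8]
    is shared with [factorW_deriv]: it comes from [|z - 1| ^+ 2 = 2 * t] and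
    [2 * 5 ^ 2 <= 8 ^ 2]. *)
Lemma factorF_deriv : nc (ev (pderiv (- (eps * s) * N%:R + s) (E ^+ N * F)) z) ^+ 2 <=
  (8 * expR 5 * s) ^+ 2 * t.
Proof.
have h : nc (ev (pderiv (- (eps * s) * N%:R + s) (E ^+ N * F)) z) <= 5 * expR 5 * s * D.
  rewrite pderivM pderivX evD !evM !ev_exp; apply: (le_trans (ncD _ _)).
  rewrite !ncM !ncX -polyC_natr evC nc_real ger0_norm//.
  have F1 : nc (ev F z) <= 1.
    rewrite -(ler_pXn2r (isT : 0 < 2)%N) ?nnegrE ?nc_ge0// expr1n nc_F.
    by have := sqt; lra.
  have e0 := expR_gt0 (1 : R).
  have e5 : expR 1 <= expR 5%:R :> R by rewrite ler_expR; lra.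
  move: s01 D0 eps01 => /andP[s0 s1] D0' /andP[p0 p1].
  have sD : 0 <= s * D by rewrite mulr_ge0// ltW.
  apply: (@le_trans _ _ (N%:R * expR 1 * (2 * eps * s * D) * 1 + expR 1 * (s * D))).
    have EN k : 0 <= nc (ev E z) ^+ k by rewrite exprn_ge0 ?nc_ge0.
    have h1 : N%:R * nc (ev E z) ^+ N.-1 <= N%:R * expR 1.
      by apply: ler_wpM2l => //; apply: nc_E_le; exact: leq_pred.
    apply: lerD.
      apply: ler_pM F1; [by rewrite !mulr_ge0 ?nc_ge0|exact: nc_ge0|].
      by apply: ler_pM h1 pderivE; [exact: mulr_ge0|exact: nc_ge0].
    by apply: ler_pM (nc_E_le (leqnn _)) pderivF => //; exact: nc_ge0.
  rewrite (_ : _ + _ = (2 * (eps * N%:R) + 1) * expR 1 * (s * D)); last by ring.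
  rewrite epsN (_ : 5 * _ * s * D = 5 * expR 5 * (s * D)); last by ring.
  by rewrite ler_wpM2r//; move: q01; nra.
apply: (@le_trans _ _ ((5 * expR 5 * s * D) ^+ 2)).
  apply: lerXn2r => //; rewrite nnegrE ?nc_ge0//.
  by rewrite !mulr_ge0 ?expR_ge0// ltW//; case/andP: s01.
rewrite exprMn versineE// -/t (_ : (8 * expR 5 * s) ^+ 2 * t = 64 * ((expR 5 * s) ^+ 2 * t)); last by ring.
rewrite (_ : _ * (2 * t) = 50 * ((expR 5 * s) ^+ 2 * t)); last by ring.
by apply: ler_wpM2r; [rewrite mulr_ge0// sqr_ge0|lra].
Qed.

Lemma factorW_deriv :
  nc (ev (pderiv (- (eps * s) * N%:R + s / N%:R * N%:R) (E ^+ N * W ^+ N)) z) ^+ 2 <=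
  (8 * expR 5 * s) ^+ 2 * t.
Proof.
have h : nc (ev (pderiv (- (eps * s) * N%:R + s / N%:R * N%:R) (E ^+ N * W ^+ N)) z) <=
    5 * expR 5 * s * D.
  rewrite pderivM !pderivX evD !evM !ev_exp; apply: (le_trans (ncD _ _)).
  rewrite !ncM !ncX -polyC_natr evC nc_real ger0_norm//.
  have e0 := expR_gt0 (1 : R). have e4 := expR_gt0 (4 : R).
  have e5 : expR 1 * expR 4 = expR 5%:R :> R by rewrite -expRD; congr expR; lra.
  move: s01 D0 eps01 => /andP[s0 s1] D0' /andP[p0 p1].
  have sD : 0 <= s * D by rewrite mulr_ge0// ltW.
  apply: (@le_trans _ _ (N%:R * expR 1 * (2 * eps * s * D) * expR 4 +
      expR 1 * (N%:R * expR 4 * (4 * s / N%:R * D)))).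
    have EN k : 0 <= nc (ev E z) ^+ k by rewrite exprn_ge0 ?nc_ge0.
    have WN k : 0 <= nc (ev W z) ^+ k by rewrite exprn_ge0 ?nc_ge0.
    have h1 : N%:R * nc (ev E z) ^+ N.-1 <= N%:R * expR 1.
      by apply: ler_wpM2l => //; apply: nc_E_le; exact: leq_pred.
    have h2 : N%:R * nc (ev W z) ^+ N.-1 <= N%:R * expR 4.
      by apply: ler_wpM2l => //; apply: nc_W_le; exact: leq_pred.
    apply: lerD.
      apply: ler_pM (nc_W_le (leqnn _)) => //; first by rewrite !mulr_ge0 ?nc_ge0.
      by apply: ler_pM h1 pderivE; [exact: mulr_ge0|exact: nc_ge0].
    apply: ler_pM (nc_E_le (leqnn _)) _ => //; first by rewrite !mulr_ge0 ?nc_ge0.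
    by apply: ler_pM h2 pderivW; [exact: mulr_ge0|exact: nc_ge0].
  rewrite [leLHS](_ : _ = (2 * (eps * N%:R) + 4) * (expR 1 * expR 4) * (s * D)); last first.
    by field; rewrite gt_eqF.
  rewrite epsN e5 (_ : 5 * _ * s * D = 5 * expR 5 * (s * D)); last by ring.
  rewrite ler_wpM2r//; have := expR_gt0 (5 : R); move: q01; nra.
apply: (@le_trans _ _ ((5 * expR 5 * s * D) ^+ 2)).
  apply: lerXn2r => //; rewrite nnegrE ?nc_ge0//.
  by rewrite !mulr_ge0 ?expR_ge0// ltW//; case/andP: s01.
rewrite exprMn versineE// -/t (_ : (8 * expR 5 * s) ^+ 2 * t = 64 * ((expR 5 * s) ^+ 2 * t)); last by ring.
rewrite (_ : _ * (2 * t) = 50 * ((expR 5 * s) ^+ 2 * t)); last by ring.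
by apply: ler_wpM2r; [rewrite mulr_ge0// sqr_ge0|lra].
Qed.

End point.

(** The constant of [l1_pow_bound] for the decay rate [s * q] and [B = 8 * expR 5 * s]. In the ratio
    [8 * expR 5 / q] the factor [s] cancels, and [256 = 4 * 8 ^ 2]. *)
Definition factor_const : R := 128 * (1 + 256 * expR 2 * expR 5 ^+ 2).

Lemma factor_const_ge1 : 1 <= factor_const.
Proof.
rewrite /factor_const; have := mulr_ge0 (expR_ge0 (2%:R : R)) (sqr_ge0 (expR 5%:R : R)).
by rewrite -mulrA; lra.
Qed.

Let l1_factor (g : {poly R}) (mu : R) :
  (forall z, nc z = 1 -> nc (ev g z) ^+ 2 <= expR (- (s * q * versine z))) ->
  (forall z, nc z = 1 ->
     nc (ev ('X * g^`() - mu *: g) z) ^+ 2 <= (8 * expR 5 * s) ^+ 2 * versine z) ->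
  forall j, l1 (g ^+ j) <= factor_const / q.
Proof.
move=> h1 h2 j.
move: s01 => /andP[s0 s1]; have C1 := factor_const_ge1.
have sq : 0 < s * q <= 1 by move: q01 s0 s1; nra.
have := l1_pow_bound sq h1 h2 j.
rewrite (_ : 8 * expR 5 * s / (s * q) = 8 * expR 5 / q); last by field; rewrite !gt_eqF.
move=> h; rewrite -(ler_pXn2r (isT : 0 < 2)%N) ?nnegrE ?l1_ge0//; last first.
  by rewrite divr_ge0 ?(ltW q0)//; lra.
apply: (le_trans h).
apply: (@le_trans _ _ (factor_const / q ^+ 2)); last first.
  by rewrite expr_div_n ler_pM2r ?invr_gt0 ?exprn_gt0// expr2 ler_peMr//; lra.
rewrite ler_pdivlMr ?exprn_gt0// /factor_const.
set X := expR 5; set Y := expR 2.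
rewrite (_ : _ * q ^+ 2 = 128 * (q ^+ 2 + 256 * Y * X ^+ 2)); last by field; rewrite gt_eqF.
by rewrite ler_pM2l// lerD2r; move: q01; nra.
Qed.

Lemma l1_factorF j : l1 ((E ^+ N * F) ^+ j) <= factor_const / q.
Proof.
by apply: l1_factor => [z z1|z z1]; [exact: factorF_decay|exact: factorF_deriv].
Qed.

Lemma l1_factorW j : l1 ((E ^+ N * W ^+ N) ^+ j) <= factor_const / q.
Proof.
by apply: l1_factor => [z z1|z z1]; [exact: factorW_decay|exact: factorW_deriv].
Qed.

End parameters.
End factor_bounds.

(** * The group algebra of translations *)

Section translation_ring.
Context (R : realType) (V : zmodType).

Definition opfun (l : seq (R * V)) (u : V -> R) (x : V) : R :=
  \sum_(cv <- l) cv.1 * u (x + cv.2).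

(* The group algebra of [V], represented by convolution operators: finite linear
   combinations of translations of functions on [V]. *)
Record transop := Transop {
  opval :> (V -> R) -> V -> R;
  opvalP : exists l, opval = opfun l }.

Definition transop_of l := Transop (ex_intro _ l erefl).

(** The representing list is only asserted to exist, so equality is pointwise, and repeated shifts
    or zero coefficients call for no normal form. *)
Lemma transop_eq (S T : transop) : (forall u x, S u x = T u x) -> S = T.
Proof.
case: S T => [S Sp] [T Tp] /= ST; have E : S = T by apply/funext => u; apply/funext => x.
by subst T; congr Transop; exact: Prop_irrelevance.
Qed.

HB.instance Definition _ := gen_eqMixin transop.
HB.instance Definition _ := gen_choiceMixin transop.

Definition op0 := transop_of [::].
Definition op_const (c : R) := transop_of [:: (c, 0)].
Definition op_shift (v : V) := transop_of [:: (1, v)].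

Lemma op_constE c u x : op_const c u x = c * u x.
Proof. by rewrite /= /opfun big_seq1 addr0. Qed.

Lemma op_shiftE v u x : op_shift v u x = u (x + v).
Proof. by rewrite /= /opfun big_seq1 mul1r. Qed.

Lemma op0E u x : op0 u x = 0.
Proof. by rewrite /= /opfun big_nil. Qed.

Lemma opP (T : transop) : exists l, forall u x, T u x = \sum_(cv <- l) cv.1 * u (x + cv.2).
Proof. by have [l Tl] := opvalP T; exists l => u x; rewrite Tl. Qed.

Definition op_add (S T : transop) : transop.
Proof.
exists (fun u x => S u x + T u x).
have [l Sl] := opP S; have [m Tm] := opP T; exists (l ++ m).
by apply/funext => u; apply/funext => x; rewrite /opfun big_cat Sl Tm.
Defined.

Definition op_opp (T : transop) : transop.
Proof.
exists (fun u x => - T u x).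
have [m Tm] := opP T; exists [seq (- cv.1, cv.2) | cv <- m].
apply/funext => u; apply/funext => x; rewrite /opfun big_map Tm -sumrN.
by apply: eq_bigr => cv _; rewrite mulNr.
Defined.

Definition op_mul (S T : transop) : transop.
Proof.
exists (fun u => S (T u)).
have [l Sl] := opP S; have [m Tm] := opP T.
exists [seq (cv.1 * dw.1, cv.2 + dw.2) | cv <- l, dw <- m].
apply/funext => u; apply/funext => x; rewrite /opfun Sl big_allpairs_dep.
apply: eq_bigr => cv _; rewrite Tm mulr_sumr.
by apply: eq_bigr => dw _; rewrite mulrA addrA.
Defined.

Lemma opD (T : transop) (u u' : V -> R) x :
  T (fun y => u y + u' y) x = T u x + T u' x.
Proof.
by have [l Tl] := opP T; rewrite !Tl -big_split; apply: eq_bigr => cv _; rewrite mulrDr.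
Qed.

Lemma opZ (T : transop) (c : R) (u : V -> R) x :
  T (fun y => c * u y) x = c * T u x.
Proof.
by have [l Tl] := opP T; rewrite !Tl mulr_sumr; apply: eq_bigr => cv _; rewrite mulrCA.
Qed.

Fact op_addA : associative op_add.
Proof. by move=> S T U; apply: transop_eq => u x; exact: addrA. Qed.
Fact op_addC : commutative op_add.
Proof. by move=> S T; apply: transop_eq => u x; exact: addrC. Qed.
Fact op_add0 : left_id op0 op_add.
Proof. by move=> S; apply: transop_eq => u x; rewrite -[RHS]add0r; congr (_ + _); exact: op0E. Qed.
Fact op_addN : left_inverse op0 op_opp op_add.
Proof. by move=> S; apply: transop_eq => u x; rewrite [RHS]op0E; exact: addNr. Qed.

HB.instance Definition _ :=
  GRing.isZmodule.Build transop op_addA op_addC op_add0 op_addN.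

Fact op_mulA : associative op_mul.
Proof. by move=> S T U; apply: transop_eq. Qed.
Fact op_mulC : commutative op_mul.
Proof.
move=> S T; apply: transop_eq => u x /=.
have [l Sl] := opP S; have [m Tm] := opP T; rewrite Sl Tm.
under eq_bigr do rewrite Tm mulr_sumr.
under [RHS]eq_bigr do rewrite Sl mulr_sumr.
rewrite exchange_big; apply: eq_bigr => dw _; apply: eq_bigr => cv _ /=.
by rewrite mulrCA -!addrA (addrC dw.2).
Qed.
Fact op_mul1 : left_id (op_const 1) op_mul.
Proof. by move=> S; apply: transop_eq => u x; rewrite [LHS]op_constE mul1r. Qed.
Fact op_mulDl : left_distributive op_mul op_add.
Proof. by move=> S T U; apply: transop_eq. Qed.
Fact op_nz : op_const 1 != op0.
Proof.
apply/eqP => /(congr1 (fun T : transop => T (fun=> 1) 0)).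
by rewrite op_constE op0E mulr1 => /eqP; rewrite oner_eq0.
Qed.

HB.instance Definition _ :=
  GRing.Zmodule_isComNzRing.Build transop op_mulA op_mulC op_mul1 op_mulDl op_nz.

Lemma op_addE (S T : transop) u x : (S + T) u x = S u x + T u x.
Proof. by []. Qed.
Lemma op_oppE (T : transop) u x : (- T) u x = - T u x.
Proof. by []. Qed.
Lemma op_mulE (S T : transop) u x : (S * T) u x = S (T u) x.
Proof. by []. Qed.
Lemma op_1E u x : (1 : transop) u x = u x.
Proof. by rewrite [LHS]op_constE mul1r. Qed.

Fact op_const_additive : additive op_const.
Proof.
by move=> a b; apply: transop_eq => u x; rewrite op_addE op_oppE !op_constE mulrBl.
Qed.
Fact op_const_multiplicative : multiplicative op_const.
Proof.
by split=> [a b|//]; apply: transop_eq => u x; rewrite op_mulE !op_constE mulrA.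
Qed.
HB.instance Definition _ := GRing.isAdditive.Build R transop op_const op_const_additive.
HB.instance Definition _ :=
  GRing.isMultiplicative.Build R transop op_const op_const_multiplicative.

Lemma op_shiftD v w : op_shift (v + w) = op_shift v * op_shift w.
Proof. by apply: transop_eq => u x; rewrite op_mulE !op_shiftE addrA. Qed.
Lemma op_shift0 : op_shift 0 = 1.
Proof. by []. Qed.
Lemma op_shiftMn v n : op_shift (v *+ n) = op_shift v ^+ n.
Proof. by elim: n => [|n ih]; rewrite ?mulr0n ?op_shift0// mulrS exprS op_shiftD ih. Qed.

(** A bound on the sup-norm operator norm, which for a combination of distinct point masses is the
    total variation norm. In this form submultiplicativity is mere composition. *)
Definition bnd (T : transop) (c : R) : Prop :=
  forall u, (forall x, `|u x| <= 1) -> forall x, `|T u x| <= c.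

Lemma bnd_ge0 T c : bnd T c -> 0 <= c.
Proof. by move=> /(_ (fun=> 0)) h; apply: le_trans (normr_ge0 _) (h _ 0) => x; rewrite normr0. Qed.

Lemma bndE T c u K : bnd T c -> (forall x, `|u x| <= K) -> forall x, `|T u x| <= c * K.
Proof.
move=> Tc uK x; have K0 : 0 <= K by apply: le_trans (uK 0).
have [K00|Kn0] := eqVneq K 0.
  have [l Tl] := opP T; rewrite K00 mulr0 Tl big1 ?normr0// => cv _.
  by have := uK (x + cv.2); rewrite K00 normr_le0 => /eqP ->; rewrite mulr0.
have Kgt0 : 0 < K by rewrite lt_def Kn0.
rewrite (_ : u = fun y => K * (K^-1 * u y)); last by apply/funext => y; rewrite mulVKf.
rewrite opZ normrM (ger0_norm K0) mulrC ler_pM2r//; apply: Tc => y.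
by rewrite normrM ger0_norm ?invr_ge0// mulrC ler_pdivrMr// mul1r.
Qed.

Lemma bnd_le T c d : bnd T c -> c <= d -> bnd T d.
Proof. by move=> Tc cd u u1 x; apply: le_trans (Tc u u1 x) cd. Qed.

Lemma bndD S T c d : bnd S c -> bnd T d -> bnd (S + T) (c + d).
Proof.
move=> Sc Td u u1 x; rewrite op_addE.
by apply: (le_trans (ler_normD _ _)); rewrite lerD ?Sc ?Td.
Qed.

Lemma bndN T c : bnd T c -> bnd (- T) c.
Proof. by move=> Tc u u1 x; rewrite op_oppE normrN Tc. Qed.

Lemma bndB S T c d : bnd S c -> bnd T d -> bnd (S - T) (c + d).
Proof. by move=> Sc Td; apply: bndD => //; exact: bndN. Qed.

Lemma bndM S T c d : bnd S c -> bnd T d -> bnd (S * T) (c * d).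
Proof.
by move=> Sc Td u u1 x; rewrite op_mulE; apply: bndE => // y; exact: Td.
Qed.

Lemma bnd_const c : bnd (op_const c) `|c|.
Proof. by move=> u u1 x; rewrite op_constE normrM ler_piMr. Qed.

Lemma bnd0 : bnd 0 0.
Proof. by rewrite -(rmorph0 op_const) -[X in bnd _ X](normr0 R); exact: bnd_const. Qed.

Lemma bnd1 : bnd 1 1.
Proof. by rewrite -(rmorph1 op_const) -[X in bnd _ X]normr1; exact: bnd_const. Qed.

Lemma bnd_shift v : bnd (op_shift v) 1.
Proof. by move=> u u1 x; rewrite op_shiftE u1. Qed.

Lemma bndX T c n : bnd T c -> bnd (T ^+ n) (c ^+ n).
Proof.
move=> Tc; elim: n => [|n ih]; first by rewrite !expr0; exact: bnd1.
by rewrite !exprS; apply: bndM.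
Qed.

Lemma bndX1 T n : bnd T 1 -> bnd (T ^+ n) 1.
Proof. by move=> /(@bndX _ _ n); rewrite expr1n. Qed.

Lemma bnd_sum (I : Type) (s : seq I) (P : pred I) (T : I -> transop) (c : I -> R) :
  (forall i, P i -> bnd (T i) (c i)) ->
  bnd (\sum_(i <- s | P i) T i) (\sum_(i <- s | P i) c i).
Proof. by move=> Tc; elim/big_rec2: _ => [|i S d Pi Sd]; [exact: bnd0|exact: bndD (Tc i Pi) Sd]. Qed.

Lemma bnd_prod1 (I : Type) (s : seq I) (P : pred I) (T : I -> transop) :
  (forall i, P i -> bnd (T i) 1) -> bnd (\prod_(i <- s | P i) T i) 1.
Proof.
move=> Tc; elim/big_rec: _ => [|i S Pi Sd]; first exact: bnd1.
by rewrite -[X in bnd _ X]mulr1; exact: bndM (Tc i Pi) Sd.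
Qed.

Definition op_poly (T : transop) (g : {poly R}) : transop := (map_poly op_const g).[T].

Lemma op_polyM T g h : op_poly T (g * h) = op_poly T g * op_poly T h.
Proof. by rewrite /op_poly rmorphM hornerM. Qed.
Lemma op_polyD T g h : op_poly T (g + h) = op_poly T g + op_poly T h.
Proof. by rewrite /op_poly rmorphD hornerD. Qed.
Lemma op_polyB T g h : op_poly T (g - h) = op_poly T g - op_poly T h.
Proof. by rewrite /op_poly rmorphB hornerD hornerN. Qed.
Lemma op_poly_exp T g n : op_poly T (g ^+ n) = op_poly T g ^+ n.
Proof. by rewrite /op_poly rmorphXn horner_exp. Qed.
Lemma op_polyC T c : op_poly T c%:P = op_const c.
Proof. by rewrite /op_poly map_polyC hornerC. Qed.
Lemma op_poly1 T : op_poly T 1 = 1.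
Proof. by rewrite -polyC1 op_polyC rmorph1. Qed.
Lemma op_polyX T : op_poly T 'X = T.
Proof. by rewrite /op_poly map_polyX hornerX. Qed.
Lemma op_polyZ T c g : op_poly T (c *: g) = op_const c * op_poly T g.
Proof. by rewrite -mul_polyC op_polyM op_polyC. Qed.
Lemma op_poly_sum (I : Type) (s : seq I) (P : pred I) (g : I -> {poly R}) T :
  op_poly T (\sum_(i <- s | P i) g i) = \sum_(i <- s | P i) op_poly T (g i).
Proof. by rewrite /op_poly rmorph_sum horner_sum. Qed.

(** The bridge from the circle to measures: an l1 bound on coefficients serves every contraction at
    once. *)
Lemma bnd_poly T g : bnd T 1 -> bnd (op_poly T g) (l1 g).
Proof.
move=> T1; rewrite /op_poly (@horner_coef_wide _ (size g)) ?size_map_poly// /l1.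
apply: bnd_sum => k _; rewrite coef_map -[X in bnd _ X]mulr1.
by apply: bndM; [exact: bnd_const|exact: bndX1].
Qed.

End translation_ring.

Arguments bnd0 : clear implicits.
Arguments bnd1 : clear implicits.
Arguments bnd_const {R} V c.
Arguments bnd_shift {R V} v.

(** * Smoothing by compound Poisson factors *)

Section smoothing.
Context (R : realType) (V : zmodType).
Local Notation op := (transop R V).
Local Notation cst := (@op_const R V).
Implicit Types (A X Y : op).

Definition sym_op (L : nat) (w : 'I_L -> R) (y : V) : op :=
  \sum_(i < L) cst (w i / 2) * (op_shift R y ^+ i.+1 + op_shift R (- y) ^+ i.+1).

Definition sym_const : R := Num.sqrt (2048 * (1 + 2 * expR 2)).

Lemma sym_const_sqr : sym_const ^+ 2 = 2048 * (1 + 2 * expR 2).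
Proof.
rewrite /sym_const; have : 0 <= 2048 * (1 + 2 * expR 2%:R) :> R.
  by apply: mulr_ge0; [exact: ler0n|have := expR_ge0 (2%:R : R); lra].
by move: (2048 * _) => k; exact: sqr_sqrtr.
Qed.

Lemma bnd_sym_op L (w : 'I_L -> R) y : (forall i, 0 <= w i) -> \sum_i w i = 1 ->
  bnd (sym_op w y) 1.
Proof.
move=> w0 w1; have -> : 1 = \sum_i (w i / 2) * (1 + 1) :> R.
  by rewrite -[LHS]w1; apply: eq_bigr => i _; field.
apply: bnd_sum => i _; apply: bndM.
  by rewrite -[X in bnd _ X]ger0_norm ?divr_ge0//; exact: bnd_const.
by apply: bndD; apply: bndX1; exact: bnd_shift.
Qed.

(** Evaluated at the translation [t] by [y], the polynomial of [sym_l1_bound] is [t ^+ (L * M.+1)]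
    times the wanted operator. The inverse translation removes this power at no cost in norm. *)
Lemma bnd_sym_smooth (L M : nat) (w : 'I_L -> R) (y : V) (sigma eps : R) :
  (forall i, 0 <= w i) -> \sum_i w i = 1 ->
  1 <= sigma -> \sum_i w i * i.+1%:R ^+ 2 <= sigma ^+ 2 ->
  0 < eps <= 2^-1 -> (0 < M)%N ->
  bnd ((sym_op w y - 1) * (1 + cst eps * (sym_op w y - 1)) ^+ M)
    (sym_const * Num.sqrt sigma / (eps * M%:R)).
Proof.
move=> w0 w1 s1 ws e01 M0.
set f := sym_op w y; set t := op_shift R y; set t' := op_shift R (- y).
have tt' : t' * t = 1 by rewrite -op_shiftD addNr op_shift0.
have tk k : t' ^+ k * t ^+ k = 1 by rewrite -exprMn tt' expr1n.
have t1 : bnd t 1 by exact: bnd_shift.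
set P := sym_poly w - 'X^L.
have PE : op_poly t P = t ^+ L * (f - 1).
  rewrite op_polyB op_poly_exp op_polyX mulrBr mulr1; congr (_ - _).
  rewrite op_poly_sum mulr_sumr; apply: eq_bigr => i _.
  rewrite op_polyZ op_polyD !op_poly_exp op_polyX mulrCA; congr (_ * _).
  rewrite exprD mulrDr; congr (_ + _).
  have -> : t ^+ L = t ^+ (L - i.+1) * t ^+ i.+1 by rewrite -exprD subnK.
  by rewrite -mulrA [X in _ * X]mulrC tk mulr1.
set g := P * ('X^L + eps *: P) ^+ M.
have gE : op_poly t g = t ^+ (L * M.+1) * ((f - 1) * (1 + cst eps * (f - 1)) ^+ M).
  rewrite op_polyM PE op_poly_exp op_polyD op_polyZ PE op_poly_exp op_polyX.
  rewrite (_ : t ^+ L + _ = t ^+ L * (1 + cst eps * (f - 1))); last by ring.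
  by rewrite exprMn -exprM mulnS exprD; ring.
have -> : (f - 1) * (1 + cst eps * (f - 1)) ^+ M = t' ^+ (L * M.+1) * op_poly t g.
  by rewrite gE mulrA tk mul1r.
rewrite -[X in bnd _ X]mul1r; apply: bndM; first by apply: bndX1; exact: bnd_shift.
apply: bnd_le (bnd_poly _ t1) _.
have := sym_l1_bound w0 w1 s1 ws e01 M0; rewrite -/P -/g => h.
have l0 : 0 < eps * M%:R by rewrite mulr_gt0 ?ltr0n//; case/andP: e01.
rewrite -(ler_pXn2r (isT : 0 < 2)%N) ?nnegrE ?l1_ge0//; last first.
  by rewrite divr_ge0 ?(ltW l0)// mulr_ge0 ?sqrtr_ge0.
apply: (le_trans h).
have -> : (sym_const * Num.sqrt sigma / (eps * M%:R)) ^+ 2 =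
    sym_const ^+ 2 * Num.sqrt sigma ^+ 2 / (eps * M%:R) ^+ 2.
  by rewrite expr_div_n (exprMn _ sym_const).
have -> : Num.sqrt sigma ^+ 2 = sigma by apply: sqr_sqrtr; exact: le_trans s1.
by rewrite sym_const_sqr.
Qed.

(** The remainder is an exact multiple of [Y ^+ 3]; a bare norm estimate would lose the factor A^3
    on which the smoothing acts. *)
Lemma binomial_remainder Y (y : R) N : bnd Y y -> exists2 Z,
  (1 + Y) ^+ N = 1 + N%:R * Y + cst (2^-1) * (N%:R * (N%:R - 1)) * Y ^+ 2 + Y ^+ 3 * Z &
  bnd Z (N%:R ^+ 3 * (1 + y) ^+ N).
Proof.
move=> Yy; have y0 := bnd_ge0 Yy; elim: N => [|N [Z e Zb]].
  by exists 0; rewrite ?expr0n ?mul0r; [ring|exact: bnd0].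
have hh : cst 2^-1 + cst 2^-1 = 1.
  by rewrite -rmorphD -(rmorph1 cst); congr cst; lra.
exists (cst (2^-1 * (N%:R * (N%:R - 1))) + Z * (1 + Y)).
  rewrite exprSr e -[N.+1%:R]natr1 !rmorphM rmorphB rmorph_nat rmorph1.
  have -> : (N%:R + 1) * (N%:R + 1 - 1) = N%:R * (N%:R - 1) + N%:R + N%:R :> op by ring.
  have E : N%:R * Y ^+ 2 = (cst 2^-1 + cst 2^-1) * (N%:R * Y ^+ 2) by rewrite hh mul1r.
  transitivity (1 + (N%:R + 1) * Y + N%:R * Y ^+ 2 +
     cst 2^-1 * (N%:R * (N%:R - 1)) * Y ^+ 2 +
     Y ^+ 3 * (cst 2^-1 * (N%:R * (N%:R - 1)) + Z * (1 + Y))); first by ring.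
  by rewrite E; ring.
have NN : 0 <= (N%:R : R) by [].
have NN1 : 0 <= N%:R * (N%:R - 1) :> R.
  by case: (N) => [|k]; rewrite ?mul0r// -natr1 addrK mulr_ge0// addr_ge0.
have y1 : 1 <= (1 + y) ^+ N.+1 by rewrite exprn_ege1// lerDl.
apply: bnd_le (bndD (bnd_const _ _) (bndM Zb (bndD (bnd1 _ _) Yy))) _.
rewrite ger0_norm; last by rewrite mulr_ge0// invr_ge0.
rewrite -mulrA -exprSr -[N.+1%:R]natr1; set u := (1 + y) ^+ N.+1 in y1 *.
set n := N%:R : R.
have h1 : 2^-1 * (n * (n - 1)) <= 2^-1 * (n * (n - 1)) * u by rewrite ler_peMr// mulr_ge0.
have h2 : 2^-1 * (n * (n - 1)) + n ^+ 3 <= (n + 1) ^+ 3.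
  by have := sqr_ge0 n; have := NN; rewrite -/n; nra.
have := ler_wpM2r (le_trans ler01 y1) h2; rewrite mulrDl; lra.
Qed.

(** [C] may depend on everything except [e], which will be of order [1 / N]. *)
Lemma prod_expansion (I : Type) (s : seq I) (a : I -> op) (alpha : I -> R) :
  (forall i, bnd (a i) (alpha i)) -> exists2 C, 0 <= C &
  forall e : R, 0 <= e <= 1 ->
  bnd (\prod_(i <- s) (1 + cst e * a i) - 1 - cst e * \sum_(i <- s) a i) (C * e ^+ 2).
Proof.
move=> ab; have a0 i := bnd_ge0 (ab i); elim: s => [|i s [C C0 ih]].
  exists 0 => // e _; rewrite !big_nil mulr0 subrr subr0 mul0r; exact: bnd0.
have s0 : 0 <= \sum_(j <- s) alpha j by apply: sumr_ge0.
exists (alpha i * (\sum_(j <- s) alpha j) + C * (1 + alpha i)).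
  by rewrite addr_ge0 ?mulr_ge0// addr_ge0.
move=> e e01; have /andP[e0 e1] := e01; rewrite !big_cons.
set P := \prod_(j <- s) _; set S := \sum_(j <- s) a j.
rewrite (_ : _ - _ = cst (e ^+ 2) * (a i * S) + (P - 1 - cst e * S) * (1 + cst e * a i)); last first.
  by rewrite rmorphXn; ring.
apply: bnd_le (bndD (bndM (bnd_const _ _) (bndM (ab i) (bnd_sum _ _)))
   (bndM (ih e e01) (bndD (bnd1 _ _) (bndM (bnd_const _ _) (ab i))))) _ => //.
rewrite !ger0_norm ?sqr_ge0//.
have : 0 <= C * e ^+ 2 * (alpha i * (1 - e)).
  by rewrite !mulr_ge0 ?sqr_ge0// subr_ge0.
lra.
Qed.

End smoothing.

(** * The estimate in the group algebra *)

Section core_estimate.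
Context (R : realType) (V : zmodType) (K : nat).
Local Notation op := (transop R V).
Local Notation cst := (@op_const R V).
Context (q : R) (p : 'I_K -> R) (f : 'I_K -> op) (b : 'I_K -> R).
Hypotheses (q01 : 0 < q < 1) (p0 : forall m, 0 < p m) (psum : \sum_m p m = 1 - q).
Hypotheses (f1 : forall m, bnd (f m) 1).
Hypothesis smooth : forall m M eps, 0 < eps <= 2^-1 -> (0 < M)%N ->
  bnd ((f m - 1) * (1 + cst eps * (f m - 1)) ^+ M) (b m / (eps * M%:R)).

Definition op_A : op := \sum_m cst (p m) * (f m - 1).
Definition op_F : op := 1 + op_A.
Definition op_X : op := op_A - cst 2^-1 * op_A ^+ 2.

Let A := op_A.
Let F := op_F.
Let X := op_X.
Let s := 1 - q.
Let q0 : 0 < q. Proof. by case/andP: q01. Qed.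
Let s0 : 0 < s. Proof. by rewrite /s subr_gt0; case/andP: q01. Qed.
Let h := cst 2^-1.
Let hh : h + h = 1.
Proof. by rewrite /h -rmorphD -(rmorph1 cst); congr cst; lra. Qed.

Let fm1 m : bnd (f m - 1) 2.
Proof. by apply: bnd_le (bndB (f1 m) (bnd1 _ _)) _; lra. Qed.

Lemma bnd_op_A : bnd A 2.
Proof.
apply: bnd_le (bnd_sum _ _) _ => [m _|].
  by apply: bndM (fm1 m); exact: bnd_const.
under eq_bigr do rewrite ger0_norm ?(ltW (p0 _))//.
by rewrite -mulr_suml psum; move: q01; lra.
Qed.

Let G : op := cst s^-1 * \sum_m cst (p m) * f m.

Let G1 : bnd G 1.
Proof.
apply: bnd_le (bndM (bnd_const _ _) (bnd_sum _ _)) _ => [m _|].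
  by apply: bndM (f1 m); exact: bnd_const.
under eq_bigr do rewrite mulr1 ger0_norm ?(ltW (p0 _))//.
by rewrite psum ger0_norm ?invr_ge0 ?(ltW s0)// mulVf// gt_eqF.
Qed.

Let AG : A = cst s * (G - 1).
Proof.
rewrite /G mulrBr mulrA -rmorphM divff ?gt_eqF// rmorph1 mul1r mulr1 /A /op_A.
under eq_bigr do rewrite mulrBr mulr1.
by rewrite sumrB -rmorph_sum psum.
Qed.

Let A_poly : op_poly G (s%:P * ('X - 1)) = A.
Proof. by rewrite op_polyM op_polyB op_polyC op_polyX op_poly1 AG. Qed.

Lemma bnd_op_F : bnd F 1.
Proof.
have -> : F = cst q + cst s * G.
  by rewrite /F /op_F -/A AG /s rmorphB rmorph1; ring.
apply: bnd_le (bndD (bnd_const _ _) (bndM (bnd_const _ _) G1)) _.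
by rewrite !ger0_norm ?(ltW s0) ?(ltW q0)// /s; lra.
Qed.

Lemma bnd_op_X : bnd X 4.
Proof.
apply: bnd_le (bndB bnd_op_A (bndM (bnd_const _ _) (bndX 2 bnd_op_A))) _.
by rewrite ger0_norm ?invr_ge0//; lra.
Qed.

Section step.
Context (M : nat).
(** A multiple of three, so that [S ^+ (N * n)] is the cube of [S ^+ (M * n)] and each of the three
    factors A gets its own share of smoothing. *)
Let N := (3 * M)%N.
Hypotheses (M0 : (0 < M)%N) (Nq : 32 / q <= N%:R).
Let eps := q / 4 / N%:R.
Let N0 : 0 < N%:R :> R. Proof. by rewrite ltr0n muln_gt0. Qed.
Let N1 : 1 <= N%:R :> R. Proof. by rewrite ler1n muln_gt0. Qed.
Let eps0 : 0 < eps. Proof. by rewrite !divr_gt0. Qed.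
Let epsN : eps * N%:R = q / 4. Proof. by rewrite /eps divfK// gt_eqF. Qed.
Let eps1 : eps <= 4^-1.
Proof.
by rewrite /eps ler_pdivrMr//; move: q01 N1; lra.
Qed.

Let E : op := 1 - cst eps * A.
Let W : op := 1 + cst N%:R^-1 * X.
Let S : op := \prod_m (1 + cst eps * (cst (p m) * (f m - 1))).

Let epsp m : 0 < eps * p m <= 2^-1.
Proof.
rewrite mulr_gt0//=; have : p m <= 1.
  apply: (@le_trans _ _ (\sum_m p m)); last by rewrite psum; move: q01; lra.
  by rewrite (bigD1 m)//= lerDl sumr_ge0// => i _; exact: ltW.
by have := p0 m; have := eps0; have := eps1; nra.
Qed.

Let smooth_factor m : 1 + cst eps * (cst (p m) * (f m - 1)) =
  1 + cst (eps * p m) * (f m - 1).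
Proof. by rewrite [cst (eps * _)]rmorphM; ring. Qed.

Let bnd_smooth_factor m : bnd (1 + cst eps * (cst (p m) * (f m - 1))) 1.
Proof.
rewrite smooth_factor; have := epsp m; move: (eps * p m) => e /andP[e0 e1].
rewrite (_ : 1 + _ * _ = cst (1 - e) + cst e * f m); last first.
  by rewrite rmorphB rmorph1; ring.
apply: bnd_le (bndD (bnd_const _ _) (bndM (bnd_const _ _) (f1 m))) _.
by rewrite !ger0_norm; lra.
Qed.

Lemma bnd_S : bnd S 1.
Proof. by apply: bnd_prod1 => m _; exact: bnd_smooth_factor. Qed.

(** In the [m]-th term only the [m]-th factor of [S] smooths; the others are contractions. The
    weight [p m] cancels, and [12] comes from [eps * M = q / 12]. *)
Lemma bnd_smooth_A n : (0 < n)%N ->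
  bnd (S ^+ (M * n) * A) (12 / (q * n%:R) * \sum_m b m).
Proof.
move=> n0; rewrite /A /op_A !mulr_sumr; apply: bnd_sum => m _.
have /andP[e0 _] := epsp m; have Mn : (0 < M * n)%N by rewrite muln_gt0 M0.
rewrite (_ : _ * _ = cst (p m) * ((f m - 1) * (1 + cst (eps * p m) * (f m - 1)) ^+ (M * n)) *
  (\prod_(i | i != m) (1 + cst eps * (cst (p i) * (f i - 1)))) ^+ (M * n)); last first.
  by rewrite /S (bigD1 m)//= exprMn smooth_factor; ring.
have r1 : bnd ((\prod_(i | i != m) (1 + cst eps * (cst (p i) * (f i - 1)))) ^+ (M * n)) 1.
  by apply: bndX1; apply: bnd_prod1 => i _; exact: bnd_smooth_factor.
apply: bnd_le (bndM (bndM (bnd_const _ _) (smooth m (epsp m) Mn)) r1) _.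
rewrite mulr1 ger0_norm ?(ltW (p0 m))// le_eqVlt; apply/orP; left; apply/eqP.
rewrite /eps /N !natrM; field.
by rewrite !gt_eqF ?ltr0n.
Qed.

Let EN : bnd (E ^+ N) (expR 1).
Proof.
apply: bnd_le (bndX N (bndB (bnd1 _ _) (bndM (bnd_const _ eps) bnd_op_A))) _.
rewrite ger0_norm ?(ltW eps0)//; apply: (@le_trans _ _ (expR (eps * 2) ^+ N)).
  have a0 : 0 <= eps * 2 by rewrite mulr_ge0// ltW.
  by apply: lerXn2r; [rewrite nnegrE; lra|rewrite nnegrE expR_ge0|exact: expR_ge1Dx].
rewrite -expRM_natl ler_expR (_ : _ * _ = 2 * (eps * N%:R)); last by ring.
by rewrite epsN; move: q01; lra.
Qed.

Lemma bnd_W : bnd (W ^+ N) (expR 4).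
Proof.
apply: bnd_le (bndX N (bndD (bnd1 _ _) (bndM (bnd_const _ N%:R^-1) bnd_op_X))) _.
rewrite ger0_norm ?invr_ge0//; apply: (@le_trans _ _ (expR (N%:R^-1 * 4) ^+ N)).
  have a0 : 0 <= N%:R^-1 * 4 :> R by rewrite mulr_ge0// invr_ge0.
  by apply: lerXn2r; [rewrite nnegrE; lra|rewrite nnegrE expR_ge0|exact: expR_ge1Dx].
by rewrite -expRM_natl ler_expR mulrA divff ?mul1r// gt_eqF.
Qed.

Let C1 := factor_const R / q.

Let powF j : bnd ((E ^+ N * F) ^+ j) C1.
Proof.
apply: bnd_le (l1_factorF q01 Nq j).
rewrite (_ : _ ^+ j = op_poly G (((1 - (q / 4 / N%:R)%:P * ((1 - q)%:P * ('X - 1))) ^+ N *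
  (1 + (1 - q)%:P * ('X - 1))) ^+ j)); first exact: bnd_poly.
rewrite op_poly_exp op_polyM op_poly_exp op_polyB (op_polyD G 1) (op_polyM _ (q / 4 / _)%:P).
by rewrite A_poly op_poly1 op_polyC.
Qed.

Let powW j : bnd ((E ^+ N * W ^+ N) ^+ j) C1.
Proof.
apply: bnd_le (l1_factorW q01 Nq j).
pose a := s%:P * ('X - 1).
rewrite (_ : _ ^+ j = op_poly G (((1 - (q / 4 / N%:R)%:P * a) ^+ N *
  (1 + N%:R^-1%:P * (a - 2^-1%:P * a ^+ 2)) ^+ N) ^+ j)); first exact: bnd_poly.
have aA : op_poly G a = A by exact: A_poly.
clearbody a.
rewrite op_poly_exp op_polyM !op_poly_exp op_polyB (op_polyD G 1).
rewrite (op_polyM _ (q / 4 / _)%:P) (op_polyM _ N%:R^-1%:P) (op_polyB _ a) (op_polyM _ 2^-1%:P).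
by rewrite op_poly_exp aA op_poly1 !op_polyC.
Qed.

(** [X] is the expansion of log (1 + A) to second order, so [1 + X + X ^+ 2 / 2] and [1 + A] differ
    by a multiple of [A ^+ 3]. The term [e] is the gap between [N * (N - 1) / 2] and [N ^+ 2 / 2] in
    the quadratic coefficient. *)
Lemma expansion : exists r e, [/\ F - W ^+ N = A ^+ 3 * r + e,
  bnd r (9 * expR 4) & bnd e (8 / N%:R)].
Proof.
pose nu := cst N%:R^-1; pose Y := nu * X.
have Nnu : N%:R * nu = 1.
  by rewrite /nu -(rmorph_nat cst) -rmorphM divff ?rmorph1// gt_eqF.
have Yb : bnd Y (4 / N%:R).
  apply: bnd_le (bndM (bnd_const _ _) bnd_op_X) _.
  by rewrite ger0_norm ?invr_ge0// mulrC.
have [Z WE Zb] := binomial_remainder N Yb.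
have XA : X = A * (1 - h * A) by rewrite /X /op_X -/A -/h; ring.
pose Z' := nu ^+ 3 * Z.
have Z'b : bnd Z' (expR 4).
  apply: bnd_le (bndM (bndX 3 (bnd_const _ _)) Zb) _.
  rewrite ger0_norm ?invr_ge0// mulrA -exprMn mulVf ?gt_eqF// expr1n mul1r.
  apply: (@le_trans _ _ (expR (4 / N%:R) ^+ N)).
    have a0 : 0 <= 4 / N%:R :> R by rewrite divr_ge0.
    by apply: lerXn2r; [rewrite nnegrE; lra|rewrite nnegrE expR_ge0|exact: expR_ge1Dx].
  by rewrite -expRM_natl mulrCA divff ?mulr1// gt_eqF.
exists (h - h ^+ 3 * A - (1 - h * A) ^+ 3 * Z'), (h * nu * X ^+ 2); split.
- rewrite WE.
  have e1 : N%:R * Y = X by rewrite /Y mulrA Nnu mul1r.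
  have e2 : cst 2^-1 * (N%:R * (N%:R - 1)) * Y ^+ 2 = h * X ^+ 2 - h * nu * X ^+ 2.
    rewrite -/h (_ : h * _ * _ = h * (N%:R * Y) ^+ 2 - h * (N%:R * Y) * Y); last by ring.
    by rewrite e1 /Y; ring.
  have e3 : A - X - h * X ^+ 2 = h * A ^+ 3 - h ^+ 3 * A ^+ 4.
    rewrite XA (_ : _ - _ = h * (h + h) * A ^+ 3 - h ^+ 3 * A ^+ 4); last by ring.
    by rewrite hh mulr1.
  have e4 : Y ^+ 3 * Z = A ^+ 3 * (1 - h * A) ^+ 3 * Z' by rewrite /Y /Z' XA; ring.
  rewrite e1 e2 e4 /F /op_F -/A.
  rewrite (_ : _ - _ = (A - X - h * X ^+ 2) + h * nu * X ^+ 2 - A ^+ 3 * (1 - h * A) ^+ 3 * Z'); last by ring.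
  by rewrite e3; ring.
- have hb : bnd h 2^-1 by rewrite -[X in bnd _ X]ger0_norm ?invr_ge0//; exact: bnd_const.
  have b1 := bndX 3 (bndB (bnd1 _ _) (bndM hb bnd_op_A)).
  apply: bnd_le (bndB (bndB hb (bndM (bndX 3 hb) bnd_op_A)) (bndM b1 Z'b)) _.
  have := @expR_ge1Dx R 4; lra.
- apply: bnd_le (bndM (bndM (bnd_const _ _) (bnd_const _ _)) (bndX 2 bnd_op_X)) _.
  by rewrite !ger0_norm ?invr_ge0//; lra.
Qed.

(** [S] and [E] are inverse to each other to first order: [S * E - 1] is of order [eps ^+ 2], and
    [N * n] such factors cost [O(1 / N)] because [eps * N = q / 4]. *)
Lemma approx_one (CP : R) n : 0 <= CP ->
  bnd (S - 1 - cst eps * A) (CP * eps ^+ 2) ->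
  bnd ((S ^+ N * E ^+ N) ^+ n - 1) ((3 * CP + 4) * n%:R * expR n%:R / N%:R).
Proof.
move=> CP0 Sb; have n0 : 0 <= n%:R :> R by [].
have epsN1 : eps <= N%:R^-1.
  by rewrite -[leRHS]mul1r ler_pdivlMr// epsN; move: q01; lra.
have E2 : bnd E (1 + 2 * eps).
  apply: bnd_le (bndB (bnd1 _ _) (bndM (bnd_const _ eps) bnd_op_A)) _.
  by rewrite ger0_norm ?(ltW eps0)//; lra.
have SE2 : bnd (S * E) (1 + 2 * eps).
  by rewrite -[X in bnd _ X]mul1r; apply: bndM => //; exact: bnd_S.
have SE1 : bnd (S * E - 1) ((3 * CP + 4) * eps ^+ 2).
  rewrite (_ : S * E - 1 = (S - 1 - cst eps * A) * E - cst (eps ^+ 2) * A ^+ 2); last first.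
    by rewrite rmorphXn /E; ring.
  apply: bnd_le (bndB (bndM Sb E2) (bndM (bnd_const _ _) (bndX 2 bnd_op_A))) _.
  rewrite ger0_norm ?sqr_ge0//.
  have := mulr_ge0 (mulr_ge0 CP0 (sqr_ge0 eps)) (ltW eps0).
  have : CP * eps ^+ 2 * eps <= CP * eps ^+ 2 * 1.
    by apply: ler_wpM2l; [rewrite mulr_ge0// sqr_ge0|have := eps1; lra].
  lra.
rewrite -exprMn -exprM subrX1.
have eN : 0 < expR n%:R :> R by exact: expR_gt0.
have Sum : bnd (\sum_(i < N * n) (S * E) ^+ i) ((N * n)%:R * expR n%:R).
  have -> : (N * n)%:R * expR n%:R = \sum_(i < N * n) expR n%:R :> R.
    by rewrite sumr_const card_ord mulr_natl.
  apply: bnd_sum => i _; apply: bnd_le (bndX i SE2) _.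
  apply: (@le_trans _ _ (expR (2 * eps) ^+ i)).
    have e0 := eps0.
    by apply: lerXn2r; [rewrite nnegrE; lra|rewrite nnegrE expR_ge0|exact: expR_ge1Dx].
  rewrite -expRM_natl ler_expR.
  apply: (@le_trans _ _ ((N * n)%:R * (2 * eps))).
    by apply: ler_wpM2r; [have := eps0; lra|rewrite ler_nat ltnW].
  rewrite natrM (_ : _ * _ = 2 * (eps * N%:R) * n%:R); last by ring.
  by rewrite epsN ler_piMl//; move: q01; lra.
apply: bnd_le (bndM SE1 Sum) _.
rewrite natrM (_ : _ * _ * _ = (3 * CP + 4) * n%:R * expR n%:R * (eps * (eps * N%:R))); last by ring.
apply: ler_wpM2l; first by rewrite !mulr_ge0 ?(ltW eN)//; lra.
by rewrite epsN; have := eps0; move: q01 epsN1; nra.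
Qed.

(** Of the [n] copies of [E ^+ N], one stays with [F - W ^+ N] and the other [n - 1] make both
    families of the telescoping sum power bounded. The constant is [15552 = 9 * 12 ^ 3], with
    [expR 5 = expR 1 * expR 4]; [q ^+ 5] collects three smoothings and two power bounds. *)
Lemma smoothed_difference n : (0 < n)%N ->
  bnd ((S ^+ N * E ^+ N) ^+ n * (F ^+ n - (W ^+ N) ^+ n))
    (15552 * expR 5 * factor_const R ^+ 2 / (n%:R ^+ 2 * q ^+ 5) * (\sum_m b m) ^+ 3 +
     8 * expR 1 * n%:R * C1 ^+ 2 / N%:R).
Proof.
move=> n0; have [r [e [FW rb eb]]] := expansion.
set Q := \sum_(i < n) (E ^+ N * F) ^+ (n.-1 - i) * (E ^+ N * W ^+ N) ^+ i.
have Qb : bnd Q (n%:R * C1 ^+ 2).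
  have -> : n%:R * C1 ^+ 2 = \sum_(i < n) C1 ^+ 2 by rewrite sumr_const card_ord mulr_natl.
  by apply: bnd_sum => i _; rewrite expr2; apply: bndM.
have nq : 0 < n%:R :> R by rewrite ltr0n.
have -> : (S ^+ N * E ^+ N) ^+ n * (F ^+ n - (W ^+ N) ^+ n) =
   (S ^+ (M * n) * A) ^+ 3 * (E ^+ N * r * Q) + S ^+ (N * n) * (E ^+ N * e * Q).
  have e1 : S ^+ (N * n) = S ^+ (M * n) ^+ 3 by rewrite -exprM /N -mulnA [(3 * _)%N]mulnC.
  have e2 : (E ^+ N) ^+ n * (F ^+ n - (W ^+ N) ^+ n) = E ^+ N * (A ^+ 3 * r + e) * Q.
    by rewrite mulrBr -[X in X - _]exprMn -[X in _ - X]exprMn subrXX -mulrBr FW.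
  rewrite [(S ^+ N * E ^+ N) ^+ n]exprMn -[LHS]mulrA e2 -[S ^+ N ^+ n]exprM e1; ring.
have Ab := bndX 3 (bnd_smooth_A n0).
have p1 := bndM Ab (bndM (bndM EN rb) Qb).
have p2 := bndM (bndX1 (N * n) bnd_S) (bndM (bndM EN eb) Qb).
apply: bnd_le (bndD p1 p2) _; rewrite le_eqVlt; apply/orP; left; apply/eqP.
have -> : expR 5 = expR 1 * expR 4 :> R by rewrite -expRD; congr expR; lra.
by rewrite /C1; field; rewrite !gt_eqF.
Qed.

End step.

(** The factor [T], close to [1], is inserted at the price [(T - 1) * D]. The crude bound on [D]
    grows exponentially in [n], which is harmless as [C] does not depend on [M]. *)
Lemma core_estimate n : (0 < n)%N -> exists2 C, 0 <= C &
  forall M, let N := (3 * M)%N in (0 < M)%N -> 32 / q <= N%:R ->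
  bnd (F ^+ n - ((1 + cst N%:R^-1 * X) ^+ N) ^+ n)
    (15552 * expR 5 * factor_const R ^+ 2 / (n%:R ^+ 2 * q ^+ 5) * (\sum_m b m) ^+ 3 +
     C / N%:R).
Proof.
move=> n0.
have [CP CP0 hP] := prod_expansion (index_enum 'I_K) (fun m => bndM (bnd_const V (p m)) (fm1 m)).
pose C := (3 * CP + 4) * n%:R * expR n%:R * (1 + expR 4 ^+ n) +
  8 * expR 1 * n%:R * (factor_const R / q) ^+ 2.
exists C.
  rewrite addr_ge0//; last first.
    by apply: mulr_ge0 (sqr_ge0 _); rewrite !mulr_ge0 ?expR_ge0.
  rewrite !mulr_ge0 ?expR_ge0 ?addr_ge0 ?exprn_ge0 ?expR_ge0//; lra.
move=> M N M0 Nq; have N0 : 0 < N%:R :> R by rewrite ltr0n muln_gt0.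
have e01 : 0 <= q / 4 / N%:R <= 1.
  rewrite divr_ge0 ?divr_ge0 ?(ltW q0)//= ler_pdivrMr//.
  by have : 1 <= N%:R :> R; [rewrite ler1n muln_gt0|move: q01; lra].
have h1 := approx_one M0 n CP0 (hP _ e01).
have h2 := smoothed_difference M0 Nq n0.
move: h1 h2; rewrite -/N; set T := _ ^+ n; set D := F ^+ n - _ => h1 h2.
have Db : bnd D (1 + expR 4 ^+ n).
  by apply: bndB; [apply: bndX1; exact: bnd_op_F|apply: bndX; exact: bnd_W].
have -> : D = T * D - (T - 1) * D by ring.
apply: bnd_le (bndB h2 (bndM h1 Db)) _.
rewrite le_eqVlt; apply/orP; left; apply/eqP; rewrite /C; field.
by rewrite !gt_eqF// ltr0n.
Qed.
End core_estimate.

(** * Signed measures and convolution *)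

Section charge_values.
Context d (T : measurableType d) (R : realType).
Implicit Types (mu nu : {charge set T -> \bar R}) (A B : set T).

Definition cval mu A : R := fine (mu A).

Lemma cvalE mu A : measurable A -> mu A = (cval mu A)%:E.
Proof. by move=> mA; rewrite /cval fineK// fin_num_measure. Qed.

Lemma cval_add mu nu A : measurable A ->
  cval (cadd mu nu) A = cval mu A + cval nu A.
Proof. by move=> mA; rewrite {1}/cval /= /cadd fineD ?fin_num_measure. Qed.

Lemma cval_opp mu A : cval (copp mu) A = - cval mu A.
Proof. by rewrite {1}/cval /= /copp fineN. Qed.

Lemma cval_sub mu nu A : measurable A ->
  cval (charge_sub mu nu) A = cval mu A - cval nu A.
Proof. by move=> mA; rewrite /charge_sub cval_add// cval_opp. Qed.

Lemma cval_scale (c : R) mu A : measurable A -> cval (cscale c mu) A = c * cval mu A.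
Proof. by move=> mA; rewrite {1}/cval /= /cscale fineM// fin_num_measure. Qed.

(** A bound on the total variation norm that mentions no Hahn decomposition; the Hahn sets
    themselves are the extremal choice of [A] and [B]. *)
Definition osc_le mu (c : R) : Prop :=
  forall A B, measurable A -> measurable B -> cval mu A - cval mu B <= c.

Definition close mu nu (c : R) : Prop :=
  forall A B, measurable A -> measurable B ->
    (cval mu A - cval nu A) - (cval mu B - cval nu B) <= c.

Lemma closeP mu nu c : close mu nu c <-> osc_le (charge_sub mu nu) c.
Proof. by split=> h A B mA mB; have := h A B mA mB; rewrite !cval_sub. Qed.

Lemma osc_le_tv mu c : osc_le mu c <-> (tv_norm mu <= c%:E)%E.
Proof.
split=> [h|h A B mA mB].
  have [[mP _] [mN _] _ _] := hahn_posneg mu.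
  by rewrite tv_norm_hahn (cvalE _ mP) (cvalE _ mN) -EFinB lee_fin h.
have val X : measurable X -> cval mu X = fine (charge_pos mu X) - fine (charge_neg mu X).
  by move=> mX; rewrite /cval chargeE// fineB// fin_num_measure.
move: h; rewrite tv_normE -[charge_pos _ _]fineK ?fin_num_measure//.
rewrite -[charge_neg _ _]fineK ?fin_num_measure// -EFinD lee_fin.
rewrite !val//.
have mono (m : {finite_measure set T -> \bar R}) X : measurable X ->
    0 <= fine (m X) <= fine (m setT).
  move=> mX; rewrite fine_ge0//= fine_le ?fin_num_measure//.
  by apply: le_measure; rewrite ?inE.
have := mono (charge_pos mu) A mA; have := mono (charge_neg mu) A mA.
have := mono (charge_pos mu) B mB; have := mono (charge_neg mu) B mB; lra.
Qed.

Lemma finite_measure_EFin (m : {finite_measure set T -> \bar R}) A :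
  measurable A -> exists a : R, m A = a%:E.
Proof. by move=> mA; exists (fine (m A)); rewrite fineK// fin_num_measure. Qed.

Lemma osc_ge0 mu c : osc_le mu c -> 0 <= c.
Proof. by move=> /(_ set0 set0 measurable0 measurable0); rewrite subrr. Qed.

Lemma abs_cval_le mu c A : osc_le mu c -> measurable A -> `|cval mu A| <= c.
Proof.
move=> h mA; have := h A set0 mA measurable0; have := h set0 A measurable0 mA.
by rewrite {1 4}/cval charge0 /= ler_norml; lra.
Qed.

Lemma osc_le_eq mu nu c : (forall A, measurable A -> cval mu A = cval nu A) ->
  osc_le mu c -> osc_le nu c.
Proof. by move=> h H A B mA mB; rewrite -!h//; exact: H. Qed.

Lemma close_trans mu nu la c e : close mu nu c -> close nu la e -> close mu la (c + e).
Proof. by move=> h k A B mA mB; have := h A B mA mB; have := k A B mA mB; lra. Qed.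

Lemma close_le mu nu c e : close mu nu c -> c <= e -> close mu nu e.
Proof. by move=> h ce A B mA mB; apply: le_trans (h A B mA mB) ce. Qed.

Lemma close_ge0 mu nu c : close mu nu c -> 0 <= c.
Proof. by move=> /(_ set0 set0 measurable0 measurable0); rewrite subrr. Qed.

Lemma close_sym mu nu c : close mu nu c -> close nu mu c.
Proof. by move=> h A B mA mB; have := h B A mB mA; lra. Qed.

Lemma close_eq mu nu : (forall A, measurable A -> cval mu A = cval nu A) ->
  close mu nu 0.
Proof. by move=> h A B mA mB; rewrite !h//; lra. Qed.

Lemma d_TV_le mu nu (c : R) : close mu nu c -> (d_TV mu nu <= (c / 2)%:E)%E.
Proof.
move=> /closeP/osc_le_tv h; rewrite /d_TV mulrC EFinM.
by apply: lee_wpmul2l => //; rewrite lee_fin invr_ge0.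
Qed.

End charge_values.

Section product_charges.
Context d1 d2 (T1 : measurableType d1) (T2 : measurableType d2) (R : realType).

(* Rectangles form a pi-system, so a signed measure is determined by them. *)
Lemma charge_eq_rect (k1 k2 : {charge set (T1 * T2)%type -> \bar R}) :
  (forall A B, measurable A -> measurable B -> cval k1 (A `*` B) = cval k2 (A `*` B)) ->
  forall X, measurable X -> cval k1 X = cval k2 X.
Proof.
move=> h X mX.
(* Uniqueness on a pi-system concerns nonnegative measures, so the negative parts are moved to the
   opposite sides. *)
pose M1 := measure_add (charge_pos k1) (charge_neg k2).
pose M2 := measure_add (charge_pos k2) (charge_neg k1).
pose C : set (set (T1 * T2)) :=
  [set C | exists A, measurable A /\ exists B, measurable B /\ C = A `*` B].
have CI : setI_closed C.
  move=> /= _ _ [X1 [mX1 [X2 [mX2 ->]]]] [Y1 [mY1 [Y2 [mY2 ->]]]].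
  rewrite -setXI; exists (X1 `&` Y1); split; first exact: measurableI.
  by exists (X2 `&` Y2); split => //; exact: measurableI.
have val Y : measurable Y -> (M1 Y = M2 Y <-> cval k1 Y = cval k2 Y).
  move=> mY.
  have -> : M1 Y = (charge_pos k1 Y + charge_neg k2 Y)%E by exact: measure_addE.
  have -> : M2 Y = (charge_pos k2 Y + charge_neg k1 Y)%E by exact: measure_addE.
  rewrite /cval !chargeE//.
  have [p1 ->] := finite_measure_EFin (charge_pos k1) mY.
  have [n1 ->] := finite_measure_EFin (charge_neg k1) mY.
  have [p2 ->] := finite_measure_EFin (charge_pos k2) mY.
  have [n2 ->] := finite_measure_EFin (charge_neg k2) mY.
  rewrite -!EFinD  /=; split=> [[]|e]; first lra.
  by congr EFin; lra.
apply/val => //; apply: (measure_unique C (fun=> setT)) => //.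
- rewrite measurable_prod_measurableType //; congr (<<s _ >>).
  rewrite predeqE; split => [[A mA [B mB <-]]|[A [mA [B [mB ->]]]]].
    by exists A; split => //; exists B.
  by exists A => //; exists B.
- by move=> _; exists setT; split => //; exists setT; split => //; rewrite setXTT.
- by rewrite bigcup_const.
- move=> _ [A [mA [B [mB ->]]]]; apply/val; first exact: measurableX.
  exact: h.
- move=> _.
  have [a ea] := finite_measure_EFin (charge_pos k1) (@measurableT _ _).
  have [b eb] := finite_measure_EFin (charge_neg k2) (@measurableT _ _).
  have E : M1 setT = (charge_pos k1 setT + charge_neg k2 setT)%E by exact: measure_addE.
  apply: (eq_ind_r (fun x => (x < +oo)%E) _ E).
  by rewrite ea eb -EFinD ltry.
Qed.

Lemma charge_product_rect (mu : {charge set T1 -> \bar R}) (nu : {charge set T2 -> \bar R})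
    A B : measurable A -> measurable B ->
  cval (charge_product mu nu) (A `*` B) = cval mu A * cval nu B.
Proof.
move=> mA mB; rewrite {1}/cval charge_productE.
have fpE (m1 : {finite_measure set T1 -> \bar R}) (m2 : {finite_measure set T2 -> \bar R}) :
    finite_product m1 m2 (A `*` B) = (m1 A * m2 B)%E by exact: product_measure1E.
rewrite !fpE.
rewrite /cval !chargeE//.
have [p1 ->] := finite_measure_EFin (charge_pos mu) mA.
have [n1 ->] := finite_measure_EFin (charge_neg mu) mA.
have [p2 ->] := finite_measure_EFin (charge_pos nu) mB.
have [n2 ->] := finite_measure_EFin (charge_neg nu) mB.
by rewrite -!EFinM -!EFinD /=; ring.
Qed.

(** The definition does not show this, as Jordan parts are not additive; on rectangles it is plain
    distributivity. *)
Lemma charge_product_subl (mu mu' : {charge set T1 -> \bar R})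
    (nu : {charge set T2 -> \bar R}) X : measurable X ->
  cval (charge_product (charge_sub mu mu') nu) X =
  cval (charge_product mu nu) X - cval (charge_product mu' nu) X.
Proof.
move=> mX; rewrite -cval_sub//; apply: charge_eq_rect mX => A B mA mB.
rewrite cval_sub; last exact: measurableX.
by rewrite !charge_product_rect// cval_sub// mulrBl.
Qed.

Lemma charge_product_subr (mu : {charge set T1 -> \bar R})
    (nu nu' : {charge set T2 -> \bar R}) X : measurable X ->
  cval (charge_product mu (charge_sub nu nu')) X =
  cval (charge_product mu nu) X - cval (charge_product mu nu') X.
Proof.
move=> mX; rewrite -cval_sub//; apply: charge_eq_rect mX => A B mA mB.
rewrite cval_sub; last exact: measurableX.
by rewrite !charge_product_rect// cval_sub// mulrBr.
Qed.

Lemma charge_product_addl (mu mu' : {charge set T1 -> \bar R})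
    (nu : {charge set T2 -> \bar R}) X : measurable X ->
  cval (charge_product (cadd mu mu') nu) X =
  cval (charge_product mu nu) X + cval (charge_product mu' nu) X.
Proof.
move=> mX; rewrite -cval_add//; apply: charge_eq_rect mX => A B mA mB.
rewrite cval_add; last exact: measurableX.
by rewrite !charge_product_rect// cval_add// mulrDl.
Qed.

End product_charges.

(** * Convolution and finite combinations of point masses *)

Section convolution_stability.
Context (R : realType) (d : nat).
Local Notation V := 'rV[R]_d.
Local Notation op := (transop R V).
Local Notation conv := Defs.conv.
Implicit Types (mu nu : {charge set V -> \bar R}) (A B : set V) (T : op).

Let add_preimage A : measurable A ->
  measurable ((fun z : V * V => z.1 + z.2) @^-1` A).
Proof. by move=> mA; rewrite -[X in measurable X]setTI; exact: measurable_addmx. Qed.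

Lemma cval_conv mu nu A :
  cval (conv mu nu) A = cval (charge_product mu nu) ((fun z : V * V => z.1 + z.2) @^-1` A).
Proof. by []. Qed.

Lemma osc_conv mu nu (a b : R) : osc_le mu a -> osc_le nu b ->
  osc_le (conv mu nu) (a * b).
Proof.
move=> /osc_le_tv ha /osc_le_tv hb; apply/osc_le_tv.
apply: (le_trans (tv_norm_conv _ _)); rewrite EFinM.
by apply: lee_pmul => //; exact: tv_norm_ge0.
Qed.

Lemma osc_dirac0 : osc_le (charge_dirac0 R d) 1.
Proof. by apply/osc_le_tv; exact: tv_norm_dirac0. Qed.

Lemma osc_conv_pow mu (a : R) n : osc_le mu a -> osc_le (conv_pow mu n) (a ^+ n).
Proof.
move=> ha; elim: n => [|n ih]; first by rewrite expr0; exact: osc_dirac0.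
by rewrite exprS; exact: osc_conv.
Qed.

Lemma close_convl mu mu' nu (e b : R) : close mu mu' e -> osc_le nu b ->
  close (conv mu nu) (conv mu' nu) (e * b).
Proof.
move=> /closeP h hb; apply/closeP; apply: osc_le_eq (osc_conv h hb) => A mA.
rewrite cval_sub// !cval_conv charge_product_subl//; exact: add_preimage.
Qed.

Lemma close_convr mu nu nu' (e a : R) : osc_le mu a -> close nu nu' e ->
  close (conv mu nu) (conv mu nu') (a * e).
Proof.
move=> ha /closeP h; apply/closeP; apply: osc_le_eq (osc_conv ha h) => A mA.
rewrite cval_sub// !cval_conv charge_product_subr//; exact: add_preimage.
Qed.

Definition charge_dirac (v : V) : {charge set V -> \bar R} := charge_of_finite_measure (\d_v).

Fixpoint charge_of_list (l : seq (R * V)) : {charge set V -> \bar R} :=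
  if l is cv :: l' then cadd (cscale cv.1 (charge_dirac cv.2)) (charge_of_list l')
  else czero.

(** The representing list is an arbitrary choice, but by [cval_op] the values on measurable sets
    depend on the operator alone. *)
Definition charge_of_op T : {charge set V -> \bar R} := charge_of_list (sval (cid (opvalP T))).

Lemma cval_dirac v A : cval (charge_dirac v) A = \1_A v.
Proof. by rewrite /cval (_ : charge_dirac v A = \d_v A)// diracE indicE. Qed.

Lemma cval_list l A : measurable A ->
  cval (charge_of_list l) A = \sum_(cv <- l) cv.1 * \1_A cv.2.
Proof.
move=> mA; elim: l => [|cv l ih]; first by rewrite big_nil.
by rewrite big_cons /= cval_add// cval_scale// cval_dirac ih.
Qed.

Lemma cval_op T A : measurable A -> cval (charge_of_op T) A = T \1_A 0.
Proof.
move=> mA; rewrite cval_list//; case: (cid (opvalP T)) => l /= ->.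
by apply: eq_bigr => cv _; rewrite add0r.
Qed.

Let shift_preimage (v : V) A : measurable A -> measurable ((fun y : V => v + y) @^-1` A).
Proof.
move=> mA; rewrite -[X in measurable X]setTI.
have -> : (fun y : V => v + y) = (fun z : V * V => z.1 + z.2) \o (fun y => (v, y)) by [].
apply: (measurableT_comp (@measurable_addmx R 1 d)) => //.
exact: pair1_measurable.
Qed.

Lemma charge_product_list l nu A : measurable A ->
  cval (conv (charge_of_list l) nu) A =
  \sum_(cv <- l) cv.1 * cval nu ((fun y : V => cv.2 + y) @^-1` A).
Proof.
move=> mA; elim: l => [|[c v] l ih].
  rewrite big_nil cval_conv.
  rewrite (_ : 0 = cval (@czero _ (V * V)%type R) ((fun z : V * V => z.1 + z.2) @^-1` A))//.
  apply: charge_eq_rect; last exact: add_preimage.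
  by move=> X Y mX mY; rewrite charge_product_rect// {1}/cval /= mul0r.
rewrite big_cons /= -ih !cval_conv charge_product_addl; last exact: add_preimage.
congr (_ + _).
have mp : measurable_fun [set: V] (fun y : V => (v, y)) by exact: pair1_measurable.
(* The product of a point mass at [v] with [nu] is [nu] carried to the slice of first coordinate
   [v]; agreement on rectangles is enough. *)
pose k : {charge set (V * V)%type -> \bar R} :=
  cscale c (measure_function_pushforward__canonical__charge_Charge nu mp).
transitivity (cval k ((fun z : V * V => z.1 + z.2) @^-1` A)).
  apply: charge_eq_rect; last exact: add_preimage.
  move=> X Y mX mY; rewrite charge_product_rect// cval_scale// cval_dirac.
  rewrite /k cval_scale; last exact: measurableX.
  rewrite -mulrA; congr (_ * _); rewrite indicE.
  have [vX|vX] := boolP (v \in X).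
    rewrite mul1r /cval /=; congr fine; rewrite /pushforward; congr (nu _).
    by rewrite predeqE => y /=; split=> [|[]//]; split=> //; rewrite -in_setE.
  rewrite mul0r /cval /= /pushforward (_ : _ @^-1` _ = set0) ?charge0//.
  rewrite predeqE => y /=; split=> // -[Xv _]; move: vX; rewrite notin_setE; exact.
by rewrite /k cval_scale//; exact: add_preimage.
Qed.

Lemma op_translate T (v : V) (u : V -> R) : T (fun y => u (v + y)) 0 = T u v.
Proof. by have [l Tl] := opP T; rewrite !Tl; apply: eq_bigr => cv _; rewrite add0r. Qed.

Lemma conv_op T T' A : measurable A ->
  cval (conv (charge_of_op T) (charge_of_op T')) A = cval (charge_of_op (T * T')) A.
Proof.
move=> mA; rewrite charge_product_list// cval_op// op_mulE.
case: (cid (opvalP T)) => l /= ->; rewrite /opfun; apply: eq_bigr => cv _.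
rewrite cval_op; last exact: shift_preimage.
rewrite add0r -[in RHS]op_translate; by congr (_ * opval T' _ 0).
Qed.

(** The difference of two indicators is a test function with values in [[-1, 1]], so no factor [2]
    is lost. *)
Lemma osc_op T (c : R) : bnd T c -> osc_le (charge_of_op T) c.
Proof.
move=> Tc A B mA mB; rewrite !cval_op//.
have -> : T \1_A 0 - T \1_B 0 = T (fun y => \1_A y + (-1) * \1_B y) 0.
  by rewrite opD opZ mulN1r.
apply: (le_trans (ler_norm _)); apply: Tc => y; rewrite !indicE.
by case: (y \in A); case: (y \in B); rewrite ?mulr1 ?mulr0 ?subrr ?addr0 ?add0r ?normr0 ?normr1 ?normrN ?normr1.
Qed.

Lemma close_op T T' (c : R) : bnd (T - T') c -> close (charge_of_op T) (charge_of_op T') c.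
Proof.
move=> h; apply/closeP; apply: osc_le_eq (osc_op h) => A mA.
by rewrite cval_sub// !cval_op.
Qed.

Lemma close_conv_pow mu T (a e : R) n : 1 <= a -> osc_le mu a -> bnd T a ->
  close mu (charge_of_op T) e ->
  close (conv_pow mu n) (charge_of_op (T ^+ n)) (n%:R * (e * a ^+ n)).
Proof.
move=> a1 ha hT h; have e0 := close_ge0 h; elim: n => [|n ih].
  rewrite mul0r; apply: close_eq => A mA; rewrite cval_op// expr0 op_1E.
  exact: cval_dirac.
have h1 := close_convl h (osc_conv_pow n ha).
have h2 := close_convr (osc_op hT) ih.
have h3 : close (conv (charge_of_op T) (charge_of_op (T ^+ n))) (charge_of_op (T ^+ n.+1)) 0.
  by apply: close_eq => A mA; rewrite conv_op// exprS.
apply: close_le (close_trans (close_trans h1 h2) h3) _.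
rewrite addr0 -[n.+1%:R]natr1 exprS.
have : e * a ^+ n <= a * (e * a ^+ n).
  by rewrite ler_peMl// mulr_ge0// exprn_ge0//; lra.
rewrite mulrDl mul1r [a * (n%:R * _)]mulrCA [e * (a * _)]mulrCA; lra.
Qed.

End convolution_stability.

(** * Exponential series and their binomial substitutes *)

Section exponential_stability.
Context (R : realType).

Lemma exp_partial_le (x : R) n : 0 <= x ->
  \sum_(j < n) j`!%:R^-1 * x ^+ j <= expR x.
Proof.
move=> x0; have -> : \sum_(j < n) j`!%:R^-1 * x ^+ j = series (exp_coeff x) n.
  by rewrite /series /= big_mkord; apply: eq_bigr => j _; rewrite /exp_coeff /= mulrC.
apply: nondecreasing_cvgn_le; last exact: is_cvg_series_exp_coeff.
by apply: nondecreasing_series => k _ _; exact: exp_coeff_ge0.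
Qed.

Lemma nat_le_exp4 j : j%:R ^+ 2 <= 4 ^+ j :> R.
Proof.
have h : j%:R <= 2 ^+ j :> R by rewrite -natrX ler_nat ltnW// ltn_expl.
by rewrite (_ : 4 = 2 ^+ 2) 1?exprAC ?lerXn2r ?nnegrE ?exprn_ge0//; ring.
Qed.

(** The ratio is the product of [1 - i / N] over [i < j]. Once [j > N] it vanishes, and the lower
    bound is then negative. *)
Lemma ffact_ratio (N j : nat) : (0 < N)%N ->
  1 - j%:R ^+ 2 / N%:R <= (N ^_ j)%:R / N%:R ^+ j :> R /\
  (N ^_ j)%:R / N%:R ^+ j <= 1 :> R.
Proof.
move=> N0; have N0' : 0 < N%:R :> R by rewrite ltr0n.
elim: j => [|j [ih1 ih2]]; first by rewrite ffactn0 expr0 divr1 expr0n mul0r subr0.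
set a := (N ^_ j)%:R / N%:R ^+ j in ih1 ih2; have a0 : 0 <= a by rewrite divr_ge0// exprn_ge0.
have -> : (N ^_ j.+1)%:R / N%:R ^+ j.+1 = a * ((N - j)%:R / N%:R) :> R.
  by rewrite ffactnSr natrM exprSr invfM mulrACA.
have [jN|Nj] := leqP j N.
  have b0 : 0 <= ((N - j)%:R / N%:R : R) <= 1.
    by rewrite divr_ge0//= ler_pdivrMr// mul1r ler_nat leq_subr.
  have : (N - j)%:R / N%:R = 1 - j%:R / N%:R :> R.
    by rewrite natrB//; field; rewrite gt_eqF.
  set b := _ / _ in b0 * => bE; case/andP: b0 => b0 b1; split; last by nra.
  have : a * b >= a - j%:R / N%:R.
    have c0 : 0 <= j%:R / N%:R :> R by rewrite divr_ge0.
    by rewrite bE; nra.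
  have : j.+1%:R ^+ 2 / N%:R >= j%:R ^+ 2 / N%:R + j%:R / N%:R :> R.
    rewrite -mulrDl ler_pM2r ?invr_gt0// -natr1.
    by have : 0 <= j%:R :> R by []; nra.
  lra.
move: (ltnW Nj); rewrite -subn_eq0 => /eqP ->; rewrite mul0r mulr0; split => //.
rewrite subr_le0 ler_pdivlMr// mul1r -natrX ler_nat.
by apply: leq_trans (ltnW Nj) _; rewrite (leq_trans (leqnSn j))// expnS leq_pmulr.
Qed.

(** The coefficients of [T ^+ j] differ by at most [j ^ 2 / (N * j!)], and [j ^ 2 <= 4 ^ j] turns
    the sum into an exponential series at [4 * k]. The bound does not depend on the cut-off [J]. *)
Lemma bnd_exp_approx (V : zmodType) (T : transop R V) (k : R) (N J : nat) :
  0 <= k -> bnd T k -> (0 < N)%N -> (N < J)%N ->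
  bnd (\sum_(j < J) op_const V j`!%:R^-1 * T ^+ j -
       (1 + op_const V N%:R^-1 * T) ^+ N) (expR (4 * k) / N%:R).
Proof.
move=> k0 Tk N0 NJ; have N0' : 0 < N%:R :> R by rewrite ltr0n.
have fact0 j : 0 < j`!%:R :> R by rewrite ltr0n fact_gt0.
have -> : (1 + op_const V N%:R^-1 * T) ^+ N =
    \sum_(j < J) op_const V ('C(N, j)%:R / N%:R ^+ j) * T ^+ j.
  pose G j := op_const V ('C(N, j)%:R / N%:R ^+ j) * T ^+ j.
  have -> : \sum_(j < J) op_const V ('C(N, j)%:R / N%:R ^+ j) * T ^+ j = \sum_(j < N.+1) G j.
    rewrite (big_ord_widen J G NJ) [RHS]big_mkcond; apply: eq_bigr => j _ /=.
    by case: ltnP => // Nj; rewrite bin_small// mul0r rmorph0 mul0r.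
  rewrite exprDn; apply: eq_bigr => j _.
  rewrite expr1n mul1r exprMn -rmorphXn -mulr_natl mulrA; congr (_ * _).
  by rewrite -(rmorph_nat (op_const V)) -rmorphM exprVn.
rewrite -sumrB; apply: bnd_le (bnd_sum _ _) _ => [j _|].
  by rewrite -mulrBl -rmorphB; apply: bndM (bnd_const _ _) (bndX j Tk).
apply: (@le_trans _ _ (\sum_(j < J) N%:R^-1 * (j`!%:R^-1 * (4 * k) ^+ j))); last first.
  rewrite -mulr_sumr mulrC ler_wpM2r ?invr_ge0//.
  by apply: exp_partial_le; rewrite mulr_ge0.
apply: ler_sum => j _; rewrite exprMn !mulrA; apply: ler_wpM2r; first exact: exprn_ge0.
have [h1 h2] := ffact_ratio j N0.
have -> : 'C(N, j)%:R / N%:R ^+ j = j`!%:R^-1 * ((N ^_ j)%:R / N%:R ^+ j) :> R.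
  rewrite -bin_ffact natrM; field.
  by rewrite !gt_eqF// exprn_gt0.
rewrite -[X in `|X - _|]mulr1 -mulrBr normrM ger0_norm ?invr_ge0 ?(ltW (fact0 _))//.
rewrite [leRHS]mulrAC [leRHS]mulrC; apply: ler_wpM2l.
  by rewrite invr_ge0 ltW.
rewrite ger0_norm; last by lra.
apply: (@le_trans _ _ (j%:R ^+ 2 / N%:R)); first lra.
by rewrite [leRHS]mulrC ler_pM2r ?invr_gt0//; exact: nat_le_exp4.
Qed.

Section conv_exp_approx.
Context (d : nat).
Local Notation V := 'rV[R]_d.
Local Notation op := (transop R V).
Implicit Types (mu : {charge set V -> \bar R}) (T : op).

Let term mu (A : set V) (j : nat) : R := j`!%:R^-1 * cval (conv_pow mu j) A.

Let term_cvg mu (k : R) A : osc_le mu k -> measurable A -> cvgn (series (term mu A)).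
Proof.
move=> hk mA; have k0 := osc_ge0 hk; apply: normed_cvg.
apply: (@series_le_cvg _ _ (exp_coeff k)) => [j|j|j|].
- exact: normr_ge0.
- exact: exp_coeff_ge0.
- rewrite /term /= normrM ger0_norm ?invr_ge0// /exp_coeff /= mulrC.
  by apply: ler_wpM2r; rewrite ?invr_ge0//; apply: abs_cval_le => //; exact: osc_conv_pow.
- exact: is_cvg_series_exp_coeff.
Qed.

Let cval_conv_exp mu (k : R) A : osc_le mu k -> measurable A ->
  cval (conv_exp mu) A = limn (series (term mu A)).
Proof.
move=> hk mA; rewrite /cval /= /conv_exp.
rewrite (_ : (fun n => _) = EFin \o series (term mu A)).
  by rewrite EFin_lim//; exact: term_cvg hk mA.
apply/funext => n; rewrite /= /series /= -sumEFin; apply: eq_bigr => j _.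
by rewrite /term EFinM (cvalE _ mA).
Qed.

Lemma op_sumE (I : Type) (s : seq I) (P : pred I) (S : I -> op) u x :
  (\sum_(i <- s | P i) S i) u x = \sum_(i <- s | P i) S i u x.
Proof. by elim/big_rec2: _ => [|i y T _ <-]; [exact: op0E|rewrite op_addE]. Qed.

(** On partial sums, passing from [mu] to [T] costs [j * e * k ^+ j] in the [j]-th power, and
    passing to the binomial power costs [bnd_exp_approx]. Both are uniform in the cut-off, which
    then tends to infinity. *)
Lemma close_conv_exp mu T (k e : R) N : 1 <= k -> osc_le mu k -> bnd T k ->
  close mu (charge_of_op T) e -> (0 < N)%N ->
  close (conv_exp mu) (charge_of_op ((1 + op_const V N%:R^-1 * T) ^+ N))
    (e * expR (4 * k) + expR (4 * k) / N%:R).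
Proof.
move=> k1 hk Tk h N0 A B mA mB; have e0 := close_ge0 h.
have k0 : 0 <= k by lra.
set W := (1 + _) ^+ N; rewrite !(cval_conv_exp hk)//.
have cA := term_cvg hk mA; have cB := term_cvg hk mB.
set c := _ + _ / _.
suff : limn (series (term mu A) - series (term mu B)) <=
    c + cval (charge_of_op W) A - cval (charge_of_op W) B.
  by rewrite limB//; lra.
apply: limr_le; first exact: is_cvgB.
near=> J; have NJ : (N < J)%N by near: J; exact: nbhs_infty_gt.
have P := close_op (bnd_exp_approx k0 Tk N0 NJ) mA mB.
rewrite -/W in P.
have PE X : measurable X ->
    cval (charge_of_op (\sum_(j < J) op_const V j`!%:R^-1 * T ^+ j)) X =
    \sum_(j < J) j`!%:R^-1 * cval (charge_of_op (T ^+ j)) X.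
  move=> mX; rewrite cval_op// op_sumE; apply: eq_bigr => j _.
  by rewrite op_mulE op_constE cval_op.
rewrite !PE// in P.
have Q : \sum_(j < J) j`!%:R^-1 * ((cval (conv_pow mu j) A - cval (charge_of_op (T ^+ j)) A) -
    (cval (conv_pow mu j) B - cval (charge_of_op (T ^+ j)) B)) <= e * expR (4 * k).
  apply: (@le_trans _ _ (\sum_(j < J) e * (j`!%:R^-1 * (4 * k) ^+ j))); last first.
    by rewrite -mulr_sumr; apply: ler_wpM2l => //; apply: exp_partial_le; rewrite mulr_ge0.
  apply: ler_sum => j _; rewrite [leRHS]mulrCA; apply: ler_wpM2l; first by rewrite invr_ge0.
  apply: le_trans (close_conv_pow j k1 hk Tk h mA mB) _.
  rewrite mulrCA exprMn; apply: ler_wpM2l => //; apply: ler_wpM2r; first exact: exprn_ge0.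
  have := nat_le_exp4 j; case: (nat_of_ord j) => [|i]; first by rewrite expr0.
  by move=> /(le_trans _); apply; rewrite expr2 ler_peMl// ler1n.
have SE X : series (term mu X) J = \sum_(j < J) j`!%:R^-1 * cval (conv_pow mu j) X.
  by rewrite /series /= big_mkord.
rewrite -[leLHS]/(series (term mu A) J - series (term mu B) J) !SE /c.
move: P Q; under [X in _ -> X <= _ -> _]eq_bigr do rewrite !mulrBr.
rewrite !sumrB.
set a1 := \sum_(j < J) _; set a2 := \sum_(j < J) _; set a3 := \sum_(j < J) _; set a4 := \sum_(j < J) _.
lra.
Unshelve. all: by end_near. Qed.

End conv_exp_approx.

End exponential_stability.

(** * Truncation of lattice distributions *)

Section lattice_truncation.
Context (R : realType) (d : nat).
Local Notation V := 'rV[R]_d.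

Let coord_preimage (i : 'I_1) (j : 'I_d) (B : set R) : measurable B ->
  measurable ((fun A : V => A i j) @^-1` B).
Proof. by move=> mB; rewrite -[X in measurable X]setTI; exact: measurable_coord_mx. Qed.

Lemma measurable_point (x : V) : measurable [set x].
Proof.
rewrite (_ : [set x] = \bigcap_(p in [set: 'I_1 * 'I_d])
    ((fun A : V => A p.1 p.2) @^-1` [set x p.1 p.2])).
  by apply: fin_bigcap_measurable => // p _; exact: coord_preimage.
apply/seteqP; split=> [A -> //|A h]; apply/matrixP => i j.
exact: (h (i, j)).
Qed.

Let cube (q : 'M[rat]_(1, d) * rat) : set V :=
  [set A | forall i j, ball (ratr (q.1 i j) : R) (ratr q.2) (A i j)].

Let measurable_cube q : measurable (cube q).
Proof.
rewrite (_ : cube q = \bigcap_(p in [set: 'I_1 * 'I_d])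
    ((fun A : V => A p.1 p.2) @^-1` ball (ratr (q.1 p.1 p.2) : R) (ratr q.2))).
  apply: fin_bigcap_measurable => // p _; apply: coord_preimage.
  exact: measurable_ball.
by apply/seteqP; split=> [A h p _ //=|A h i j]; exact: (h (i, j)).
Qed.

Let open_cube (U : set V) x : open U -> U x -> exists2 q, cube q x & cube q `<=` U.
Proof.
move=> oU Ux; have /nbhs_ballP[e /= e0 eU] := open_nbhs_nbhs (conj oU Ux).
have [r /itvP re] := rat_in_itvoo (divr_gt0 e0 (ltr0Sn R 1)).
have r0 : 0 < ratr r :> R by rewrite re.
have cA j : {q : rat | ball (ratr q : R) (ratr r) (x ord0 j)}.
  apply: cid; have [|q qA] := @rat_in_itvoo R (x ord0 j - ratr r) (x ord0 j).
    by rewrite ltrBlDr ltrDl.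
  exists q; move: qA => /itvP qA.
  by rewrite /ball /= distrC gtr0_norm ?subr_gt0 ?qA// ltrBlDr -ltrBlDl qA.
exists (\matrix_(i, j) sval (cA j), r) => [i j|A h].
  by rewrite mxE (ord1 i); case: (cA j).
apply: eU; split=> // i j; have := h i j; rewrite /= mxE (ord1 i).
have : ball (ratr (sval (cA j)) : R) (ratr r) (x ord0 j) by case: (cA j).
move=> /ball_sym /ball_triangle /[apply]; apply: le_ball.
by rewrite [leRHS]splitr lerD// ltW// re.
Qed.

(* By Lindelof: the complement of the support is covered by countably many
   null cubes with rational centre and radius. *)
Lemma msupport_null (mu : {measure set V -> \bar R}) (S : set V) :
  measurable S -> msupport mu `<=` S -> mu (~` S) = 0%E.
Proof.
move=> mS supS.
pose C n : set V := if @unpickle ('M[rat]_(1, d) * rat)%type n is Some q then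
  (if mu (cube q) == 0%E then cube q else set0) else set0.
have mC n : measurable (C n).
  by rewrite /C; case: unpickle => // q; case: ifP.
have C0 n : mu (C n) = 0%E.
  by rewrite /C; case: unpickle => // q; case: ifP => // /eqP.
have sub : ~` S `<=` \bigcup_n C n.
  move=> x Sx; have : ~ msupport mu x by move=> /supS.
  move=> /existsNP[U /not_implyP[oU /not_implyP[Ux /negP]]].
  rewrite -leNgt => U0; have [q qx qU] := open_cube oU Ux.
  exists (pickle q) => //; rewrite /C pickleK.
  rewrite (_ : mu (cube q) == 0%E)//; apply/eqP/le_anti; rewrite measure_ge0 andbT.
  by apply: le_trans U0; apply: le_measure; rewrite ?inE//; exact: open_measurable_mx.
apply/le_anti; rewrite measure_ge0 andbT.
apply: le_trans (measure_sigma_subadditive mu mC (measurableC mS) sub) _.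
by rewrite eseries0.
Qed.

Section line.
Context (mu : probability V R) (y : V).
Hypotheses (y0 : y != 0)
  (supp : msupport mu `<=` [set x | exists2 k : int, k != 0 & x = k%:~R *: y])
  (sym : forall k : nat, (0 < k)%N -> mu [set k%:R *: y] = mu [set - k%:R *: y]).

Let pt k : V := k.+1%:R *: y.
Let nt k : V := - k.+1%:R *: y.
Let om k : R := fine (mu [set pt k]).

Fixpoint sym_points L : set V :=
  if L is L'.+1 then sym_points L' `|` ([set pt L'] `|` [set nt L']) else set0.

Let om_ge0 k : 0 <= om k. Proof. by rewrite fine_ge0. Qed.

Let measurable_sym_points L : measurable (sym_points L).
Proof.
by elim: L => //= L ih; apply: measurableU => //; apply: measurableU; exact: measurable_point.
Qed.

Let sym_pointsP L x : sym_points L x <-> exists2 k, (k < L)%N & x = pt k \/ x = nt k.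
Proof.
elim: L => [|L ih] /=; first by split=> // -[].
split=> [[/ih[k kL h]|[->|->]]|[k]].
- by exists k => //; exact: ltnW.
- by exists L; [exact: ltnSn|left].
- by exists L; [exact: ltnSn|right].
- rewrite ltnS leq_eqVlt => /orP[/eqP -> [->|->]|kL h]; [by right; left|by right; right|].
  by left; apply/ih; exists k.
Qed.

Let line_inj (a b : R) : a *: y = b *: y -> a = b.
Proof.
move=> /eqP; rewrite -subr_eq0 -scalerBl scaler_eq0 (negPf y0) orbF subr_eq0.
by move/eqP.
Qed.

Let mu_pt A x : measurable A -> fine (mu (A `&` [set x])) = fine (mu [set x]) * \1_A x.
Proof.
move=> mA; rewrite indicE; have [xA|xA] := boolP (x \in A).
  rewrite mulr1 (_ : A `&` [set x] = [set x])//.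
  by apply/seteqP; split=> [z []//|z ->]; split=> //; rewrite -in_setE.
rewrite mulr0 (_ : A `&` [set x] = set0) ?measure0//.
by apply/seteqP; split=> // z [Az zx]; move: xA; rewrite notin_setE -zx; exact.
Qed.

Let mass A L : measurable A -> fine (mu (A `&` sym_points L)) =
  \sum_(k < L) om k * (\1_A (pt k) + \1_A (nt k)).
Proof.
move=> mA; elim: L => [|L ih]; first by rewrite big_ord0 /= setI0 measure0.
have mpt x : measurable (A `&` [set x]) by apply: measurableI => //; exact: measurable_point.
rewrite big_ord_recr /= -ih !setIUr.
have notin x : x = pt L \/ x = nt L -> ~ sym_points L x.
  move=> xL /sym_pointsP[k kL].
  by case: xL => ->; rewrite /pt /nt => -[] /line_inj /eqP;
    rewrite ?eqr_opp ?eqr_nat ?eqSS ?gtn_eqF// -subr_eq0 ?opprK -?opprD ?oppr_eq0 -natrD pnatr_eq0.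
rewrite measureU; last 3 first.
- exact: measurableI.
- exact: measurableU.
- apply/seteqP; split=> // x [[_ h]]; rewrite -setIUr => -[_ [|] e]; apply: (notin x) h; [left|right]; exact: e.
rewrite measureU//; last first.
  apply/seteqP; split=> // x [[_ /= ->] [_ /= /line_inj /eqP]].
  by rewrite -subr_eq0 opprK -natrD pnatr_eq0.
rewrite fineD ?fin_numD ?fin_num_measure//; last exact: measurableI.
rewrite fineD ?fin_num_measure//; congr (_ + _).
by rewrite !mu_pt// mulrDr; congr (_ + _); rewrite /om /nt -sym.
Qed.

(** The nonzero integer multiples of [y] form a countable, hence measurable, set containing the
    support, so [msupport_null] gives it full mass. *)
Let mass_cvg (delta : R) : 0 < delta -> exists L, 1 - delta <= fine (mu (sym_points L)).
Proof.
move=> d0; pose S := \bigcup_n sym_points n.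
have mS : measurable S by exact: bigcupT_measurable.
have S1 : mu S = 1%E.
  have : mu (~` S) = 0%E.
    apply: msupport_null => // x /supp[k k0 ->].
    case: k k0 => n n0.
      case: n n0 => // n _; exists n.+1 => //; apply/sym_pointsP; exists n => //; left.
      by rewrite /pt.
    exists n.+1 => //; apply/sym_pointsP; exists n => //; right.
    by rewrite /nt NegzE mulrNz.
  by rewrite probability_setC// => /eqP; rewrite sube_eq// ?add0e => /eqP.
have nd : nondecreasing_seq sym_points.
  apply/nondecreasing_seqP => n; apply/subsetPset; exact: subsetUl.
have : mu \o sym_points @ \oo --> 1%E.
  by rewrite -S1; exact: nondecreasing_cvg_mu.
move=> /fine_cvgP[_ /cvgrPdist_lt /(_ _ d0)] [N _ /(_ N (leqnn _))].
move=> h; exists N; move: h => /=; rewrite ltr_norml; lra.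
Qed.

(** Conditioning on the first [L] pairs. Kept mass [rho >= 1/2] raises the second moment to at most
    [2 * s ^+ 2]; the value [2 * (1 + s)] dominates its square root and is at least [1], as
    [sym_l1_bound] requires of its [sigma]. *)
Lemma lattice_approx (s delta : R) : lattice_sigma mu y = s%:E -> 0 < delta ->
  0 <= s /\ exists L (w : 'I_L -> R), [/\ forall i, 0 <= w i, \sum_i w i = 1,
    \sum_i w i * i.+1%:R ^+ 2 <= (2 * (1 + s)) ^+ 2 &
    close (charge_of_finite_measure mu) (charge_of_op (sym_op w y)) delta].
Proof.
move=> sE d0.
have s0 : 0 <= s by rewrite -lee_fin -sE sqrte_ge0.
have moment L : 2 * \sum_(k < L) om k * k.+1%:R ^+ 2 <= s ^+ 2.
  move: sE; rewrite /lattice_sigma.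
  set U := (\sum_(1 <= k <oo) _)%E => sE.
  have U0 : (0 <= 2%:E * U)%E.
    by rewrite mule_ge0//; apply: nneseries_ge0 => k _ _; rewrite mule_ge0 ?lee_fin ?sqr_ge0.
  have US : (2%:E * U = (s ^+ 2)%:E)%E.
    move: U0 sE; case: (2%:E * U)%E => [r|//|//] r0 /= [<-].
    by rewrite sqr_sqrtr.
  rewrite -lee_fin -US EFinM; apply: lee_wpmul2l => //.
  have -> : (\sum_(k < L) om k * k.+1%:R ^+ 2)%:E =
      (\sum_(1 <= k < L.+1) (k%:R ^+ 2)%:E * mu [set k%:R *: y])%E.
    rewrite big_add1 /= big_mkord -sumEFin; apply: eq_bigr => k _.
    by rewrite mulrC EFinM /om fineK// fin_num_measure//; exact: measurable_point.
  by apply: nneseries_lim_ge => k _ _; rewrite mule_ge0 ?lee_fin ?sqr_ge0.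
(* The first bound gives [rho >= 1/2]. The second is needed because each measurable set changes its
   mass by at most [1 - rho], so oscillations change by at most twice that. *)
split=> //; pose e := Num.min 2^-1 (delta / 2).
have e0 : 0 < e by rewrite lt_min invr_gt0 ltr0n divr_gt0.
have [L hL] := mass_cvg e0; exists L.
set rho := fine _ in hL.
have e1 : e <= 2^-1 by rewrite ge_min lexx.
have e2 : e <= delta / 2 by rewrite ge_min lexx orbT.
have rho0 : 2^-1 <= rho by lra.
have rhoE : rho = \sum_(k < L) om k * 2.
  rewrite /rho -[sym_points L]setTI mass//; apply: eq_bigr => k _.
  by rewrite !indicE !in_setT.
have rho1 : rho <= 1.
  by rewrite -lee_fin /rho fineK ?fin_num_measure//; exact: probability_le1.
exists (fun k : 'I_L => om k * 2 / rho); split.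
- by move=> i; rewrite divr_ge0 ?mulr_ge0//; lra.
- by rewrite -mulr_suml -rhoE divff// gt_eqF//; lra.
- rewrite (_ : \sum_i _ = (2 * \sum_(k < L) om k * k.+1%:R ^+ 2) / rho); last first.
    by rewrite mulr_sumr mulr_suml; apply: eq_bigr => k _; ring.
  rewrite ler_pdivrMr; last by lra.
  apply: le_trans (moment L) _; have := sqr_ge0 s; nra.
- have val A : measurable A ->
      cval (charge_of_op (sym_op (fun k : 'I_L => om k * 2 / rho) y)) A =
      fine (mu (A `&` sym_points L)) / rho.
    move=> mA; rewrite cval_op// mass// /sym_op op_sumE mulr_suml; apply: eq_bigr => k _.
    rewrite op_mulE op_constE op_addE -!op_shiftMn !op_shiftE !add0r.
    rewrite (_ : y *+ k.+1 = pt k); last by rewrite /pt scaler_nat.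
    rewrite (_ : - y *+ k.+1 = nt k); last by rewrite /nt scaleNr scaler_nat mulNrn.
    by field; rewrite gt_eqF//; lra.
  have bd A : measurable A -> - (1 - rho) <= cval (charge_of_finite_measure mu) A -
      fine (mu (A `&` sym_points L)) / rho <= 1 - rho.
    move=> mA.
    have mAS : measurable (A `&` sym_points L) by exact: measurableI.
    have mAD : measurable (A `\` sym_points L) by exact: measurableD.
    have E : cval (charge_of_finite_measure mu) A =
        fine (mu (A `&` sym_points L)) + fine (mu (A `\` sym_points L)).
      rewrite -fineD ?fin_num_measure//; congr fine.
      by rewrite /charge_of_finite_measure addeC -[LHS]/(mu A) (measureDI mu mA (measurable_sym_points L)).
    have D1 : fine (mu (A `\` sym_points L)) <= 1 - rho.
      rewrite -lee_fin fineK ?fin_num_measure// EFinB /rho fineK ?fin_num_measure//.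
      by rewrite -probability_setC//; apply: le_measure; rewrite ?inE//; exact: measurableC.
    have I1 : fine (mu (A `&` sym_points L)) <= rho.
      apply: fine_le; rewrite ?fin_num_measure//.
      by apply: le_measure; rewrite ?inE// => x [].
    have D0 : 0 <= fine (mu (A `\` sym_points L)) by rewrite fine_ge0.
    have I0 : 0 <= fine (mu (A `&` sym_points L)) by rewrite fine_ge0.
    rewrite E; set a := fine (mu (A `&` _)) in I1 I0 *; set b := fine _ in D1 D0 *.
    have : a <= a / rho by rewrite ler_pdivlMr; [nra|lra].
    have : a / rho <= a + (1 - rho).
      by rewrite ler_pdivrMr; [nra|lra].
    lra.
  rewrite /close => A B mA mB; rewrite !val//.
  have /andP[_ h1] := bd A mA; have /andP[h2 _] := bd B mB.
  by apply: le_trans (lerB h1 h2) _; rewrite opprK; lra.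
Qed.

End line.
End lattice_truncation.

(** * The theorem *)

Section assembly.
Context (R : realType) (d : nat).
Local Notation V := 'rV[R]_d.
Local Notation op := (transop R V).
Local Notation cst := (@op_const R V).
Implicit Types (mu nu : {charge set V -> \bar R}).

Lemma close_sub mu nu (S T : op) (e e' : R) :
  close mu (charge_of_op S) e -> close nu (charge_of_op T) e' ->
  close (charge_sub mu nu) (charge_of_op (S - T)) (e + e').
Proof.
move=> h k A B mA mB; have := h A B mA mB; have := k B A mB mA.
by rewrite !cval_sub// !cval_op// !op_addE !op_oppE; lra.
Qed.

Lemma close_scale mu (T : op) (c e : R) : 0 <= c ->
  close mu (charge_of_op T) e -> close (cscale c mu) (charge_of_op (cst c * T)) (c * e).
Proof.
move=> c0 h A B mA mB; have := ler_wpM2l c0 (h A B mA mB).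
by rewrite !cval_scale// !cval_op// !op_mulE !op_constE; lra.
Qed.

Lemma osc_sub mu nu (a b : R) : osc_le mu a -> osc_le nu b ->
  osc_le (charge_sub mu nu) (a + b).
Proof.
move=> h k A B mA mB; have := h A B mA mB; have := k B A mB mA.
by rewrite !cval_sub//; lra.
Qed.

Lemma osc_scale mu (c a : R) : 0 <= c -> osc_le mu a -> osc_le (cscale c mu) (c * a).
Proof.
move=> c0 h A B mA mB; have := ler_wpM2l c0 (h A B mA mB).
by rewrite !cval_scale//; lra.
Qed.

Lemma osc_close mu nu (a e : R) : close mu nu e -> osc_le nu a -> osc_le mu (a + e).
Proof. by move=> h k A B mA mB; have := h A B mA mB; have := k A B mA mB; lra. Qed.

Lemma osc_le_trans mu (a b : R) : osc_le mu a -> a <= b -> osc_le mu b.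
Proof. by move=> h ab A B mA mB; apply: le_trans (h A B mA mB) ab. Qed.

Lemma osc_probability (P : probability V R) : osc_le (charge_of_finite_measure P) 1.
Proof.
move=> A B mA mB; have h X : measurable X -> 0 <= cval (charge_of_finite_measure P) X <= 1.
  move=> mX; rewrite /cval fine_ge0 ?measure_ge0//=.
  by rewrite -lee_fin fineK ?fin_num_measure//; exact: probability_le1.
have /andP[_ hA] := h A mA; have /andP[hB _] := h B mB.
by rewrite -[leRHS]subr0 lerB.
Qed.

Definition main_const : R := 15552 * expR 5 * factor_const R ^+ 2.

Section bound.
Context (K : nat) (F : probability V R) (q : R) (p : 'I_K -> R)
  (Fm : 'I_K -> probability V R) (y : 'I_K -> V) (s : 'I_K -> R).
Hypotheses (q01 : 0 < q < 1) (p0 : forall m, 0 < p m)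
  (psum : \sum_(m < K) p m = 1 - q)
  (FE : forall A, measurable A ->
     F A = (q%:E * \d_(0%R : V) A + \sum_(m < K) (p m)%:E * Fm m A)%E)
  (y0 : forall m, y m != 0)
  (supp : forall m, msupport (Fm m) `<=`
     [set x | exists2 k : int, k != 0 & x = k%:~R *: y m])
  (sym : forall m (k : nat), (0 < k)%N ->
     Fm m [set k%:R *: y m] = Fm m [set - k%:R *: y m])
  (sE : forall m, lattice_sigma (Fm m) (y m) = (s m)%:E).

Let F' := charge_of_finite_measure F.
Let FI := charge_sub F' (charge_dirac0 R d).
Let Z := charge_sub FI (cscale (2^-1) (conv_pow FI 2)).
Let D := conv_exp Z.
Let b m := sym_const R * Num.sqrt (2 * (1 + s m)).

(** [op_F p f] equals [q + \sum_m p m * f m], so the atom at the origin is reproduced exactly and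
    only the components contribute an error. *)
Let close_F (f : 'I_K -> op) (delta : R) :
  (forall m, close (charge_of_finite_measure (Fm m)) (charge_of_op (f m)) delta) ->
  0 <= delta -> close F' (charge_of_op (op_F p f)) delta.
Proof.
move=> hf delta0 A B mA mB.
have val X : measurable X -> cval F' X - cval (charge_of_op (op_F p f)) X =
    \sum_(m < K) p m * (cval (charge_of_finite_measure (Fm m)) X - cval (charge_of_op (f m)) X).
  move=> mX; under eq_bigr do rewrite mulrBr.
  rewrite sumrB.
  have -> : cval F' X = q * \1_X 0 + \sum_(m < K) p m * cval (charge_of_finite_measure (Fm m)) X.
    have -> : cval F' X = fine (F X) by [].
    have PE m : ((p m)%:E * Fm m X = (p m * cval (charge_of_finite_measure (Fm m)) X)%:E)%E.
      by rewrite EFinM -cvalE.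
    rewrite (FE mX) diracE; under eq_bigr do rewrite PE.
    by rewrite sumEFin -EFinM -EFinD /= indicE.
  have -> : cval (charge_of_op (op_F p f)) X =
      q * \1_X 0 + \sum_(m < K) p m * cval (charge_of_op (f m)) X.
    rewrite cval_op// /op_F /op_A op_addE op_1E op_sumE.
    under eq_bigr do rewrite op_mulE op_constE op_addE op_oppE op_1E mulrBr.
    rewrite sumrB -mulr_suml psum.
    under [X in _ = _ + X]eq_bigr do rewrite cval_op//.
    by ring.
  by ring.
rewrite !val// -sumrB; under eq_bigr do rewrite -mulrBr.
apply: (@le_trans _ _ (\sum_(m < K) p m * delta)).
  by apply: ler_sum => m _; apply: ler_wpM2l; [exact: ltW|exact: hf].
by rewrite -mulr_suml psum ler_piMl//; move: q01; lra.
Qed.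

(** The order of choices matters: [delta] depends on [n] and [eta] only, the truncated components
    [f] on [delta], the constant [C0] of the core estimate may depend on [f], and [N] comes last. *)
Lemma close_power_bound (n : nat) (eta : R) : (0 < n)%N -> 0 < eta ->
  close (conv_pow F' n) (conv_pow D n)
    (main_const / (n%:R ^+ 2 * q ^+ 5) * (\sum_m b m) ^+ 3 + eta).
Proof.
move=> n0 eta0.
(* [Z] has norm at most [2 + 2 ^ 2 / 2 = 4], so [E = expR (4 * 4)] is the constant of
   [close_conv_exp]. In [a], which bounds both D and its substitute, [expR 4] bounds the substitute
   and [2 * E] the distance between them. *)
pose E := expR (16 : R); have E1 : 1 <= E.
  by apply: le_trans (expR_ge1Dx _); lra.
pose a := expR (4 : R) + 2 * E; have a1 : 1 <= a.
  by rewrite /a; have := expR_ge0 (4 : R); lra.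
have an0 : 0 < a ^+ n by rewrite exprn_gt0//; lra.
have nR : 0 < n%:R :> R by rewrite ltr0n.
(* The total coefficient of [delta]: one part from the powers of F, the other from those of D, where
   [5 = 1 + 2 * 2 ^ 2 / 2] is the loss in passing from [FI] to [Z]. *)
pose La := n%:R + 5 * n%:R * E * a ^+ n.
have La0 : 0 < La.
  by rewrite /La; have := mulr_gt0 (mulr_gt0 nR (lt_le_trans ltr01 E1)) an0; lra.
pose delta := Num.min 5^-1 (eta / 2 / La).
have d0 : 0 < delta by rewrite lt_min invr_gt0 ltr0n !divr_gt0.
have d1 : delta <= 5^-1 by rewrite ge_min lexx.
have d2 : delta * La <= eta / 2 by rewrite -ler_pdivlMr// ge_min lexx orbT.
have /choice[f hf] : forall m, exists f : op, [/\ bnd f 1,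
    close (charge_of_finite_measure (Fm m)) (charge_of_op f) delta &
    forall M eps, 0 < eps <= 2^-1 -> (0 < M)%N ->
    bnd ((f - 1) * (1 + cst eps * (f - 1)) ^+ M) (b m / (eps * M%:R))].
  move=> m; have [s0 [L [w [w0 w1 w2 wc]]]] :=
    lattice_approx (y0 m) (@supp m) (@sym m) (sE m) d0.
  exists (sym_op w (y m)); split=> //; first exact: bnd_sym_op.
  by move=> M eps e01 M0; apply: bnd_sym_smooth => //; lra.
have f1 m : bnd (f m) 1 by case: (hf m).
have fc m : close (charge_of_finite_measure (Fm m)) (charge_of_op (f m)) delta by case: (hf m).
have fs m : forall M eps, 0 < eps <= 2^-1 -> (0 < M)%N ->
    bnd ((f m - 1) * (1 + cst eps * (f m - 1)) ^+ M) (b m / (eps * M%:R)) by case: (hf m).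
have cF := close_F fc (ltW d0).
have bF := bnd_op_F q01 p0 psum f1.
have bA := bnd_op_A q01 p0 psum f1.
have bX := bnd_op_X q01 p0 psum f1.
have cFn := close_conv_pow n (lexx 1) (osc_probability F) bF cF.
have oFI : osc_le FI 2.
  by apply: osc_le_trans (osc_sub (osc_probability F) (@osc_dirac0 R d)) _; lra.
have cFI : close FI (charge_of_op (op_A p f)) delta.
  have c1 : close (charge_dirac0 R d) (charge_of_op (1 : op)) 0.
    by apply: close_eq => A mA; rewrite cval_op// op_1E; exact: cval_dirac.
  by have := close_sub cF c1; rewrite /op_F addrC addKr addr0.
have cZ : close Z (charge_of_op (op_X p f)) (5 * delta).
  have c2 := close_conv_pow 2 (ler1n R 2) oFI bA cFI.
  have h2 : 0 <= 2^-1 :> R by rewrite invr_ge0.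
  by apply: close_le (close_sub cFI (close_scale h2 c2)) _; lra.
have oZ : osc_le Z 4.
  have h2 : 0 <= 2^-1 :> R by rewrite invr_ge0.
  by apply: osc_le_trans (osc_sub oFI (osc_scale h2 (osc_conv_pow 2 oFI))) _; lra.
have [C0 C00 hC] := core_estimate q01 p0 psum f1 fs n0.
pose G := C0 + n%:R * E * a ^+ n.
have E0 : 0 <= E by exact: expR_ge0.
have G0 : 0 <= G.
  by apply: addr_ge0 => //; apply: mulr_ge0 (ltW an0); apply: mulr_ge0.
(* One threshold serves both needs: [32 / q <= N] for the core estimate and [G / N <= eta / 2] for
   the remaining error. *)
pose M := (Num.bound (32 / q + G / (eta / 2))).+1.
pose N := (3 * M)%N.
have q0 : 0 < q by case/andP: q01.
have Nbig : 32 / q + G / (eta / 2) <= N%:R.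
  have x0 : 0 <= 32 / q + G / (eta / 2).
    by rewrite addr_ge0// ?divr_ge0// ltW// divr_gt0.
  apply: le_trans (ltW (archi_boundP x0)) _.
  by rewrite ler_nat /N /M mulnC (leq_trans (leqnSn _))// leq_pmulr.
have NG : G / N%:R <= eta / 2.
  rewrite ler_pdivrMr; last by rewrite ltr0n.
  rewrite mulrC -ler_pdivrMr; last by rewrite divr_gt0.
  by apply: le_trans Nbig; rewrite lerDr divr_ge0// ltW.
have Nq : 32 / q <= N%:R.
  by apply: le_trans Nbig; rewrite lerDl divr_ge0// divr_ge0// ltW.
have N1 : 1 <= N%:R :> R by rewrite ler1n.
have core := hC M isT Nq; rewrite -/N in core.
set W := (1 + cst N%:R^-1 * op_X p f) ^+ N in core.
have bW : bnd W (expR 4) := bnd_W q01 p0 psum f1 (isT : (0 < M)%N).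
have cD : close D (charge_of_op W) (5 * delta * E + E / N%:R).
  have := close_conv_exp (ler1n R 4) oZ bX cZ (isT : (0 < N)%N).
  by rewrite -/W (_ : 4 * 4 = 16)// -natrM.
have cle : 5 * delta * E + E / N%:R <= 2 * E.
  rewrite (_ : 2 * E = 1 * E + E); last by ring.
  apply: lerD; last by rewrite ler_pdivrMr ?ltr0n// ler_peMr.
  by apply: ler_wpM2r => //; rewrite mulrC -ler_pdivlMr// div1r.
have oD : osc_le D a.
  by apply: osc_le_trans (osc_close cD (osc_op bW)) _; rewrite /a lerD2l.
have bWa : bnd W a by apply: bnd_le bW _; rewrite /a lerDl mulr_ge0.
have cDn := close_sym (close_conv_pow n a1 oD bWa cD).
apply: close_le (close_trans cFn (close_trans (close_op core) cDn)) _.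
rewrite /main_const -/(op_X _ _) expr1n mulr1.
set beta := _ / _ * _ ^+ 3.
rewrite [leLHS](_ : _ = beta + (delta * La + G / N%:R)); last by rewrite /La /G; ring.
by rewrite lerD2l [leRHS]splitr; exact: lerD.
Qed.

End bound.
End assembly.

Local Open Scope ereal_scope.

Theorem theorem8 (R : realType) :
  exists2 C : R, (0 < C)%R &
  forall (d K : nat) (F : probability 'rV[R]_d R) (q : R) (p : 'I_K -> R)
    (Fm : 'I_K -> probability 'rV[R]_d R) (y : 'I_K -> 'rV[R]_d),
  (0 < d)%N -> (d <= K)%N ->
  (0 < q < 1)%R ->
  (forall m, (0 < p m < 1)%R) ->
  (\sum_(m < K) p m = 1 - q)%R ->
  (forall A, measurable A ->
     F A = q%:E * \d_(0%R : 'rV[R]_d) A + \sum_(m < K) (p m)%:E * Fm m A) ->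
  (forall m, y m != 0%R) ->
  (forall m, msupport (Fm m) `<=`
     [set x | exists2 k : int, k != 0%R & x = (k%:~R *: y m)%R]) ->
  (forall m k, k != m -> msupport (Fm m) `&` msupport (Fm k) = set0) ->
  (forall m, msupport (Fm m) !=set0) ->
  (forall m (k : nat), (0 < k)%N ->
     Fm m [set (k%:R *: y m)%R] = Fm m [set (- k%:R *: y m)%R]) ->
  (forall m, exists k0 : int,
     0 < Fm m [set (k0%:~R *: y m)%R] /\
     0 < Fm m [set ((k0 + 1)%:~R *: y m)%R]) ->
  forall n : nat, (0 < n)%N ->
  let F' := charge_of_finite_measure F in
  let FI := charge_sub F' (charge_dirac0 R d) in
  let D := conv_exp (charge_sub FI (cscale (2^-1)%R (conv_pow FI 2))) in
  d_TV (conv_pow F' n) (conv_pow D n) <=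
    (C / (n%:R ^+ 2 * q `^ (13 / 2)))%:E *
    (\sum_(m < K) sqrte (1 + lattice_sigma (Fm m) (y m))) ^+ 3.
Proof.
have mc0 : (0 <= main_const R)%R.
  by apply: mulr_ge0 (sqr_ge0 _); apply: mulr_ge0 (expR_ge0 _); exact: ler0n.
have sc0 : (0 <= sym_const R * Num.sqrt 2)%R by rewrite mulr_ge0 ?sqrtr_ge0.
(* The summand [1] makes [C] strictly positive; its factor [(sym_const R * Num.sqrt 2) ^+ 3] is what
   [b m = sym_const R * Num.sqrt (2 * (1 + s m))] leaves after [Num.sqrt (1 + s m)] is taken out. *)
pose C : R := (main_const R * (sym_const R * Num.sqrt 2) ^+ 3 + 1)%R.
have C0 : (0 < C)%R by rewrite ltr_wpDl// mulr_ge0// exprn_ge0.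
exists C => // d K F q p Fm y _ _ q01 p01 psum FE y0 supp _ _ sym _ n n0; cbv zeta.
have q0 : (0 < q)%R by case/andP: q01.
have nq0 : (0 < n%:R ^+ 2 * q `^ (13 / 2))%R.
  by rewrite mulr_gt0 ?powR_gt0// exprn_gt0// ltr0n.
have Cn0 : (0 < C / (n%:R ^+ 2 * q `^ (13 / 2)))%R by rewrite divr_gt0.
have sig0 m : 0 <= lattice_sigma (Fm m) (y m) by exact: sqrte_ge0.
(* An infinite [sigma] makes the right-hand side [+oo], since the prefactor is strictly positive and
   the other summands are nonnegative. *)
have [[m0 sm0]|fin] := pselect (exists m, lattice_sigma (Fm m) (y m) = +oo).
  rewrite (_ : \sum_(m < K) _ = +oo).
    by rewrite !expeS expe0 mule1 !mulyy gt0_muley// leey.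
  rewrite (bigD1 m0)//= sm0 [sqrte _]/= addye//.
  rewrite gt_eqF//; apply: lt_le_trans (ltNyr 0%R) _.
  by apply: sume_ge0 => m _; exact: sqrte_ge0.
have sE m : {s : R | (0 <= s)%R & lattice_sigma (Fm m) (y m) = s%:E}.
  move: (sig0 m) (fun h => fin (ex_intro _ m h)).
  by case: (lattice_sigma _ _) => [s s0 _|_ /(_ erefl)//|//]; exists s.
pose s m := s2val (sE m).
have s0 m : (0 <= s m)%R by exact: (s2valP (sE m)).
have sEs m : lattice_sigma (Fm m) (y m) = (s m)%:E by exact: (s2valP' (sE m)).
have -> : \sum_(m < K) sqrte (1 + lattice_sigma (Fm m) (y m)) =
    (\sum_(m < K) Num.sqrt (1 + s m))%:E.
  by rewrite -sumEFin; apply: eq_bigr => m _; rewrite sEs.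
set B := (\sum_(m < K) _)%R; have B0 : (0 <= B)%R by apply: sumr_ge0 => m _; exact: sqrtr_ge0.
(* The slack [eta] absorbs truncation and discretisation together, neither of which occurs in the
   statement. *)
rewrite -EFin_expe -EFinM; apply/lee_addgt0Pr => eta eta0.
have p0 m : (0 < p m)%R by case/andP: (p01 m).
have h := close_power_bound q01 p0 psum FE y0 supp sym sEs n0 eta0.
apply: le_trans (d_TV_le h) _; rewrite -EFinD lee_fin.
have -> : (\sum_m sym_const R * Num.sqrt (2 * (1 + s m)) = sym_const R * Num.sqrt 2 * B)%R.
  by rewrite mulr_sumr; apply: eq_bigr => m _; rewrite sqrtrM// mulrA.
(* The estimate proved has [q ^+ 5] in the denominator; [q <= 1] makes it at least as strong as the
   stated one. *)
have q5 : (q `^ (13 / 2) <= q ^+ 5)%R.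
  have qle : (0 < q <= 1)%R by rewrite q0 ltW//; case/andP: q01.
  by rewrite -powR_mulrn ?(ltW q0)//; apply: (ger_powR qle); lra.
have P0 : (0 < n%:R ^+ 2 * q ^+ 5)%R.
  by apply: mulr_gt0; rewrite exprn_gt0// ltr0n.
have : (main_const R / (n%:R ^+ 2 * q ^+ 5) * (sym_const R * Num.sqrt 2 * B) ^+ 3 <=
    C / (n%:R ^+ 2 * q `^ (13 / 2)) * B ^+ 3)%R.
  rewrite exprMn mulrA; apply: ler_wpM2r; first exact: exprn_ge0.
  rewrite mulrAC; apply: ler_pM.
  - by apply: mulr_ge0; [exact: mc0|exact: exprn_ge0].
  - by rewrite invr_ge0 ltW.
  - by rewrite /C lerDl.
  - by rewrite lef_pV2 ?posrE// ler_wpM2l// exprn_ge0.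
have : (0 <= main_const R / (n%:R ^+ 2 * q ^+ 5) * (sym_const R * Num.sqrt 2 * B) ^+ 3)%R.
  apply: mulr_ge0; last by apply: exprn_ge0; exact: mulr_ge0.
  by apply: divr_ge0; [exact: mc0|exact: ltW].
set X := (_ / _ * (_ * _) ^+ 3)%R; set Y := (C / _ * _)%R.
by move: X Y => X Y X0 XY; lra.
Qed.
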